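(* Let $M$ be a square-free positive integer. Then $$\sum_{\substack{1<n\le N,\ (n,M)=1\\ n\ \text{non-square}}}\left(\sum_{\substack{d\le X,\ (d,M)=1\\ d\ \equiv\ \text{non-zero square}\bmod M}}\chi_d(n)\right)^2\ll NM^2X\log^{10}(NM),$$ where the inner sum is over even fundamental discriminants $d$, $0<d\le X$, relatively prime to $M$, that are congruent to a non-zero square modulo $M$. The same bound holds if instead the $d$-sum is restricted to $d$ that are non-squares modulo $M$.
   Context: An even fundamental discriminant is a positive fundamental discriminant $d$, i.e. $d>0$ with either $d\equiv1\bmod4$ squarefree, or $4\mid d$ with $d/4\equiv2,3\bmod4$ squarefree. $\chi_d(n)=\left(\frac dn\right)$ is the Kronecker symbol. *)

(* Defs.v *)
From mathcomp Require Import all_boot all_order all_algebra.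
From mathcomp Require Import all_classical all_reals all_analysis.
Set Implicit Arguments.
Unset Strict Implicit.
Unset Printing Implicit Defensive.
Import Order.TTheory GRing.Theory Num.Theory.

Definition is_square (n : nat) : bool := [exists k : 'I_n.+1, n == k ^ 2].

Definition squarefree (m : nat) : bool :=
  [forall k : 'I_m.+1, (k ^ 2 %| m) ==> (k == 1 :> nat)].

Definition square_mod (M d : nat) : bool :=
  [exists y : 'I_M, d == y ^ 2 %[mod M]].

(* For M = 1 the only residue class is 0, and a literal reading would exclude
   every d; here that single class is admitted, so that M = 1 imposes no
   condition on d. *)
Definition nonzero_square_mod (M d : nat) : bool :=
  [exists y : 'I_M, (d == y ^ 2 %[mod M]) && ((1 < M) ==> ~~ (M %| y ^ 2))].

Definition even_fund_disc (d : nat) : bool :=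
  (0 < d) &&
  (((d %% 4 == 1) && squarefree d) ||
   [&& 4 %| d, (d %/ 4) %% 4 \in [:: 2; 3] & squarefree (d %/ 4)]).

(* (d / p) for p prime: Legendre's symbol for odd p. *)
Definition kronecker_prime (d p : nat) : int :=
  if p %| d then 0%R
  else if p == 2 then (if d %% 8 \in [:: 1; 7] then 1%R else (-1)%R)
  else if square_mod p d then 1%R else (-1)%R.

(* Kronecker's symbol (d / n) for n > 0; the cases n = 0 and d < 0 are not
   covered. *)
Definition kronecker (d n : nat) : int :=
  (\prod_(p <- primes n) kronecker_prime d p ^+ logn p n)%R.

(* The sum of chi_d(n) over the even fundamental discriminants d <= X that are
   prime to M and satisfy P. *)
Definition disc_sum (R : realType) (M : nat) (P : pred nat) (X : R) (n : nat)
    : int :=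
  (\sum_(1 <= d < (Num.truncn X).+1 |
      [&& even_fund_disc d, coprime d M & P d]) kronecker d n)%R.

Definition nonsquare_second_moment (R : realType) (M : nat) (P : pred nat)
    (N X : R) : int :=
  (\sum_(2 <= n < (Num.truncn N).+1 | coprime n M && ~~ is_square n)
      disc_sum M P X n ^+ 2)%R.

Lemma is_squareP n : reflect (exists k, n = k ^ 2) (is_square n).
Proof.
apply: (iffP existsP) => [[k /eqP->]|[k def_n]]; first by exists k.
have lekn : k < n.+1 by rewrite ltnS def_n; case: k {def_n} => // k; apply: leq_pmulr.
by exists (Ordinal lekn); apply/eqP.
Qed.

Lemma squarefreeP m :
  reflect (0 < m /\ forall k, k ^ 2 %| m -> k = 1) (squarefree m).
Proof.
apply: (iffP forallP) => [sqf|[m0 sqf] k]; last by apply/implyP=> /sqf ->.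
have m0 : 0 < m by case: m sqf => // /(_ ord0).
split=> // k k2m; have km : k < m.+1.
  rewrite ltnS; apply: leq_trans (dvdn_leq m0 k2m).
  by case: (k) => // j; apply: leq_pmulr.
by have /implyP/(_ k2m)/eqP := sqf (Ordinal km).
Qed.

Lemma square_modP M d : 0 < M ->
  reflect (exists y, d = y ^ 2 %[mod M]) (square_mod M d).
Proof.
move=> M0; apply: (iffP existsP) => [[y /eqP]|[y dy]]; first by exists y.
by exists (Ordinal (ltn_pmod y M0)); rewrite /= modnXm dy.
Qed.

Lemma nonzero_square_modP M d : 1 < M ->
  reflect (exists2 y, d = y ^ 2 %[mod M] & ~~ (M %| y ^ 2))
          (nonzero_square_mod M d).
Proof.
move=> M1; apply: (iffP existsP) => [[y /andP[/eqP dy]]|[y dy ndv]].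
  by rewrite M1 => ?; exists y.
exists (Ordinal (ltn_pmod y (ltnW M1))).
by rewrite /= modnXm dy eqxx M1 /dvdn modnXm.
Qed.

Lemma nonzero_square_mod1 d : nonzero_square_mod 1 d.
Proof. by apply/existsP; exists ord0; rewrite !modn1. Qed.

(* Main.v *)
(* For M = 1, open the square over d. Pairs (d1, d2) whose product is a square give the main term; for
   the other pairs quadratic reciprocity turns n |-> (d1 d2 / n) into a non-principal character, and the
   Polya-Vinogradov inequality suffices when the d-sum is shorter than sqrt N. A sum of length between
   sqrt N and N is replaced by its average over shifts of size sqrt N, the difference being made of short
   sums; Fourier inversion with a Gauss sum turns the average into a dual sum over g of effective length
   sqrt N, whose coefficients vary slowly with n, so that Abel summation and Polya-Vinogradov apply once
   more. Sums longer than N are bounded individually by Polya-Vinogradov. This treats squarefree n and all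
   d in a progression mod 8; sieving yields arbitrary n and squarefree d.
   For general M the indicator of the squares mod M, on d prime to M, is the mean of (d / m) over the odd
   m | M, and (d / m) (d / n) [(d, M) = 1] = (d / n') with n' = n m (M / m) ^ 2, which is again a
   non-square and is at most N M ^ 2 / m; this reduces the theorem to M = 1. *)
Require Import Defs.
From mathcomp Require Import all_boot all_order all_algebra all_solvable all_field.
From mathcomp Require Import all_classical all_reals all_analysis.
From mathcomp Require Import complex.
From mathcomp Require Import ring lra zify.
Set Implicit Arguments.
Unset Strict Implicit.
Unset Printing Implicit Defensive.
Import Order.TTheory GRing.Theory Num.Theory.
Import numFieldNormedType.Exports.
Local Open Scope ring_scope.

(** The bound contains no log X, although X may exceed every power of N. Hence the moment of a sum
    over a progression of size Y is kept in the form N min(N, Y): removing the square divisors k^2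
    of d then involves N min(N, X / k^2), and Cauchy-Schwarz with weights adapted to the turning
    point k ~ sqrt (X / N) costs only powers of log N. Even n are delicate. If n = 2^a t^2 with a
    odd, n is not a square, yet for odd d the symbol (d / n) depends only on d mod 8 and on whether
    d is prime to t, so Polya-Vinogradov saves nothing. What saves the bound is d = 1 mod 4: the
    classes 1 and 5 mod 8 enter with opposite signs and almost cancel. For the same reason pairs
    (d1, d2) whose product is twice a square are counted as diagonal. Powers of the logarithm:
    squarefree odd n cost four (two from partial summation with Polya-Vinogradov, two from the sum
    over dual frequencies), the square part of n one more, and the sieve to squarefree d two more.
    The resulting exponent 7 is weakened to 10 at the very end. *)

Lemma le_of_eq (T : porderType ring_display) (x y : T) : x = y -> (x <= y)%R.
Proof. by move=> ->. Qed.

(** * The Kronecker symbol and quadratic reciprocity *)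

Lemma kronecker_prime_dvd d p : (p %| d)%N -> kronecker_prime d p = 0.
Proof. by rewrite /kronecker_prime => ->. Qed.

Lemma kronecker_prime_sign d p :
  ~~ (p %| d)%N -> kronecker_prime d p = 1 \/ kronecker_prime d p = -1.
Proof.
rewrite /kronecker_prime => /negbTE ->.
by case: ifP => _; case: ifP => _; [left|right|left|right].
Qed.

Lemma kronecker_prime_odd d p : odd p -> kronecker_prime d p =
  if (p %| d)%N then 0 else if square_mod p d then 1 else -1.
Proof. by rewrite /kronecker_prime; case: eqP => [->|]. Qed.

(** Stated over any field of characteristic p, because reciprocity is proved by computing in a field
    that also contains roots of unity. *)
Lemma euler_criterion (K : fieldType) (p d : nat) : p \in [pchar K] -> odd p ->
  (kronecker_prime d p)%:~R = (d%:R : K) ^+ (p.-1)./2.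
Proof.
move=> chp oddp; have prp := pcharf_prime chp.
have p2 := odd_prime_gt2 oddp prp.
set m := (p.-1)./2.
have pE : p = (m.*2).+1.
  by have := odd_double_half p.-1; rewrite -/m; move: oddp p2; case: (p) => //= k; 
    case: (odd k) => //= _ _ <-.
have m0 : (0 < m)%N by lia.
have fer : (d%:R : K) ^+ p = d%:R by rewrite -(pFrobenius_autE chp) pFrobenius_aut_nat.
rewrite kronecker_prime_odd //; case: ifP => [pd|pd].
  move: pd; rewrite (dvdn_pcharf chp) => /eqP ->.
  by rewrite expr0n; case: (m) m0.
have d0 : (d%:R : K) != 0 by rewrite -(dvdn_pcharf chp) pd.
have dm : (d%:R : K) ^+ (m.*2) = 1.
  by apply: (mulfI d0); rewrite -exprS -pE fer mulr1.
have natr_inj (k j : nat) : (k < p)%N -> (j < p)%N -> (k%:R : K) = j%:R -> k = j.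
  move=> kp jp; wlog kj : k j kp jp / (k <= j)%N.
    by move=> W; case: (leqP k j) => [|/ltnW] le e; [exact: W|apply/esym; exact: W].
  move=> e; have : (p %| j - k)%N by rewrite (dvdn_pcharf chp) natrB // e subrr.
  move/dvdnP => [c cE]; case: c cE => [|c]; first by lia.
  by rewrite mulSn; lia.
case: ifP => [/square_modP|] sq.
  have [|y dy] := sq; first by lia.
  have -> : (d%:R : K) = y%:R ^+ 2.
    rewrite -natrX; have : forall a, (a%:R : K) = (a %% p)%N%:R.
      by move=> a; rewrite {1}(divn_eq a p) natrD natrM (pcharf0 chp) mulr0 add0r.
    by move=> mE; rewrite mE dy -mE.
  have y0 : (y%:R : K) != 0.
    apply: contraNneq d0 => y0; rewrite -(dvdn_pcharf chp) /dvdn dy; apply/eqP; apply/eqP.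
    by apply: dvdn_mulr; rewrite (dvdn_pcharf chp) y0.
  have fy : (y%:R : K) ^+ p = y%:R by rewrite -(pFrobenius_autE chp) pFrobenius_aut_nat.
  rewrite -exprM mul2n; apply: (mulfI y0); rewrite -exprS -pE fy.
  by rewrite mulr1.
have : ((d%:R : K) ^+ m - 1) * (d%:R ^+ m + 1) = 0.
  by rewrite -subr_sqr expr1n -exprM muln2 dm subrr.
move/eqP; rewrite mulf_eq0 => /orP[|]; last by rewrite addr_eq0 => /eqP ->.
rewrite subr_eq0 => /eqP dm1; exfalso.
(* If the non-square d satisfied d^m = 1, then d and the squares of 1, ..., m would be m + 1
   distinct roots of X^m - 1. *)
pose rs := (d%:R : K) :: [seq (k%:R : K) ^+ 2 | k <- iota 1 m].
have Xm0 : 'X^m - 1 != 0 :> {poly K} by rewrite -size_poly_eq0 size_XnsubC.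
suff [rsr rsu] : all (root ('X^m - 1)) rs /\ uniq rs.
  by have := max_poly_roots Xm0 rsr rsu; rewrite size_XnsubC //= size_map size_iota ltnn.
split.
  rewrite /rs /= rootE hornerD hornerN hornerXn hornerC dm1 subrr eqxx /=.
  apply/allP => x /mapP[k]; rewrite mem_iota => /andP[k1 km] ->.
  rewrite rootE hornerD hornerN hornerXn hornerC -exprM mul2n.
  have k0 : (k%:R : K) != 0.
    by rewrite -(dvdn_pcharf chp) gtnNdvd //; lia.
  have -> : (k%:R : K) ^+ m.*2 = 1.
    apply: (mulfI k0); rewrite -exprS -pE mulr1.
    by rewrite -(pFrobenius_autE chp) pFrobenius_aut_nat.
  by rewrite subrr.
rewrite /rs /=; apply/andP; split.
  apply: contraFN sq => /mapP[k _ dk]; apply/square_modP; first by lia.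
  exists k; apply/eqP.
  case: (leqP (k ^ 2) d) => [kd|/ltnW kd].
    by rewrite eqn_mod_dvd // (dvdn_pcharf chp) natrB // natrX dk subrr.
  by rewrite eq_sym eqn_mod_dvd // (dvdn_pcharf chp) natrB // natrX dk subrr.
rewrite map_inj_in_uniq ?iota_uniq // => k j; rewrite !mem_iota => kr jr /eqP.
rewrite -subr_eq0 subr_sqr mulf_eq0 => /orP[|].
  by rewrite subr_eq0 => /eqP /natr_inj; apply; lia.
by rewrite -natrD -(dvdn_pcharf chp) gtnNdvd //; lia.
Qed.

Lemma kronecker_primeM d e p : prime p -> odd p ->
  kronecker_prime (d * e) p = kronecker_prime d p * kronecker_prime e p.
Proof.
move=> prp oddp; have p2 := odd_prime_gt2 oddp prp.
have [pd|pd] := boolP (p %| d)%N.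
  by rewrite (kronecker_prime_dvd pd) (kronecker_prime_dvd (dvdn_mulr e pd)) mul0r.
have [pe|pe] := boolP (p %| e)%N.
  by rewrite (kronecker_prime_dvd pe) (kronecker_prime_dvd (dvdn_mull d pe)) ?mulr0.
have pde : ~~ (p %| d * e)%N by rewrite Euclid_dvdM // negb_or pd pe.
have chp := pchar_Fp prp.
have E : ((kronecker_prime (d * e) p)%:~R : 'F_p) =
         (kronecker_prime d p * kronecker_prime e p)%:~R.
  by rewrite intrM !(euler_criterion _ chp) // natrM exprMn.
have n11 : (1 : 'F_p) != -1.
  by rewrite -subr_eq0 opprK -[_ + _]/(2%:R) -(dvdn_pcharf chp) gtnNdvd.
have n11' : (-1 : 'F_p) != 1 by rewrite eq_sym.
move: E.
case: (kronecker_prime_sign pd) => ->; case: (kronecker_prime_sign pe) => ->;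
case: (kronecker_prime_sign pde) => -> //=; rewrite ?mulrNN ?mul1r ?mulr1 // ?mulrN1z /= => /eqP;
by rewrite ?(negbTE n11) ?(negbTE n11').
Qed.

Lemma eq_square_mod p d e : (d = e %[mod p])%N -> square_mod p d = square_mod p e.
Proof. by rewrite /square_mod => de; apply: eq_existsb => y; rewrite de. Qed.

Lemma eq_kronecker_prime p d e : odd p -> (d = e %[mod p])%N ->
  kronecker_prime d p = kronecker_prime e p.
Proof. by move=> op de; rewrite !kronecker_prime_odd // /dvdn de (eq_square_mod de). Qed.

Lemma square_mod1 p d : (0 < p)%N -> (d = 1 %[mod p])%N -> square_mod p d.
Proof. by move=> p0 d1; apply/square_modP => //; exists 1%N. Qed.

(** Squaring takes the same value at 1 and p - 1, so it is not injective on the residues modulo p,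
    hence not surjective. *)
Lemma nonresidue p : prime p -> odd p -> exists u, kronecker_prime u p = -1.
Proof.
move=> prp op; have p2 := odd_prime_gt2 op prp; have p0 := prime_gt0 prp.
pose f (y : 'I_p) : 'I_p := Ordinal (ltn_pmod (y ^ 2) p0).
have [/forallP sf|] := boolP [forall u, [exists y, f y == u]].
  have inj : injective f.
    have : [set f y | y in 'I_p] = [set: 'I_p].
      by apply/setP => u; rewrite inE; have /existsP[y /eqP <-] := sf u; rewrite imset_f.
    move=> e; have /imset_injP fI : #|[set f y | y in 'I_p]| == #|'I_p|.
      by rewrite e cardsT.
    by move=> x y; apply: fI.
  have p1 : (1 < p)%N by lia.
  have pm1 : (p.-1 < p)%N by lia.
  have /inj/(congr1 val) /= : f (Ordinal p1) = f (Ordinal pm1).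
    apply/val_inj => /=; have -> : (p.-1 ^ 2 = 1 + (p - 2) * p)%N by nia.
    by rewrite [in RHS]addnC modnMDl.
  lia.
rewrite negb_forall => /existsP[u]; rewrite negb_exists => /forallP nu.
have NS : ~~ square_mod p u.
  apply/existsP => -[y /eqP uy]; have /negP := nu y; apply.
  by apply/eqP/val_inj => /=; rewrite -uy modn_small.
exists u; rewrite kronecker_prime_odd // (negbTE NS) ifN //.
apply: contra NS => pu; apply/square_modP => //; exists 0%N.
by rewrite exp0n // mod0n; apply/eqP.
Qed.

(** The completely multiplicative function with prescribed values at the primes. [kronecker d] is
    convertible to [pmul (kronecker_prime d)], so general facts about [pmul] apply to it
    directly. *)
Definition pmul (f : nat -> int) n : int := \prod_(p <- primes n) f p ^+ logn p n.

Lemma pmul_sub f n (s : seq nat) : uniq s -> {subset primes n <= s} ->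
  pmul f n = \prod_(p <- s) f p ^+ logn p n.
Proof.
move=> us ps; rewrite (bigID (mem (primes n))) /= [X in _ * X]big1 ?mulr1; last first.
  by move=> p; rewrite -logn_gt0 lt0n negbK => /eqP ->.
rewrite -big_filter; apply/perm_big/uniq_perm; rewrite ?filter_uniq ?primes_uniq //.
by move=> p; rewrite mem_filter; case: (boolP (p \in primes n)) => // /ps.
Qed.

Lemma pmulM f m n : (0 < m)%N -> (0 < n)%N -> pmul f (m * n) = pmul f m * pmul f n.
Proof.
move=> m0 n0; have u := primes_uniq (m * n).
rewrite (pmul_sub f u) // (@pmul_sub f m _ u) 1?(@pmul_sub f n _ u).
- by rewrite -big_split /=; apply: eq_bigr => p _; rewrite lognM // exprD.
- by move=> p; rewrite primesM // => ->; rewrite orbT.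
by move=> p; rewrite primesM // => ->.
Qed.

Lemma pmul1 f : pmul f 1 = 1. Proof. by rewrite /pmul big_nil. Qed.

Lemma pmul_prime f p : prime p -> pmul f p = f p.
Proof. by move=> prp; rewrite /pmul primes_prime // big_seq1 logn_prime // eqxx expr1. Qed.

Lemma eq_pmul f g n : (forall p, prime p -> (p %| n)%N -> f p = g p) ->
  pmul f n = pmul g n.
Proof.
move=> fg; apply: eq_big_seq => p; rewrite mem_primes => /and3P[prp _ pn].
by rewrite fg.
Qed.

Lemma pmul_mul f g n : pmul (fun p => f p * g p) n = pmul f n * pmul g n.
Proof. by rewrite -big_split; apply: eq_bigr => p _; rewrite exprMn. Qed.

Lemma nat_mul_ind (P : nat -> Prop) : P 1%N -> (forall p n, prime p -> (0 < n)%N -> P n -> P (p * n)%N) ->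
  forall n, (0 < n)%N -> P n.
Proof.
move=> P1 PM; elim/ltn_ind => n IH n0.
case: (ltngtP n 1) n0 => [|n1 _|-> //]; first by case: n {IH}.
have pn := pdiv_dvd n; have prp := pdiv_prime n1.
rewrite -(divnK pn) mulnC; apply: PM => //; first by rewrite divn_gt0 ?pdiv_gt0 // pdiv_leq // ltnW.
apply: IH; first by rewrite ltn_Pdiv // ?prime_gt1 // ltnW.
by rewrite divn_gt0 ?pdiv_gt0 // pdiv_leq // ltnW.
Qed.

Lemma odd_dvdn d n : (d %| n)%N -> odd n -> odd d.
Proof. by move=> /dvdnP[k ->]; rewrite oddM => /andP[]. Qed.

Lemma kroneckerM d m n : (0 < m)%N -> (0 < n)%N ->
  kronecker d (m * n) = kronecker d m * kronecker d n.
Proof. exact: pmulM. Qed.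

Lemma kronecker1 d : kronecker d 1 = 1. Proof. exact: pmul1. Qed.

Lemma kroneckerMl d e n : odd n -> kronecker (d * e) n = kronecker d n * kronecker e n.
Proof.
move=> on; rewrite -[RHS]pmul_mul; apply: eq_pmul => p prp pn.
exact: kronecker_primeM prp (odd_dvdn pn on).
Qed.

Lemma kronecker1l n : odd n -> kronecker 1 n = 1.
Proof.
move=> on; rewrite -[LHS]/(pmul _ _) (@eq_pmul _ (fun=> 1)).
  by rewrite /pmul big1 // => p _; rewrite expr1n.
move=> p prp pn; have op := odd_dvdn pn on; have := prime_gt1 prp.
by rewrite kronecker_prime_odd // square_mod1 ?prime_gt0 // => p1; rewrite gtnNdvd.
Qed.

Lemma eq_kronecker n d e : odd n -> (d = e %[mod n])%N -> kronecker d n = kronecker e n.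
Proof.
move=> on de; apply: eq_pmul => p prp pn; apply: eq_kronecker_prime (odd_dvdn pn on) _.
by rewrite -(modn_dvdm d pn) -(modn_dvdm e pn) de.
Qed.

Lemma kronecker_sign d n : (0 < n)%N -> coprime d n -> kronecker d n ^+ 2 = 1.
Proof.
move: n; apply: nat_mul_ind => [|p n prp n0 IH]; first by rewrite kronecker1 expr1n.
rewrite coprimeMr => /andP[cp cn]; rewrite kroneckerM ?(prime_gt0 prp) // exprMn IH // mulr1.
rewrite -[kronecker d p]/(pmul _ _) pmul_prime //.
have pd : ~~ (p %| d)%N by rewrite -prime_coprime // coprime_sym.
by case: (kronecker_prime_sign pd) => ->; rewrite ?expr1n ?sqrrN ?expr1n.
Qed.

Lemma kronecker_eq0 d n : (0 < n)%N -> ~~ coprime d n -> kronecker d n = 0.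
Proof.
move: n; apply: nat_mul_ind => [|p n prp n0 IH]; first by rewrite coprimen1.
rewrite coprimeMr negb_and kroneckerM ?(prime_gt0 prp) // => /orP[cp|/IH ->]; last by rewrite mulr0.
rewrite -[kronecker d p]/(pmul _ _) pmul_prime // kronecker_prime_dvd ?mul0r //.
by move: cp; rewrite coprime_sym prime_coprime // negbK.
Qed.

Lemma kronecker_sqr d n : (0 < n)%N -> kronecker d n ^+ 2 = (coprime d n)%:R.
Proof.
move=> n0; case: (boolP (coprime d n)) => cd; first exact: kronecker_sign.
by rewrite kronecker_eq0 // expr0n.
Qed.

Lemma kronecker_norm d n : (0 < n)%N -> `|kronecker d n| = (coprime d n)%:R.
Proof.
move=> n0; have := kronecker_sqr d n0.
rewrite -real_normK ?num_real // => /eqP; case: (coprime d n) => /=.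
  by rewrite sqrp_eq1 // => /eqP ->.
by rewrite sqrf_eq0 => /eqP ->.
Qed.

Lemma kronecker_norm_le1 d n : (0 < n)%N -> `|kronecker d n| <= 1.
Proof. by move=> n0; rewrite kronecker_norm //; case: coprime. Qed.

(** * Gauss sums modulo a prime and the reciprocity law *)

Lemma sum_mod_unit (V : nmodType) q u (F : nat -> V) : coprime u q ->
  \sum_(h < q) F (h * u %% q)%N = \sum_(h < q) F h.
Proof.
case: q => [|q] cuq; first by rewrite !big_ord0.
pose f (h : 'I_q.+1) : 'I_q.+1 := Ordinal (ltn_pmod (h * u) (ltn0Sn q)).
have inj : injective f.
  move=> x y /(congr1 val) /= /eqP.
  wlog xy : x y / (y <= x)%N.
    move=> W; case: (leqP y x) => [|/ltnW] le e; first exact: W.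
    by apply/esym/W; rewrite // eq_sym.
  rewrite eqn_mod_dvd ?leq_mul2r ?xy ?orbT // -mulnBl Gauss_dvdl 1?coprime_sym //.
  case: (posnP (x - y)) => [e _|xy0 /dvdn_leq -/(_ xy0)].
    by apply/val_inj => /=; lia.
  by have := ltn_ord x; lia.
by rewrite [RHS](reindex_inj inj).
Qed.

Lemma sum_mul_unit (V : nmodType) q u (F : nat -> V) : coprime u q ->
  (forall h, F (h %% q)%N = F h) -> \sum_(h < q) F (h * u)%N = \sum_(h < q) F h.
Proof.
by move=> cuq Fq; rewrite -[RHS](sum_mod_unit F cuq); apply: eq_bigr => h _; rewrite Fq.
Qed.

(** Multiplying the variable by a non-residue permutes the residues and changes the sign of the
    sum. *)
Lemma sum_kronecker_prime p : prime p -> odd p -> \sum_(a < p) kronecker_prime a p = 0.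
Proof.
move=> prp op; have [u ku] := nonresidue prp op.
have cup : coprime u p.
  rewrite coprime_sym prime_coprime //; apply/negP => /kronecker_prime_dvd.
  by rewrite ku.
have := @sum_mul_unit _ p u (fun a => kronecker_prime a p) cup.
under eq_bigr do rewrite kronecker_primeM // ku mulrN1.
rewrite sumrN => /(_ _)/eqP; rewrite eq_sym -addr_eq0 -mulr2n mulrn_eq0 /=.
by move=> E; apply/eqP/E => h; apply: eq_kronecker_prime; rewrite ?modn_mod.
Qed.

Lemma sum_prim_root (K : fieldType) n (z : K) b : n.-primitive_root z ->
  \sum_(a < n) z ^+ (a * b) = if (n %| b)%N then n%:R else 0.
Proof.
move=> pz; have zb : (z ^+ b) ^+ n = 1 by rewrite exprAC (prim_expr_order pz) expr1n.
under eq_bigr do rewrite mulnC exprM.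
case: ifP => nb.
  have -> : z ^+ b = 1 by apply/eqP; rewrite -(prim_order_dvd pz).
  by under eq_bigr do rewrite expr1n; rewrite sumr_const card_ord.
have zb1 : z ^+ b - 1 != 0 by rewrite subr_eq0 -(prim_order_dvd pz) nb.
by apply: (mulfI zb1); rewrite -subrX1 zb subrr mulr0.
Qed.

(** After b is replaced by a b, the sum over a is chi(b) times the sum of z^(a (b + 1)) over a != 0,
    which is p - 1 for b = p - 1 and -1 otherwise. The terms -1 cancel because chi has sum zero. *)
Lemma gauss_sum_prime_sqr (K : fieldType) p (z : K) : prime p -> odd p -> p.-primitive_root z ->
  (\sum_(a < p) (kronecker_prime a p)%:~R * z ^+ a) ^+ 2 =
  (kronecker_prime p.-1 p)%:~R * p%:R.
Proof.
move=> prp op pz; have p0 := prime_gt0 prp; set chi := fun a => (kronecker_prime a p)%:~R : K.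
have chiM a b : chi (a * b)%N = chi a * chi b by rewrite /chi kronecker_primeM // intrM.
have chi_mod a : chi (a %% p)%N = chi a.
  by rewrite /chi (@eq_kronecker_prime _ _ a) // modn_mod.
have chi0 : chi 0%N = 0 by rewrite /chi kronecker_prime_dvd.
have chi_sq (a : 'I_p) : chi a ^+ 2 = (a != 0 :> nat)%:R.
  case: eqP => [->|/eqP a0]; first by rewrite chi0 expr0n.
  have : ~~ (p %| a)%N by rewrite gtnNdvd // lt0n.
  by case/kronecker_prime_sign; rewrite /chi => ->; rewrite ?mulrN1z ?sqrrN expr1n.
have -> : (\sum_(a < p) chi a * z ^+ a) ^+ 2 =
          \sum_(a < p) \sum_(b < p) chi a * z ^+ a * (chi (b * a)%N * z ^+ (b * a)).
  rewrite expr2 mulr_suml; apply: eq_bigr => a _; rewrite mulr_sumr.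
  have [a0|a0] := eqVneq (val a) 0%N.
    by rewrite a0 chi0; rewrite !big1 // => b _; rewrite !mul0r.
  have cap : coprime a p by rewrite coprime_sym prime_coprime // gtnNdvd // lt0n.
  apply/esym/(sum_mul_unit (F := fun b => chi a * z ^+ a * (chi b * z ^+ b)) cap) => h.
  by rewrite chi_mod (prim_expr_mod pz).
rewrite exchange_big /=.
have inner (b : 'I_p) : \sum_(a < p) chi a * z ^+ a * (chi (b * a)%N * z ^+ (b * a)) =
    chi b * ((if b.+1 == p then p%:R else 0) - 1).
  transitivity (chi b * \sum_(a < p) (a != 0 :> nat)%:R * z ^+ (a * b.+1)).
    rewrite mulr_sumr; apply: eq_bigr => a _.
    by rewrite -chi_sq chiM mulnS exprD [(b * a)%N]mulnC; ring.
  congr (_ * _).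
  have -> : (b.+1 == p) = (p %| b.+1)%N.
    apply/eqP/idP => [->//|/dvdn_leq -/(_ isT)]; have := ltn_ord b; lia.
  rewrite -(sum_prim_root _ pz) (bigD1 (Ordinal p0)) //= [in RHS](bigD1 (Ordinal p0)) //=.
  rewrite mul0r mul0n expr0 add0r [1 + _]addrC addrK.
  apply: eq_bigr => i i0; suff -> : (i != 0 :> nat) by rewrite mul1r.
  by apply: contra i0 => /eqP i0; apply/eqP/val_inj.
under eq_bigr do rewrite inner mulrBr mulr1.
rewrite sumrB -[X in _ - X]rmorph_sum /= sum_kronecker_prime // subr0.
have pp : (p.-1 < p)%N by lia.
rewrite (bigD1 (Ordinal pp)) //= prednK // eqxx big1 ?addr0 // => b bp.
case: eqP; rewrite ?mulr0 // => bE; case/eqP: bp; apply/val_inj => /=; lia.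
Qed.

(** The field with l^phi(m) elements has a cyclic unit group, of order divisible by m by Euler's
    theorem. *)
Lemma prim_root_exists (l m : nat) : prime l -> (0 < m)%N -> coprime l m ->
  exists (K : fieldType) (z : K), l \in [pchar K] /\ m.-primitive_root z.
Proof.
move=> prl m0 clm; have t0 : (0 < totient m)%N by rewrite totient_gt0.
have [K chK cardK] := PrimePowerField prl t0.
pose n := #|K|.-1; pose rs := enum (predC1 (0 : K)).
have n0 : (0 < n)%N by rewrite /n -ltnS prednK ?finNzRing_gt1 // ltnW // finNzRing_gt1.
have nE : (n = l ^ totient m - 1)%N by rewrite /n cardK subn1.
have rsn : all n.-unity_root rs.
  apply/allP => x; rewrite mem_enum => /= x0.
  rewrite unity_rootE; apply/eqP/(mulfI x0).
  by rewrite -exprS prednK ?(ltnW (finNzRing_gt1 K)) // mulr1 expf_card.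
have szrs : (n <= size rs)%N by rewrite -cardE cardC1.
have /hasP[g _ pg] := has_prim_root n0 rsn (enum_uniq _) szrs.
have mn : (m %| n)%N.
  rewrite nE -eqn_mod_dvd ?expn_gt0 ?prime_gt0 //; apply/eqP.
  exact: Euler_exp_totient.
by exists K, (g ^+ (n %/ m)); split=> //; apply: dvdn_prim_root pg _ mn.
Qed.

Lemma int_sign_inj (K : fieldType) l (x y : int) : l \in [pchar K] -> odd l ->
  x ^+ 2 = 1 -> y ^+ 2 = 1 -> (x%:~R : K) = y%:~R -> x = y.
Proof.
move=> ch ol /eqP x1 /eqP y1; have prl := pcharf_prime ch.
have n11 : (1 : K) != -1.
  by rewrite -subr_eq0 opprK -[_ + _]/(2%:R) -(dvdn_pcharf ch) gtnNdvd // odd_prime_gt2.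
have n11' : (-1 : K) != 1 by rewrite eq_sym.
move: x1 y1; rewrite !sqrf_eq1 => /orP[]/eqP-> /orP[]/eqP-> //; rewrite ?mulrN1z /= => /eqP;
by rewrite ?(negbTE n11) ?(negbTE n11').
Qed.

Lemma kronecker_prime_sqr d p : ~~ (p %| d)%N -> kronecker_prime d p ^+ 2 = 1.
Proof. by case/kronecker_prime_sign => ->; rewrite ?expr1n ?sqrrN ?expr1n. Qed.

Lemma sign_sqr n : ((-1) ^+ n) ^+ 2 = 1 :> int.
Proof. by rewrite -exprM mulnC exprM sqrrN !expr1n. Qed.

Lemma half_pred n : odd n -> (n.-1)./2 = n./2.
Proof. by move=> on; rewrite -{1}(odd_double_half n) on /= doubleK. Qed.

Lemma kronecker_prime_pred p : prime p -> odd p -> kronecker_prime p.-1 p = (-1) ^+ p./2.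
Proof.
move=> prp op; have p2 := odd_prime_gt2 op prp; have ch := pchar_Fp prp.
apply: (int_sign_inj ch op); rewrite ?sign_sqr //.
  by apply: kronecker_prime_sqr; rewrite gtnNdvd //; lia.
rewrite (euler_criterion _ ch) // half_pred // rmorphXn /= mulrN1z; congr (_ ^+ _).
by apply/eqP; rewrite -subr_eq0 opprK natr1 prednK ?prime_gt0 // -(dvdn_pcharf ch).
Qed.

(** The Gauss sum t modulo p is taken in characteristic l. Frobenius gives t^l = (l / p) t, while
    t^(l - 1) is a power of the known t^2 and is evaluated by Euler's criterion modulo l. *)
Lemma quadratic_reciprocity p l : prime p -> odd p -> prime l -> odd l -> p != l ->
  kronecker_prime l p = (-1) ^+ (p./2 * l./2) * kronecker_prime p l.
Proof.
move=> prp op prl ol pl.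
have p2 := odd_prime_gt2 op prp; have l2 := odd_prime_gt2 ol prl.
have clp : coprime l p by rewrite prime_coprime // dvdn_prime2 // eq_sym.
have pdl : ~~ (p %| l)%N by rewrite dvdn_prime2.
have ldp : ~~ (l %| p)%N by rewrite dvdn_prime2 // eq_sym.
have [K [z [ch pz]]] := prim_root_exists prl (prime_gt0 prp) clp.
set t := \sum_(a < p) (kronecker_prime a p)%:~R * z ^+ a.
have t2 := gauss_sum_prime_sqr prp op pz; rewrite -/t in t2.
have t0 : t != 0.
  rewrite -sqrf_eq0 t2 kronecker_prime_pred // rmorphXn /= mulrN1z.
  by rewrite mulf_eq0 negb_or signr_eq0 -(dvdn_pcharf ch).
apply: (int_sign_inj ch ol); rewrite ?exprMn ?sign_sqr ?kronecker_prime_sqr ?mulr1 //.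
have tl : t ^+ l = (kronecker_prime l p)%:~R * t.
  rewrite -(pFrobenius_autE ch) rmorph_sum /=.
  rewrite -[t](@sum_mul_unit _ p l (fun a => (kronecker_prime a p)%:~R * z ^+ a)) //; last first.
    by move=> h; rewrite (@eq_kronecker_prime _ _ h) ?modn_mod // (prim_expr_mod pz).
  rewrite mulr_sumr; apply: eq_bigr => a _.
  rewrite rmorphM rmorph_int rmorphXn /= pFrobenius_autE -exprM mulnC exprM.
  rewrite kronecker_primeM // intrM -exprM mulnC mulrA [_ * (_ * _)]mulrCA -expr2 -rmorphXn /=.
  by rewrite kronecker_prime_sqr // mulr1.
have {tl} : t ^+ l.-1 = (kronecker_prime l p)%:~R.
  by apply: (mulIf t0); rewrite -tl -exprSr prednK ?prime_gt0.
have -> : (l.-1 = l./2 * 2)%N.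
  by have := odd_double_half l; rewrite ol; lia.
rewrite mulnC exprM t2 exprMn => <-.
rewrite kronecker_prime_pred // -rmorphXn /= -exprM intrM; congr (_ * _).
by rewrite (euler_criterion _ ch) // half_pred.
Qed.

(** On odd numbers, (n - 1) / 2 modulo 2 turns products into sums; this makes the sign of the
    reciprocity law multiplicative in each variable and carries the law from primes to odd
    numbers. *)
Lemma half_mul_odd m n : odd m -> odd n -> odd (m * n)./2 = odd m./2 (+) odd n./2.
Proof.
move=> om on; rewrite -{1}(odd_double_half m) -{1}(odd_double_half n) om on.
set a := m./2; set b := n./2.
have -> : ((true + a.*2) * (true + b.*2) = true + (a * b + a * b + a + b).*2)%N.
  by rewrite /nat_of_bool -!mul2n; ring.
by rewrite half_bit_double -!addnA oddD oddD addbA addbb addFb oddD.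
Qed.

Lemma sign_half_mul m n k : odd m -> odd n ->
  (-1) ^+ ((m * n)./2 * k) = (-1) ^+ (m./2 * k) * (-1) ^+ (n./2 * k) :> int.
Proof.
move=> om on; rewrite -exprD -signr_odd -[in RHS]signr_odd; congr (_ ^+ nat_of_bool _).
by rewrite oddD !oddM half_mul_odd //; case: (odd m./2); case: (odd n./2); case: (odd k).
Qed.

Lemma kronecker_prime_l d p : prime p -> kronecker d p = kronecker_prime d p.
Proof. exact: pmul_prime. Qed.

(** Coprimality is not assumed: a common prime makes both symbols vanish. The induction runs over n
    for s prime, then over s. *)
Lemma jacobi_reciprocity s n : odd s -> odd n ->
  kronecker s n = (-1) ^+ (s./2 * n./2) * kronecker n s.
Proof.
have R1 p : prime p -> odd p -> forall n, (0 < n)%N -> odd n ->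
    kronecker p n = (-1) ^+ (p./2 * n./2) * kronecker n p.
  move=> prp op; apply: nat_mul_ind => [|l m prl m0 IH].
    by rewrite kronecker1 kronecker1l // muln0 expr0 mul1r.
  rewrite oddM => /andP[ol om]; have l0 := prime_gt0 prl.
  rewrite kroneckerM // kroneckerMl // IH // ![(p./2 * _)%N]mulnC sign_half_mul //.
  suff -> : kronecker p l = (-1) ^+ (l./2 * p./2) * kronecker l p by ring.
  rewrite !kronecker_prime_l //; have [->|pl] := eqVneq p l.
    by rewrite kronecker_prime_dvd // mulr0.
  by apply: quadratic_reciprocity; rewrite // eq_sym.
move=> os on; have s0 := odd_gt0 os; have n0 := odd_gt0 on.
move: s s0 os; apply: nat_mul_ind => [|p m prp m0 IH].
  by rewrite kronecker1 kronecker1l // mul0n expr0 mul1r.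
rewrite oddM => /andP[op om]; rewrite kroneckerM ?(prime_gt0 prp) // kroneckerMl // IH //.
by rewrite R1 // sign_half_mul //; ring.
Qed.

Lemma kronecker_prime2 d : kronecker_prime d 2 =
  if ~~ odd d then 0 else if (d %% 8 \in [:: 1; 7])%N then 1 else -1.
Proof. by rewrite /kronecker_prime dvdn2. Qed.

Lemma kronecker_prime2M d e : kronecker_prime (d * e) 2 = kronecker_prime d 2 * kronecker_prime e 2.
Proof.
rewrite !kronecker_prime2 oddM -modnMm.
have Hd : odd d = odd (d %% 8) by rewrite {1}(divn_eq d 8) oddD oddM andbF.
have He : odd e = odd (e %% 8) by rewrite {1}(divn_eq e 8) oddD oddM andbF.
rewrite Hd He; have := ltn_pmod d (isT : 0 < 8)%N; have := ltn_pmod e (isT : 0 < 8)%N.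
by case: (d %% 8)%N => [|[|[|[|[|[|[|[|?]]]]]]]] //; case: (e %% 8)%N => [|[|[|[|[|[|[|[|?]]]]]]]].
Qed.

(** For a primitive eighth root of unity z in characteristic l, t = z + z^-1 satisfies t^2 = 2.
    Euler's criterion identifies t^(l - 1) with (2 / l), and Frobenius gives t^l = z^l + z^-l, which
    is t or -t according to l mod 8. *)
Lemma kronecker2_prime l : prime l -> odd l -> kronecker_prime 2 l = kronecker_prime l 2.
Proof.
move=> prl ol; have l2 := odd_prime_gt2 ol prl.
have cl8 : coprime l 8 by rewrite (_ : 8 = 2 ^ 3)%N // coprimeXr // coprimen2.
have [K [z [ch pz]]] := prim_root_exists prl (isT : 0 < 8)%N cl8.
have z0 : z != 0.
  by apply/eqP => e; have := prim_expr_order pz; rewrite e expr0n => /eqP; rewrite eq_sym oner_eq0.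
have z4 : z ^+ 4 = -1.
  have /eqP := prim_expr_order pz; rewrite (_ : 8 = 4 * 2)%N // exprM sqrf_eq1 => /orP[|/eqP //].
  by rewrite -(prim_order_dvd pz).
have z7 : z^-1 = z ^+ 7 by apply: (mulfI z0); rewrite divff // -exprS (prim_expr_order pz).
set t := z + z ^+ 7.
have t2 : t ^+ 2 = 2%:R.
  have -> : t ^+ 2 = z ^+ 2 + 2%:R * z ^+ 8 + z ^+ 8 * z ^+ 4 * z ^+ 2 by rewrite /t; ring.
  by rewrite z4 (prim_expr_order pz); ring.
have t0 : t != 0 by rewrite -sqrf_eq0 t2 -(dvdn_pcharf ch) gtnNdvd.
have tl : t ^+ l = z ^+ (l %% 8) + z ^+ ((l %% 8) * 7).
  rewrite -(pFrobenius_autE ch) rmorphD rmorphXn /= pFrobenius_autE -(prim_expr_mod pz) -exprM.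
  by rewrite exprM -(prim_expr_mod pz) -exprM.
have nl : ~~ (l %| 2)%N by rewrite gtnNdvd.
apply: (int_sign_inj ch ol); first exact: kronecker_prime_sqr.
  by apply: kronecker_prime_sqr; rewrite dvdn2 ol.
rewrite (euler_criterion _ ch) // -t2 -exprM half_pred // kronecker_prime2 ol /=.
apply: (mulIf t0); rewrite -exprSr.
have -> : (2 * l./2).+1 = l by rewrite -[RHS]odd_double_half ol mul2n.
rewrite tl; have : odd (l %% 8) by move: ol; rewrite {1}(divn_eq l 8) oddD oddM andbF.
have := ltn_pmod l (isT : 0 < 8)%N.
case: (l %% 8)%N => [|[|[|[|[|[|[|[|?]]]]]]]] //= _ _; rewrite ?mulrN1z /= ?mul1r ?mulN1r /t //.
- rewrite (_ : z ^+ (3 * 7) = z ^+ 8 * z ^+ 8 * z * z ^+ 4); last by ring.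
  rewrite (prim_expr_order pz) (_ : z ^+ 7 = z ^+ 4 * z ^+ 3); last by ring.
  by rewrite z4; ring.
- rewrite (_ : z ^+ (5 * 7) = z ^+ 8 * z ^+ 8 * z ^+ 8 * z ^+ 8 * z ^+ 3); last by ring.
  rewrite (prim_expr_order pz) (_ : z ^+ 7 = z ^+ 4 * z ^+ 3); last by ring.
  rewrite (_ : z ^+ 5 = z ^+ 4 * z); last by ring.
  by rewrite z4; ring.
- rewrite (_ : z ^+ (7 * 7) = z ^+ 8 * z ^+ 8 * z ^+ 8 * z ^+ 8 * z ^+ 8 * z ^+ 8 * z); last by ring.
  by rewrite (prim_expr_order pz); ring.
Qed.

Lemma kronecker2 n : odd n -> kronecker 2 n = kronecker_prime n 2.
Proof.
move=> on; have n0 := odd_gt0 on.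
move: n n0 on; apply: nat_mul_ind => [|p m prp m0 IH].
  by rewrite kronecker1.
rewrite oddM => /andP[op om]; rewrite kroneckerM ?(prime_gt0 prp) // IH //.
by rewrite kronecker_prime2M kronecker_prime_l // kronecker2_prime.
Qed.

Lemma eq_half_mod m n : (m = n %[mod 8])%N -> odd m -> odd m./2 = odd n./2.
Proof. by move=> mn om; have := divn_eq m 8; have := divn_eq n 8; lia. Qed.

Lemma eq_jacobi_sign s m n : (m = n %[mod 8])%N -> odd m ->
  (-1) ^+ (s./2 * m./2) = (-1) ^+ (s./2 * n./2) :> int.
Proof.
move=> mn om; rewrite -signr_odd -[in RHS]signr_odd !oddM (eq_half_mod mn) //.
Qed.

Lemma eq_kronecker2 m n : (m = n %[mod 8])%N -> odd m -> kronecker 2 m = kronecker 2 n.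
Proof.
move=> mn om; have on : odd n by have := divn_eq m 8; have := divn_eq n 8; lia.
by rewrite !kronecker2 // !kronecker_prime2 mn om on.
Qed.

(** * Squarefree parts and sieves *)

Lemma squarefree_gt0 m : squarefree m -> (0 < m)%N.
Proof. by case/squarefreeP. Qed.

Lemma squarefree_primeP m : (0 < m)%N ->
  reflect (forall p, prime p -> ~~ (p ^ 2 %| m)%N) (squarefree m).
Proof.
move=> m0; apply: (iffP (squarefreeP m)) => [[_ sf] p prp|sf].
  by apply/negP => /sf p1; rewrite p1 in prp.
split=> // k km; have k0 : (0 < k)%N by case: k km => //; rewrite dvd0n => /eqP e; rewrite e in m0.
apply/eqP; rewrite eqn_leq k0 andbT leqNgt; apply/negP => k1.
have /negP := sf _ (pdiv_prime k1); apply.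
by apply: dvdn_trans km; rewrite dvdn_exp2r // pdiv_dvd.
Qed.

Lemma squarefreeM a b : coprime a b -> squarefree a -> squarefree b -> squarefree (a * b).
Proof.
move=> cab sa sb; have a0 := squarefree_gt0 sa; have b0 := squarefree_gt0 sb.
apply/squarefree_primeP => [|p prp]; first by rewrite muln_gt0 a0.
have [pa|pa] := boolP (p %| a)%N.
  have cpb : coprime (p ^ 2) b by rewrite coprimeXl //; apply: coprime_dvdl cab.
  by rewrite Gauss_dvdl //; apply/squarefree_primeP.
rewrite Gauss_dvdr ?coprimeXl ?prime_coprime //.
by apply/squarefree_primeP.
Qed.

Lemma squarefree_dvd d m : (d %| m)%N -> squarefree m -> squarefree d.
Proof.
move=> dm /squarefreeP[m0 sf]; apply/squarefreeP; split; first exact: dvdn_gt0 dm.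
by move=> k kd; apply: sf; apply: dvdn_trans dm.
Qed.

Definition sqpart n : nat := \max_(t < n.+1 | (t ^ 2 %| n)%N) t.
Definition sqfpart n := (n %/ sqpart n ^ 2)%N.

Lemma sqpart_dvd n : (0 < n)%N -> (sqpart n ^ 2 %| n)%N.
Proof.
move=> n0; have n1 : (1 < n.+1)%N by [].
rewrite /sqpart; have [|i iP ->] := @eq_bigmax_cond _ [pred t : 'I_n.+1 | (t ^ 2 %| n)%N] (fun t => nat_of_ord t).
  by apply/card_gt0P; exists (Ordinal n1); rewrite inE /= exp1n dvd1n.
by [].
Qed.

Lemma sqpart_gt0 n : (0 < n)%N -> (0 < sqpart n)%N.
Proof. by move=> n0; have := dvdn_gt0 n0 (sqpart_dvd n0); rewrite expn_gt0 orbF. Qed.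

Lemma sqpartE n : (0 < n)%N -> n = (sqfpart n * sqpart n ^ 2)%N.
Proof. by move=> n0; rewrite divnK ?sqpart_dvd. Qed.

Lemma sqfpart_squarefree n : (0 < n)%N -> squarefree (sqfpart n).
Proof.
move=> n0; have q0 : (0 < sqfpart n)%N.
  by move: (n0); rewrite {1}(sqpartE n0) muln_gt0 => /andP[].
apply/squarefreeP; split=> // k kq; apply/eqP; rewrite eqn_leq andbC.
have k0 : (0 < k)%N by case: k kq => //; rewrite dvd0n => /eqP e; rewrite e in q0.
rewrite k0 leqNgt; apply/negP => k1.
have kd : ((k * sqpart n) ^ 2 %| n)%N by rewrite {2}(sqpartE n0) expnMn dvdn_mul.
have kn : (k * sqpart n < n.+1)%N.
  rewrite ltnS (leq_trans _ (dvdn_leq n0 kd)) // expnS expn1 leq_pmulr // muln_gt0 k0.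
  exact: sqpart_gt0.
have := @leq_bigmax_cond _ [pred t : 'I_n.+1 | (t ^ 2 %| n)%N] (fun t => nat_of_ord t) (Ordinal kn) kd.
by rewrite -/(sqpart n) /= leqNgt -{1}(mul1n (sqpart n)) ltn_pmul2r ?k1 // sqpart_gt0.
Qed.

(** The odd part of the squarefree part. [okern h = okern k] means that h k is a square or twice a
    square; the latter is grouped with the former because n |-> (2 / n) is constant on a class
    modulo 8 and gives no cancellation there. *)
Definition okern n := let q := sqfpart n in if odd q then q else q./2.

Lemma okernP n : (0 < n)%N -> [/\ odd (okern n), squarefree (okern n) &
  exists2 u, u \in [:: 1; 2]%N & n = (u * okern n * sqpart n ^ 2)%N].
Proof.
move=> n0; have sf := sqfpart_squarefree n0; have nE := sqpartE n0; rewrite /okern.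
have [oq|eq] := boolP (odd (sqfpart n)).
  by split=> //; exists 1%N; rewrite ?inE // mul1n.
have qE : sqfpart n = (2 * (sqfpart n)./2)%N.
  by rewrite -{1}(odd_double_half (sqfpart n)) (negbTE eq) mul2n.
split; last by exists 2%N; rewrite ?inE // -qE.
  apply/negPn/negP => e; have /squarefreeP[_ H] := sf; suff /H : (2 ^ 2 %| sqfpart n)%N by [].
  by rewrite qE -mulnn dvdn_mul // dvdn2.
by apply: squarefree_dvd sf; rewrite {2}qE dvdn_mull.
Qed.

(** With g the gcd of the kernels a and b, s is (a / g) (b / g), and s = 1 would force a = g = b. If
    both h and k contribute a factor 2, the resulting 4 joins the square. *)
Lemma okernM_neq h k : (0 < h)%N -> (0 < k)%N -> okern h != okern k ->
  exists u s t, [/\ u \in [:: 1; 2]%N, odd s, squarefree s & (1 < s)%N /\ (h * k = u * s * t ^ 2)%N].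
Proof.
move=> h0 k0; have [oh sh [u uI hE]] := okernP h0; have [ok sk [v vI kE]] := okernP k0.
set a := okern h in oh sh hE *; set b := okern k in ok sk kE * => ab.
set g := gcdn a b; have a0 := squarefree_gt0 sh; have b0 := squarefree_gt0 sk.
have g0 : (0 < g)%N by rewrite gcdn_gt0 a0.
have aE : a = (a %/ g * g)%N by rewrite divnK // dvdn_gcdl.
have bE : b = (b %/ g * g)%N by rewrite divnK // dvdn_gcdr.
have cop : coprime (a %/ g) (b %/ g).
  rewrite /coprime -(eqn_pmul2r g0) muln_gcdl -aE -bE mul1n //.
set s := (a %/ g * (b %/ g))%N.
have da : (a %/ g %| a)%N by apply/dvdnP; exists g; rewrite mulnC.
have db : (b %/ g %| b)%N by apply/dvdnP; exists g; rewrite mulnC.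
have ss : squarefree s.
  exact: squarefreeM cop (squarefree_dvd da sh) (squarefree_dvd db sk).
have os : odd s by rewrite oddM (odd_dvdn da oh) (odd_dvdn db ok).
have s1 : (1 < s)%N.
  rewrite ltn_neqAle squarefree_gt0 // andbT eq_sym; apply: contra ab => /eqP/eqP.
  by rewrite muln_eq1 => /andP[/eqP a1 /eqP b1]; apply/eqP; move: aE bE; rewrite a1 b1 !mul1n => -> ->.
have hkE : (h * k = u * v * s * (g * sqpart h * sqpart k) ^ 2)%N.
  have E : (a * b = s * g ^ 2)%N by rewrite {1}aE {1}bE /s; ring.
  by rewrite {1}hE {1}kE -[RHS]/((u * v * s * (g * sqpart h * sqpart k) ^ 2)%N) !expnMn
    -[(u * v * s * _)%N]mulnA [(s * _)%N]mulnA [(s * (_ * _))%N]mulnA -E; ring.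
move: uI vI hkE; rewrite !inE => /orP[]/eqP-> /orP[]/eqP-> hkE.
- by exists 1%N, s, (g * sqpart h * sqpart k)%N; split.
- by exists 2%N, s, (g * sqpart h * sqpart k)%N; split.
- by exists 2%N, s, (g * sqpart h * sqpart k)%N; split.
- exists 1%N, s, (2 * (g * sqpart h * sqpart k))%N; split=> //; split=> //.
  by rewrite hkE; ring.
Qed.

(** For distinct primes this lists the squarefree divisors of their product, one for each subset, in
    the shape in which a product of factors 1 + F p expands. *)
Fixpoint subprods (ps : seq nat) : seq nat :=
  if ps is p :: ps' then subprods ps' ++ [seq (p * m)%N | m <- subprods ps'] else [:: 1%N].

Lemma size_subprods ps : size (subprods ps) = (2 ^ size ps)%N.
Proof. by elim: ps => //= p ps IH; rewrite size_cat size_map IH addnn -mul2n expnS. Qed.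

Lemma subprods_dvd ps m : m \in subprods ps -> (m %| \prod_(p <- ps) p)%N.
Proof.
elim: ps m => [|p ps IH] m /=; first by rewrite inE => /eqP ->; rewrite dvd1n.
rewrite mem_cat big_cons => /orP[/IH ms|/mapP[k /IH ks ->]]; first exact: dvdn_mull.
exact: dvdn_mul.
Qed.

Lemma subprods_prime ps m q : all prime ps -> prime q -> m \in subprods ps ->
  (q %| m)%N -> q \in ps.
Proof.
move=> + prq; elim: ps m => [|p ps IH] m /=.
  by rewrite inE => _ /eqP ->; rewrite dvdn1 => /eqP e; rewrite e in prq.
move=> /andP[prp prps]; rewrite mem_cat inE => /orP[mi /(IH _ prps mi) ->|]; first by rewrite orbT.
case/mapP => k ki ->; rewrite Euclid_dvdM // dvdn_prime2 // => /orP[->//|/(IH _ prps ki) ->].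
by rewrite orbT.
Qed.

Lemma subprods_gt0 ps m : all prime ps -> m \in subprods ps -> (0 < m)%N.
Proof.
move=> prps /subprods_dvd; apply: dvdn_gt0; rewrite big_seq.
elim: ps prps => [|p ps IH] /=; first by rewrite big1 // => i; rewrite in_nil.
move=> /andP[/prime_gt0 p0 /IH]; rewrite -!big_seq big_cons muln_gt0 p0 => -> //.
Qed.

Lemma prod_one_add_subprods (F : nat -> int) ps : uniq ps -> all prime ps -> F 1%N = 1 ->
  (forall p m, prime p -> ~~ (p %| m)%N -> F (p * m)%N = F p * F m) ->
  \prod_(p <- ps) (1 + F p) = \sum_(m <- subprods ps) F m.
Proof.
move=> + + F1 FM; elim: ps => [|p ps IH] /=; first by rewrite big_nil big_seq1 F1.
move=> /andP[pps ups] /andP[prp prps]; rewrite big_cons IH // big_cat /= big_map mulrDl mul1r.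
congr (_ + _); rewrite mulr_sumr; apply: eq_big_seq => m mi; rewrite FM //.
by apply: contra pps; apply: subprods_prime mi.
Qed.

Lemma uniq_subprods ps : uniq ps -> all prime ps -> uniq (subprods ps).
Proof.
elim: ps => //= p ps IH /andP[pps ups] /andP[prp prps].
rewrite cat_uniq IH //= map_inj_uniq ?IH //; last first.
  by move=> x y /eqP; rewrite eqn_pmul2l ?prime_gt0 // => /eqP.
rewrite andbT; apply/hasPn => _ /mapP[k ki ->] /=; apply: contra pps => pk.
by apply: subprods_prime pk _; rewrite // dvdn_mulr.
Qed.

(** Liouville's function. The sieves apply it to squarefree numbers, where it agrees with Moebius's
    function, and its square is always 1. *)
Definition liou := pmul (fun=> -1).

Lemma liou_sqr n : liou n ^+ 2 = 1.
Proof. by rewrite /liou /pmul -prodrXl big1 // => p _; rewrite sign_sqr. Qed.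

Lemma liou_norm n : `|liou n| = 1.
Proof.
by apply/eqP; rewrite -sqrp_eq1 ?normr_ge0 // real_normK ?num_real // liou_sqr.
Qed.

Lemma liouM p m : prime p -> ~~ (p %| m)%N -> liou (p * m) = liou p * liou m.
Proof.
move=> prp pm; have m0 : (0 < m)%N by rewrite lt0n; apply: contraNneq pm => ->.
by rewrite /liou pmulM ?(prime_gt0 prp) // [pmul _ p]pmul_prime // [in RHS]pmul_prime.
Qed.

Lemma coprime_sieve n t : (0 < t)%N ->
  (coprime n t)%:R = \sum_(e <- subprods (primes t)) liou e * (e %| n)%:R.
Proof.
move=> t0; have allp : all prime (primes t) by apply/allP => p; rewrite mem_primes => /and3P[].
rewrite -(prod_one_add_subprods (primes_uniq t) allp).
- case: (boolP (coprime n t)) => cnt.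
    rewrite big_seq big1 // => p; rewrite mem_primes => /and3P[prp _ pt].
    suff /negbTE -> : ~~ (p %| n)%N by rewrite mulr0 addr0.
    by rewrite -prime_coprime // coprime_sym (coprime_dvdr pt cnt).
  have g1 : (1 < gcdn n t)%N.
    by rewrite ltn_neqAle eq_sym cnt gcdn_gt0 t0 orbT.
  have prp := pdiv_prime g1; have pg := pdiv_dvd (gcdn n t).
  have pp : pdiv (gcdn n t) \in primes t.
    by rewrite mem_primes prp t0 (dvdn_trans pg) // dvdn_gcdr.
  rewrite (big_rem _ pp) /= (dvdn_trans pg (dvdn_gcdl _ _)) mulr1 /liou pmul_prime //.
  by rewrite subrr mul0r.
- by rewrite dvd1n mulr1 /liou pmul1.
move=> p m prp pm; rewrite liouM // Gauss_dvd ?prime_coprime //.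
by case: (p %| n)%N; case: (m %| n)%N; rewrite ?mulr1 ?mulr0 ?mul0r.
Qed.

Definition odd_primes X := [seq p <- iota 0 X.+1 | prime p && odd p].

Lemma odd_primes_prime X : all prime (odd_primes X).
Proof. by apply/allP => p; rewrite mem_filter => /andP[/andP[]]. Qed.

Lemma odd_primes_uniq X : uniq (odd_primes X).
Proof. by rewrite filter_uniq // iota_uniq. Qed.

Lemma subprods_odd X k : k \in subprods (odd_primes X) -> odd k.
Proof.
move=> ki; apply/negPn/negP; rewrite -dvdn2.
by move=> /(subprods_prime (odd_primes_prime X) (isT : prime 2) ki); rewrite mem_filter.
Qed.

(** Since 4 does not divide d, odd primes suffice, and primes up to X include every p with p^2 | d.
    Keeping k odd matters later: multiplication by k^2 then preserves the class modulo 4. *)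
Lemma squarefree_sieve X d : (0 < d <= X)%N -> ~~ (4 %| d)%N ->
  (squarefree d)%:R = \sum_(k <- subprods (odd_primes X)) liou k * (k ^ 2 %| d)%:R.
Proof.
move=> /andP[d0 dX] d4.
rewrite -(prod_one_add_subprods (odd_primes_uniq X) (odd_primes_prime X)).
- have [sf|nsf] := boolP (squarefree d).
    rewrite big_seq big1 // => p; rewrite mem_filter => /andP[/andP[prp _] _].
    by have /(squarefree_primeP d0)/(_ _ prp)/negbTE -> := sf; rewrite mulr0 addr0.
  have : ~ forall p, prime p -> ~~ (p ^ 2 %| d)%N.
    by move=> H; move/negP: nsf; apply; apply/squarefree_primeP.
  move=> NH; apply/esym; move: NH => /=.
  have [/allP H NH|] := boolP (all (fun p => ~~ (p ^ 2 %| d)%N) (odd_primes X)).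
    exfalso; apply: NH => p prp; apply/negP => pd; have op : odd p.
      by apply/negPn/negP; rewrite -dvdn2 dvdn_prime2 // => /eqP e; move: d4; rewrite -e in pd; rewrite pd.
    have : p \in odd_primes X.
      rewrite mem_filter prp op mem_iota /= add0n ltnS (leq_trans _ dX) //.
      by apply: leq_trans (dvdn_leq d0 pd); rewrite expnS expn1 leq_pmulr // prime_gt0.
    by move=> /H; rewrite pd.
  move=> /allPn[p pi]; rewrite negbK => pd _.
  have prp : prime p by have /allP := odd_primes_prime X; apply.
  by rewrite (big_rem _ pi) /= pd mulr1 /liou pmul_prime // subrr mul0r.
- by rewrite dvd1n mulr1 /liou pmul1.
move=> p m prp pm; rewrite liouM // expnMn Gauss_dvd ?coprimeXl ?coprimeXr ?prime_coprime //.
by case: (_ %| d)%N; case: (_ %| d)%N; rewrite ?mulr1 ?mulr0 ?mul0r.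
Qed.

(** * The Dirichlet kernel *)

Section ComplexExponential.
Variable R : realType.
Implicit Types (x y t : R) (z w : R[i]).

(** Real-valued, unlike the norm of [R[i]], whose values are complex numbers. *)
Definition nm z : R := Normc.normc z.

Arguments nm : simpl never.

Lemma nm_def (a b : R) : nm (a +i* b)%C = Num.sqrt (a ^+ 2 + b ^+ 2).
Proof. by []. Qed.

Lemma nm_ge0 z : 0 <= nm z.
Proof. by case: z => a b; rewrite nm_def sqrtr_ge0. Qed.

Lemma nm0 : nm 0 = 0. Proof. exact: Normc.normc0. Qed.

Lemma nm1 : nm 1 = 1. Proof. exact: Normc.normc1. Qed.

Lemma nmM z w : nm (z * w) = nm z * nm w. Proof. exact: Normc.normcM. Qed.

Lemma nmD z w : nm (z + w) <= nm z + nm w. Proof. exact: le_normcD. Qed.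

Lemma nmN z : nm (- z) = nm z. Proof. exact: normcN. Qed.

Lemma nmJ z : nm z^*%C = nm z.
Proof. by case: z => a b; rewrite /nm /= sqrrN. Qed.

Lemma nm_real x : nm x%:C%C = `|x|.
Proof. by rewrite nm_def expr0n addr0 sqrtr_sqr. Qed.

Lemma nmB z w : nm (z - w) = nm (w - z).
Proof. by rewrite -nmN opprB. Qed.

Lemma nm_sum I (r : seq I) P (F : I -> R[i]) :
  nm (\sum_(i <- r | P i) F i) <= \sum_(i <- r | P i) nm (F i).
Proof.
elim/big_ind2: _ => // [|z x w y zx wy]; first by rewrite nm0.
exact: le_trans (nmD _ _) (lerD zx wy).
Qed.

Lemma nmX z n : nm (z ^+ n) = nm z ^+ n.
Proof. by elim: n => [|n IH]; rewrite ?expr0 ?exprS ?nmM ?IH //; exact: Normc.normc1. Qed.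

Lemma nm_int (m : int) : nm m%:~R = `|m|%:~R.
Proof. by rewrite -(rmorph_int (real_complex R)) nm_real intr_norm. Qed.

Lemma nm_sqr z : ((nm z ^+ 2)%:C)%C = z * z^*%C.
Proof.
case: z => a b; rewrite nm_def sqr_sqrtr ?addr_ge0 ?sqr_ge0 //.
by apply/eqP; rewrite eq_complex /=; apply/andP; split; apply/eqP; ring.
Qed.

Arguments conjc : simpl never.

(** The additive character of period 1, usually written e(x). *)
Definition expi x : R[i] := (cos (2 * pi * x) +i* sin (2 * pi * x))%C.

Arguments expi : simpl never.

Lemma expiD x y : expi (x + y) = expi x * expi y.
Proof. by rewrite /expi mulrDr cosD sinD /=; congr (_ +i* _)%C; ring. Qed.

Lemma expi0 : expi 0 = 1. Proof. by rewrite /expi mulr0 cos0 sin0. Qed.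

Lemma expi1 : expi 1 = 1.
Proof. by rewrite /expi mulr1 mulr_natl cos2pi sin2pi. Qed.

Lemma expiMn n x : expi (n%:R * x) = expi x ^+ n.
Proof.
elim: n => [|n IH]; first by rewrite mul0r expi0 expr0.
by rewrite -natr1 mulrDl mul1r expiD IH exprSr.
Qed.

Lemma expi_nat n : expi n%:R = 1.
Proof. by rewrite -[n%:R]mulr1 expiMn expi1 expr1n. Qed.

Lemma nm_expi x : nm (expi x) = 1.
Proof. by rewrite nm_def cos2Dsin2 sqrtr1. Qed.

Lemma expiJ x : (expi x)^*%C = expi (- x).
Proof. by rewrite /expi /conjc mulrN cosN sinN. Qed.

Lemma expiNn n x : expi (n%:R - x) = expi (- x).
Proof. by rewrite expiD expi_nat mul1r. Qed.

Lemma expi_neq0 x : expi x != 0.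
Proof. by apply/eqP => e; have := nm_expi x; rewrite e nm0 => /eqP; rewrite eq_sym oner_eq0. Qed.

Lemma pi_le4 : (pi : R) <= 4.
Proof. have [/andP[_ +] _] := pihalf_02_cos_pihalf R; lra. Qed.

Lemma lip1 (f df : R -> R) : (forall x : R, is_derive x 1 f (df x)) ->
  (forall x, `|df x| <= 1) -> forall x y, `|f x - f y| <= `|x - y|.
Proof.
move=> fd df1; suff H x y : y <= x -> `|f x - f y| <= `|x - y|.
  by move=> x y; case: (leP y x) => [/H //|/ltW/H]; rewrite distrC [X in _ <= X]distrC.
move=> yx; have [|c _ ->] := @MVT_segment R f df y x yx (fun x _ => fd x).
  by apply: continuous_subspaceT => z; apply: differentiable_continuous;
    apply/derivable1_diffP; have [] := fd z.
by rewrite normrM ler_piMl.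
Qed.

Lemma cos_lip x y : `|cos x - cos y| <= `|x - y|.
Proof.
apply: (@lip1 _ (fun x => - sin x)) => z.
by rewrite normrN ler_norml sin_le1 andbT sin_geN1.
Qed.

Lemma sin_lip x y : `|sin x - sin y| <= `|x - y|.
Proof.
apply: (@lip1 _ cos) => z.
by rewrite ler_norml cos_le1 andbT cos_geN1.
Qed.

(** The bound pi <= 4 gives the constant 8 for each coordinate, and 8 sqrt 2 <= 16. *)
Lemma expi_lip x y : nm (expi x - expi y) <= 16 * `|x - y|.
Proof.
have E : (expi x - expi y) = ((cos (2 * pi * x) - cos (2 * pi * y)) +i* (sin (2 * pi * x) - sin (2 * pi * y)))%C by [].
have H : `|2 * pi * x - 2 * pi * y| <= 8 * `|x - y|.
  by rewrite -mulrBr normrM ler_wpM2r // ger0_norm ?mulr_ge0 ?pi_ge0 //; have := pi_le4; lra.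
rewrite E nm_def -(ger0_norm (_ : 0 <= 16 * `|x - y|)) ?mulr_ge0 // -sqrtr_sqr ler_sqrt ?sqr_ge0 //.
rewrite -[X in X + _]real_normK ?num_real // -[X in _ + X]real_normK ?num_real //.
have c := le_trans (cos_lip _ _) H; have s := le_trans (sin_lip _ _) H.
have := normr_ge0 (cos (2 * pi * x) - cos (2 * pi * y)).
have := normr_ge0 (sin (2 * pi * x) - sin (2 * pi * y)).
have := normr_ge0 (x - y).
move: c s; set a : R := `|cos _ - _|; set b : R := `|sin _ - _|; set d : R := `|x - y| => ad bd d0 b0 a0.
have : a ^+ 2 <= (8 * d) ^+ 2 by rewrite lerXn2r ?nnegrE ?mulr_ge0.
have : b ^+ 2 <= (8 * d) ^+ 2 by rewrite lerXn2r ?nnegrE ?mulr_ge0.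
rewrite exprMn [(16 * d) ^+ 2]exprMn => bd2 ad2; have := sqr_ge0 d; lra.
Qed.

(** For x >= 1/4 the cosine is not positive and the distance to 1 is at least 1. Smaller x are
    doubled until they reach that range: e(2 x) - 1 = (e(x) - 1) (e(x) + 1), and the last factor is
    at most 2. *)
Lemma expi_sub1_ge x : 0 <= x <= 1/2 -> 2 * x <= nm (expi x - 1).
Proof.
have big y : 1/4 <= y <= 1/2 -> 2 * y <= nm (expi y - 1).
  move=> yr; apply: (@le_trans _ _ 1); first lra.
  have p0 := pi_gt0 R.
  have c0 : cos (2 * pi * y) <= 0.
    have -> : 2 * pi * y = (2 * pi * y - pi) + pi by ring.
    rewrite cosDpi oppr_le0; apply: cos_ge0_pihalf; apply/andP; split; nra.
  have -> : expi y - 1 = ((cos (2 * pi * y) - 1) +i* (sin (2 * pi * y)))%C.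
    by rewrite /expi; apply/eqP; rewrite eq_complex /= subr0 !eqxx.
  rewrite nm_def -[X in X <= _]sqrtr1 ler_sqrt; last by rewrite addr_ge0 ?sqr_ge0.
  have := cos2Dsin2 (2 * pi * y); nra.
move=> /andP[x0 x2]; have [->|xn0] := eqVneq x 0; first by rewrite mulr0 nm_ge0.
have {xn0}x0 : 0 < x by rewrite lt_neqAle eq_sym xn0.
have [n] : exists n : nat, 1/4 <= 2 ^+ n * x.
  exists (Num.truncn (1 / (4 * x))).+1.
  have : 1 / (4 * x) < (Num.truncn (1 / (4 * x))).+1%:R by rewrite truncnS_gt.
  set k := (Num.truncn _).+1 => kx.
  have k2 : k%:R <= 2 ^+ k :> R by rewrite -natrX ler_nat ltnW // ltn_expl.
  rewrite -ler_pdivrMr //; apply: (le_trans _ k2); apply: (le_trans _ (ltW kx)).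
  by apply: le_of_eq; field; rewrite gt_eqF.
elim: n x x0 x2 => [|n IH] x x0 x2 xn.
  by move: xn; rewrite expr0 => xn; apply: big; apply/andP; split; lra.
have [x4|x4] := leP (1/4) x; first by apply: big; rewrite x4.
have : 2 * (2 * x) <= nm (expi (2 * x) - 1).
  by apply: IH; [rewrite mulr_gt0|lra|rewrite mulrA -exprSr].
have -> : expi (2 * x) - 1 = (expi x - 1) * (expi x + 1).
  by rewrite -subr_sqr expr1n expiMn.
rewrite nmM; have : nm (expi x + 1) <= 2.
  by apply: le_trans (nmD _ _) _; rewrite nm_expi nm1.
have := nm_ge0 (expi x - 1); have := nm_ge0 (expi x + 1); nra.
Qed.

Definition dirichlet K t : R[i] := \sum_(j < K) expi (j%:R * t).

Lemma dirichlet_le K t : nm (dirichlet K t) <= K%:R.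
Proof.
apply: le_trans (nm_sum _ _ _) _; under eq_bigr do rewrite nm_expi.
by rewrite sumr_const card_ord.
Qed.

Lemma dirichletM K t : dirichlet K t * (expi t - 1) = expi (K%:R * t) - 1.
Proof.
rewrite mulrC /dirichlet; under eq_bigr do rewrite expiMn.
by rewrite -subrX1 expiMn.
Qed.

Lemma dirichlet_le_inv K t : 0 < t <= 1/2 -> nm (dirichlet K t) <= t^-1.
Proof.
move=> /andP[t0 t2]; have g : 2 * t <= nm (expi t - 1) by apply: expi_sub1_ge; rewrite ltW.
have := congr1 nm (dirichletM K t); rewrite nmM => e.
have : nm (expi (K%:R * t) - 1) <= 2.
  by apply: le_trans (nmD _ _) _; rewrite nmN nm_expi nm1.
rewrite -e => h; rewrite -(ler_pM2r t0) mulVf ?gt_eqF //.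
have := nm_ge0 (dirichlet K t); nra.
Qed.

Lemma dirichlet_lip K x y : nm (dirichlet K x - dirichlet K y) <= 16 * K%:R ^+ 2 * `|x - y|.
Proof.
rewrite -sumrB; apply: le_trans (nm_sum _ _ _) _.
apply: (@le_trans _ _ (\sum_(j < K) 16 * K%:R * `|x - y|)).
  apply: ler_sum => j _; apply: le_trans (expi_lip _ _) _.
  rewrite -mulrBr normrM normr_nat -mulrA ler_wpM2l // ler_wpM2r // ler_nat.
  exact: ltnW.
by rewrite sumr_const card_ord -mulr_natl; apply: le_of_eq; ring.
Qed.

(** Better than [dirichlet_lip] once K y > 1, and only one of the two points has to stay away from
    0. The difference times e(y) - 1 equals D(x) (e(y) - e(x)) + e(K x) - e(K y), where D is the
    kernel. *)
Lemma dirichlet_lip_inv K x y : 0 < y <= 1/2 ->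
  nm (dirichlet K x - dirichlet K y) <= 16 * K%:R * `|x - y| / y.
Proof.
move=> /andP[y0 y2]; have g : 2 * y <= nm (expi y - 1) by apply: expi_sub1_ge; rewrite ltW.
have e : (dirichlet K x - dirichlet K y) * (expi y - 1) =
    dirichlet K x * (expi y - expi x) + (expi (K%:R * x) - expi (K%:R * y)).
  rewrite mulrBl dirichletM; have := dirichletM K x.
  set d := dirichlet K x => dE.
  have -> : d * (expi y - 1) = d * (expi y - expi x) + d * (expi x - 1) by ring.
  by rewrite dE; ring.
have h : nm (dirichlet K x - dirichlet K y) * nm (expi y - 1) <= 32 * K%:R * `|x - y|.
  rewrite -nmM e; apply: le_trans (nmD _ _) _.
  have h1 : nm (dirichlet K x * (expi y - expi x)) <= K%:R * (16 * `|x - y|).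
    rewrite nmM distrC; apply: ler_pM; rewrite ?nm_ge0 ?dirichlet_le //.
    by rewrite expi_lip.
  have h2 : nm (expi (K%:R * x) - expi (K%:R * y)) <= 16 * (K%:R * `|x - y|).
    by apply: le_trans (expi_lip _ _) _; rewrite -mulrBr normrM normr_nat.
  lra.
rewrite ler_pdivlMr //.
have := nm_ge0 (dirichlet K x - dirichlet K y); nra.
Qed.

End ComplexExponential.

(** * Gauss sums of squarefree modulus *)

Section GaussSums.
Variable R : realType.

(** The lower entry of the symbol comes first: for odd n, [chi n] is a character modulo n. *)
Definition chi (n a : nat) : R[i] := (kronecker a n)%:~R.

Definition expiq (q a : nat) : R[i] := expi (a%:R / q%:R : R).

Arguments conjc : simpl never.
Arguments chi : simpl never.
Arguments expiq : simpl never.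

Lemma chiM n a b : odd n -> chi n (a * b) = chi n a * chi n b.
Proof. by move=> on; rewrite /chi kroneckerMl // intrM. Qed.

Lemma chi_mod n a : odd n -> chi n (a %% n) = chi n a.
Proof. by move=> on; rewrite /chi (@eq_kronecker n _ a) // modn_mod. Qed.

Lemma chi_conj n a : (chi n a)^*%C = chi n a.
Proof. by rewrite /chi rmorph_int. Qed.

Lemma nm_chi n a : (0 < n)%N -> nm (chi n a) = (coprime a n)%:R.
Proof. by move=> n0; rewrite /chi nm_int kronecker_norm // mulrz_nat. Qed.

Lemma nm_chi_le1 n a : (0 < n)%N -> nm (chi n a) <= 1.
Proof. by move=> n0; rewrite nm_chi //; case: coprime. Qed.

Lemma chi0 n : odd n -> (1 < n)%N -> chi n 0 = 0.
Proof. 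
move=> on n1; rewrite /chi kronecker_eq0 ?(ltnW n1) //.
by rewrite /coprime gcd0n; apply/eqP => e; rewrite e in n1. Qed.

Lemma expiqD q a b : expiq q (a + b) = expiq q a * expiq q b.
Proof. by rewrite /expiq natrD mulrDl expiD. Qed.

Lemma expiqM q a : (0 < q)%N -> expiq q (a * q) = 1.
Proof. by move=> q0; rewrite /expiq natrM mulfK ?pnatr_eq0 -?lt0n // expi_nat. Qed.

Lemma expiq_mod q a : (0 < q)%N -> expiq q (a %% q) = expiq q a.
Proof. by move=> q0; rewrite {2}(divn_eq a q) expiqD expiqM // mul1r. Qed.

Lemma expiq_neq1 q a : (0 < q)%N -> ~~ (q %| a)%N -> expiq q a != 1.
Proof.
move=> q0; rewrite -(expiq_mod _ q0) /dvdn -lt0n => am0; apply/eqP => e1.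
have am := ltn_pmod a q0; have qR : (0 : R) < q%:R by rewrite ltr0n.
move: {a} (a %% q)%N am0 am e1 => a a0 aq e1.
wlog le : a a0 aq e1 / (2 * a <= q)%N.
  move=> W; case: (leqP (2 * a) q) => [|le]; first exact: W.
  apply: (W (q - a)%N); try lia.
  rewrite /expiq natrB ?(ltnW aq) // mulrBl divff ?gt_eqF // -[1]/(1%:R) expiNn.
  by rewrite -expiJ -/(expiq _ _) e1 conjc1.
have := @expi_sub1_ge R (a%:R / q%:R); rewrite -/(expiq _ _) e1 subrr nm0.
have -> : a%:R / q%:R <= 1 / 2 :> R.
  by rewrite ler_pdivrMr // mulrAC ler_pdivlMr // mul1r -natrM ler_nat mulnC.
rewrite divr_ge0 ?ler0n //= => /(_ isT).
by apply/negP; rewrite -ltNge mulr_gt0 // divr_gt0 // ltr0n.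
Qed.

Lemma expiq_sum q a : (0 < q)%N ->
  \sum_(h < q) expiq q (h * a) = if (q %| a)%N then q%:R else 0.
Proof.
move=> q0; have e h : expiq q (h * a) = expiq q a ^+ h.
  by rewrite /expiq natrM -mulrA expiMn.
under eq_bigr do rewrite e.
case: ifP => qa.
  have -> : expiq q a = 1 by case/dvdnP: qa => k ->; rewrite expiqM.
  by under eq_bigr do rewrite expr1n; rewrite sumr_const card_ord.
have a1 : expiq q a - 1 != 0 by rewrite subr_eq0 expiq_neq1 // qa.
apply: (mulfI a1); rewrite -subrX1 mulr0 -e mulnC expiqM // subrr //.
Qed.

Section OneModulus.
Variable q : nat.
Hypotheses (oq : odd q) (sq : squarefree q) (q1 : (1 < q)%N).
Let q0 : (0 < q)%N := ltnW q1.

Definition gauss := \sum_(h < q) chi q h * expiq q h.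

(** This is the primitivity of [chi q]: it is not trivial on the residues that are 1 modulo q / p.
    As q is squarefree, p is prime to q / p and the Chinese remainder theorem yields u from a
    non-residue modulo p. *)
Lemma chi_nonresidue p : prime p -> (p %| q)%N ->
  exists u, [/\ coprime u q, (u = 1 %[mod q %/ p])%N & chi q u = -1].
Proof.
move=> prp pq; have op := odd_dvdn pq oq; have [v kv] := nonresidue prp op.
have qE : q = (p * (q %/ p))%N by rewrite mulnC divnK.
have cop : coprime p (q %/ p).
  rewrite prime_coprime //; apply/negP => pp; have /squarefreeP[_ H] := sq.
  by move: (prp); rewrite (H p) // qE -mulnn dvdn_mul.
pose u := chinese p (q %/ p) v 1.
have up : (u = v %[mod p])%N := chinese_modl cop v 1.
have uq : (u = 1 %[mod q %/ p])%N := chinese_modr cop v 1.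
have oqp : odd (q %/ p) by apply: odd_dvdn oq; rewrite {2}qE dvdn_mull.
have ku : kronecker u q = -1.
  rewrite {1}qE kroneckerM ?(prime_gt0 prp) ?(odd_gt0 oqp) // (eq_kronecker oqp uq) kronecker1l //.
  by rewrite mulr1 (eq_kronecker op up) kronecker_prime_l.
exists u; split=> //; last by rewrite /chi ku.
by apply/negPn/negP => /(kronecker_eq0 q0); rewrite ku.
Qed.

(** If m is prime to q, h is replaced by h m. Otherwise take u from [chi_nonresidue] for a common
    prime: it fixes m modulo q, so the substitution h -> h u negates the left side, which therefore
    vanishes like [chi q m]. *)
Lemma gauss_separable m : \sum_(h < q) chi q h * expiq q (h * m) = chi q m * gauss.
Proof.
have [cmq|ncmq] := boolP (coprime m q).
  have m2 : chi q m * chi q m = 1.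
    by rewrite /chi -intrM -expr2 kronecker_sign.
  rewrite /gauss -(@sum_mul_unit _ q m (fun h => chi q h * expiq q h)) //; last first.
    by move=> h; rewrite chi_mod // expiq_mod.
  rewrite mulr_sumr; apply: eq_bigr => h _.
  by rewrite chiM // mulrA mulrCA m2 mulr1.
rewrite [chi q m]/chi kronecker_eq0 // mul0r.
have g1 : (1 < gcdn m q)%N by rewrite ltn_neqAle eq_sym ncmq gcdn_gt0 q0 orbT.
have prp := pdiv_prime g1; have pg := pdiv_dvd (gcdn m q).
move: prp pg; set p := pdiv _ => prp pg.
have pm := dvdn_trans pg (dvdn_gcdl _ _); have pq := dvdn_trans pg (dvdn_gcdr _ _).
have [u [cu uq ku]] := chi_nonresidue prp pq.
have um : (u * m = m %[mod q])%N.
  have qE : q = (p * (q %/ p))%N by rewrite mulnC divnK.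
  have : (p * u = p * 1 %[mod p * (q %/ p)])%N by rewrite -!muln_modr uq.
  rewrite muln1 -qE => up; case/dvdnP: pm => k ->.
  by rewrite mulnCA [(u * p)%N]mulnC -modnMmr up modnMmr.
have := @sum_mul_unit _ q u (fun h => chi q h * expiq q (h * m)) cu.
have -> : \sum_(h < q) chi q (h * u) * expiq q (h * u * m) =
          - \sum_(h < q) chi q h * expiq q (h * m).
  rewrite -sumrN; apply: eq_bigr => h _; rewrite chiM // ku mulrN1 mulNr; congr (- (_ * _)).
  by rewrite -mulnA -(expiq_mod _ q0) -modnMmr um modnMmr expiq_mod.
move=> /(_ _)/eqP; rewrite eq_sym -addr_eq0 -mulr2n mulrn_eq0 /= => E.
by apply/eqP/E => h; rewrite chi_mod // -(expiq_mod (_ * m) q0) modnMml expiq_mod.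
Qed.

(** Parseval: the squared moduli of the transform [chi q m * gauss] are summed over m in two ways,
    and the factor phi(q), which is [phi], cancels. *)
Lemma gauss_norm : nm gauss ^+ 2 = q%:R.
Proof.
pose phi : R[i] := \sum_(h < q) chi q h ^+ 2.
have phi0 : phi != 0.
  have -> : phi = (\sum_(h < q) coprime h q)%:R.
    rewrite natr_sum; apply: eq_bigr => h _.
    by rewrite /chi -rmorphXn /= kronecker_sqr // rmorph_nat.
  rewrite pnatr_eq0 -lt0n (bigD1 (Ordinal q1)) //= coprime1n //.
have phiE : phi * (nm gauss ^+ 2)%:C%C = phi * q%:R.
  rewrite nm_sqr /phi [LHS]mulr_suml [RHS]mulr_suml.
  transitivity (\sum_(m < q) (chi q m * gauss) * (chi q m * gauss)^*%C).
    by apply: eq_bigr => m _; rewrite rmorphM /= chi_conj mulrACA.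
  transitivity (\sum_(m < q) \sum_(h < q) \sum_(k < q)
      chi q h * expiq q (h * m) * (chi q k * (expiq q (k * m))^*%C)).
    apply: eq_bigr => m _; rewrite -gauss_separable rmorph_sum big_distrlr /=.
    by apply: eq_bigr => h _; apply: eq_bigr => k _; rewrite rmorphM /= chi_conj.
  rewrite exchange_big /=; apply: eq_bigr => h _.
  rewrite exchange_big /= (bigD1 h) //= [X in _ + X]big1 ?addr0.
    transitivity (\sum_(m < q) chi q h ^+ 2).
      by apply: eq_bigr => m _; rewrite mulrACA /expiq expiJ -expiD subrr expi0 mulr1 -expr2.
    by rewrite sumr_const card_ord mulr_natr.
  move=> k kh; transitivity (chi q h * chi q k * \sum_(m < q) expiq q (m * (h + (q - k)))).
    rewrite mulr_sumr; apply: eq_bigr => m _.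
    rewrite mulrACA; congr (_ * _).
    rewrite /expiq expiJ -expiD mulnDr mulnBr !natrD natrB ?leq_mul2l ?(ltnW (ltn_ord k)) ?orbT //.
    rewrite (_ : (_ + _) / _ = (h * m)%:R / q%:R - (k * m)%:R / q%:R + m%:R).
      by rewrite [in RHS]expiD expi_nat mulr1.
    by rewrite !natrM; field; rewrite pnatr_eq0 -lt0n.
  rewrite expiq_sum // ifN ?mulr0 //; apply: contra kh => /dvdnP[c cE].
  have hq := ltn_ord h; have kq := ltn_ord k; apply/eqP/val_inj => /=.
  by case: c cE => [|[|c]]; rewrite ?mulSn; lia.
have /(mulfI phi0) := phiE.
by move/(congr1 (@complex.Re R)); rewrite /= -[q%:R]/(q%:R) -(rmorph_nat (real_complex R)).
Qed.

(** This is (q^2 - 1) / 8, hence the inverse of -8 modulo q. An explicit polynomial in q is chosen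
    so that the resulting phases can later be computed from q modulo 8. *)
Definition inv8 := (q ^ 2 %/ 8)%N.

Lemma inv8E : (8 * inv8 + 1 = q ^ 2)%N.
Proof.
have : (q ^ 2 %% 8 = 1)%N.
  rewrite -modnXm; have : odd (q %% 8) by move: oq; rewrite {1}(divn_eq q 8) oddD oddM andbF.
  by have := ltn_pmod q (isT : 0 < 8)%N; case: (q %% 8)%N => [|[|[|[|[|[|[|[|?]]]]]]]].
by move=> e; rewrite /inv8 [in RHS](divn_eq (q ^ 2) 8) e mulnC.
Qed.

Lemma coprime_inv8 : coprime inv8 q.
Proof.
rewrite -(coprime_pexpr _ _ (isT : 0 < 2)%N) -inv8E /coprime.
by rewrite gcdnMDl gcdn1.
Qed.

Lemma expiq_inv8 g j : expiq q (g * inv8 * (8 * j)) = (expiq q (g * j))^*%C.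
Proof.
have e : expiq q (g * j) * (expiq q (g * j))^*%C = 1.
  by rewrite /expiq expiJ -expiD subrr expi0.
have n0 : expiq q (g * j) != 0 by exact: expi_neq0.
apply: (mulfI n0); rewrite e -expiqD.
have -> : (g * j + g * inv8 * (8 * j) = g * j * q * q)%N.
  have -> : (g * j + g * inv8 * (8 * j) = g * j * (8 * inv8 + 1))%N by ring.
  by rewrite inv8E; ring.
by rewrite expiqM.
Qed.

(** In the dual sum the start r of the progression enters only through this phase, and the set of
    steps only through [dual_sum]. *)
Definition dual_phase r g : R[i] := (expiq q (g * inv8 * r))^*%C.
Definition dual_sum (js : seq nat) g : R[i] := \sum_(j <- js) expiq q (g * j).

Lemma nm_dual_phase r g : nm (dual_phase r g) = 1.
Proof. by rewrite nmJ nm_expi. Qed.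

Lemma expiq_rev g x : (g <= q)%N -> expiq q ((q - g) * x) = (expiq q (g * x))^*%C.
Proof.
move=> gq; rewrite /expiq expiJ mulnBl natrB ?leq_mul2r ?gq ?orbT // mulrBl.
by rewrite natrM mulrAC divff ?mul1r ?expiNn // pnatr_eq0 -lt0n.
Qed.

(* Fourier inversion, reindexed by [h = g * inv8] so that the step 8 of the progression disappears
   from the frequencies; the terms [g] and [q - g] are conjugate up to sign. *)
Lemma character_sum_dual r (js : seq nat) :
  Num.sqrt q%:R * nm (\sum_(j <- js) chi q (r + 8 * j)) <=
  2 * nm (\sum_(1 <= g < q | (2 * g < q)%N) chi q g * (dual_phase r g * dual_sum js g)).
Proof.
set S := \sum_(j <- js) _.
pose B g := chi q g * (dual_phase r g * dual_sum js g).
have gE : nm gauss = Num.sqrt q%:R.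
  by rewrite -gauss_norm sqrtr_sqr ger0_norm ?nm_ge0.
have E : gauss * S = chi q inv8 * (\sum_(0 <= g < q) B g)^*%C.
  rewrite rmorph_sum mulr_sumr mulr_sumr /=.
  transitivity (\sum_(j <- js) \sum_(h < q) chi q h * expiq q (h * (r + 8 * j))).
    by apply: eq_bigr => j _; rewrite gauss_separable mulrC.
  rewrite exchange_big /= big_mkord.
  pose F h := \sum_(j <- js) chi q h * expiq q (h * (r + 8 * j)).
  rewrite -[LHS]/(\sum_(h < q) F h) -(sum_mul_unit (F := F) coprime_inv8); last first.
    move=> h; apply: eq_bigr => j _; rewrite chi_mod // -(expiq_mod (_ * _) q0) modnMml.
    by rewrite expiq_mod.
  apply: eq_bigr => g _; rewrite /F /B !rmorphM /= chi_conj /dual_phase conjcK /dual_sum.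
  rewrite rmorph_sum !mulr_sumr; apply: eq_bigr => j _ /=.
  by rewrite chiM // mulnDr expiqD expiq_inv8; ring.
have -> : Num.sqrt q%:R * nm S = nm (\sum_(0 <= g < q) B g).
  rewrite -gE -nmM E nmM nmJ nm_chi // coprime_inv8 mul1r //.
rewrite big_ltn // {1}/B chi0 // mul0r add0r.
rewrite (bigID (fun g => 2 * g < q)%N) /=.
set T := \sum_(1 <= g < q | _) B g.
suff -> : \sum_(1 <= g < q | ~~ (2 * g < q)%N) B g = chi q q.-1 * T^*%C.
  apply: le_trans (nmD _ _) _; rewrite nmM nmJ -[nm T in X in X <= _]mul1r -/T.
  by rewrite mulrDl mul1r lerD2l ler_piMl ?nm_ge0 // nm_chi_le1.
rewrite big_nat_rev /= rmorph_sum mulr_sumr big_nat_cond [RHS]big_nat_cond /=.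
apply: eq_big => [g|g /andP[/andP[g1 gq] _]].
  case: (boolP (1 <= g < q)%N) => //= /andP[g1 gq]; rewrite -leqNgt leq_eqVlt.
  have -> : (1 + q - g.+1 = q - g)%N by lia.
  have -> : (q == 2 * (q - g))%N = false.
    by apply/negbTE/negP => /eqP e; move: oq; rewrite e mul2n odd_double.
  by rewrite /=; apply/idP/idP; lia.
have -> : (1 + q - g.+1 = q - g)%N by lia.
rewrite /B !rmorphM /= chi_conj [RHS]mulrA -chiM //; congr (_ * (_ * _)).
- rewrite -(chi_mod _ oq) -[in RHS](chi_mod _ oq); congr (chi q _).
  have -> : (q.-1 * g = q - g + (g - 1) * q)%N by nia.
  by rewrite addnC modnMDl.
- by rewrite /dual_phase -mulnA expiq_rev ?(ltnW gq) // -mulnA.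
- rewrite /dual_sum rmorph_sum /=; apply: eq_bigr => j _.
  by rewrite expiq_rev // ltnW.
Qed.

End OneModulus.
End GaussSums.

(** * The Polya-Vinogradov inequality *)

Lemma prod_primes_dvd t : (0 < t)%N -> (\prod_(p <- primes t) p %| t)%N.
Proof.
move=> t0; rewrite {2}(prod_prime_decomp t0) /primes /unzip1 big_map big_seq [X in (_ %| X)%N]big_seq.
elim/big_ind2: _ => // [a b c d|f fi]; first exact: dvdn_mul.
by case: f fi => p k /mem_prime_decomp[_ k0 _]; rewrite dvdn_exp.
Qed.

(** The substitution n = b + e j; the new end points are the ceilings of (x - b) / e, and adding e -
    1 first keeps the natural subtraction of b < e exact. *)
Lemma sum_progression (V : nmodType) (P : pred nat) (F : nat -> V) e b x0 x1 :
  (b < e)%N -> (x0 <= x1)%N ->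
  \sum_(x0 <= n < x1 | P n && (n %% e == b)%N) F n =
  \sum_((x0 + (e - 1) - b) %/ e <= j < (x1 + (e - 1) - b) %/ e | P (b + e * j)%N) F (b + e * j)%N.
Proof.
move=> be x01; rewrite -(subnKC x01); elim: (x1 - x0)%N => [|d IH].
  by rewrite addn0 !big_geq.
have e0 : (0 < e)%N by apply: leq_ltn_trans be.
rewrite addnS big_mkcond big_nat_recr ?leq_addr //= -big_mkcond IH.
set n := (x0 + d)%N.
have [nb|nb] := eqVneq (n %% e)%N b; last first.
  rewrite andbF addr0; congr (\sum_(_ <= _ < _ | _) _).
  have nE := divn_eq n e; set c := (n %/ e)%N in nE.
  have ne := ltn_pmod n e0; set r := (n %% e)%N in nE ne nb.
  have [rb|rb] := ltnP r b.
    rewrite !nE (_ : c * e + r + (e - 1) - b = c * e + (r + e - 1 - b))%N; last lia.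
    rewrite (_ : (c * e + r).+1 + (e - 1) - b = c * e + (r + e - b))%N; last lia.
    by rewrite !divnMDl // !divn_small //; lia.
  have {nb rb}rb : (b < r)%N by rewrite ltn_neqAle eq_sym nb.
  rewrite !nE (_ : c * e + r + (e - 1) - b = c.+1 * e + (r - 1 - b))%N; last by rewrite mulSn; lia.
  rewrite (_ : (c * e + r).+1 + (e - 1) - b = c.+1 * e + (r - b))%N; last by rewrite mulSn; lia.
  by rewrite !divnMDl // !divn_small //; lia.
have nE := divn_eq n e; set c := (n %/ e)%N in nE; rewrite nb in nE.
have -> : ((n + (e - 1) - b) %/ e = c)%N.
  rewrite nE (_ : c * e + b + (e - 1) - b = c * e + (e - 1))%N; last lia.
  by rewrite divnMDl // divn_small //; lia.
have -> : ((n.+1 + (e - 1) - b) %/ e = c.+1)%N.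
  rewrite nE (_ : (c * e + b).+1 + (e - 1) - b = c.+1 * e)%N; last by rewrite mulSn; lia.
  by rewrite mulnK.
have cc : ((x0 + (e - 1) - b) %/ e <= c)%N.
  rewrite -ltnS ltn_divLR // mulSn; have : (x0 <= n)%N by rewrite leq_addr.
  by rewrite nE; lia.
rewrite [RHS]big_mkcond big_nat_recr //= -big_mkcond andbT.
by have -> : (b + e * c = n)%N by rewrite nE mulnC addnC.
Qed.

(** * A logarithm bounded below by 1 *)

Section Logarithm.
Variable R : realType.

(** Adding 1 makes the function at least 1 everywhere, including at 0 and 1, so that it is
    submultiplicative and its powers increase with the exponent. *)
Definition lg n : R := 1 + ln n%:R.

Lemma lgE n : lg n = 1 + ln n%:R. Proof. by []. Qed.

Lemma lg_ge1 n : 1 <= lg n.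
Proof.
rewrite /lg lerDl; case: n => [|n]; first by rewrite ln0.
by rewrite ln_ge0 // ler1n.
Qed.

Lemma lg_gt0 n : 0 < lg n. Proof. exact: lt_le_trans (lg_ge1 n). Qed.

Lemma lg_ge0 n : 0 <= lg n. Proof. exact/ltW/lg_gt0. Qed.

Lemma lg_le m n : (m <= n)%N -> lg m <= lg n.
Proof.
case: m => [|m] mn; first by rewrite /lg ln0 // addr0 lg_ge1.
by rewrite lerD2l ler_ln ?posrE ?ltr0n ?ler_nat //; lia.
Qed.

Lemma lgM m n : lg (m * n) <= lg m * lg n.
Proof.
case: m => [|m]; first by rewrite mul0n /lg ln0 // addr0 mul1r lg_ge1.
case: n => [|n]; first by rewrite muln0 /lg ln0 // addr0 mulr1 lg_ge1.
have := lg_ge1 m.+1; have := lg_ge1 n.+1; rewrite /lg natrM lnM ?posrE ?ltr0n //.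
rewrite !lerDl => a b; have := mulr_ge0 a b; lra.
Qed.

Lemma lgX2 n : lg (n ^ 2) <= 2 * lg n.
Proof.
case: n => [|n]; first by have := lg_ge1 0; rewrite exp0n //; lra.
have := lg_ge1 n.+1; rewrite /lg natrX lnXn ?ltr0n // mulr2n; lra.
Qed.

Lemma harmonic_le n : \sum_(1 <= k < n.+1) (k%:R : R)^-1 <= lg n.
Proof.
elim: n => [|n IH]; first by rewrite big_geq // lg_ge0.
rewrite big_nat_recr //=; case: n IH => [|n] IH.
  by rewrite big_geq // add0r /lg ln1 addr0 invr1.
apply: le_trans (lerD IH (lexx _)) _; rewrite /lg -addrA lerD2l.
have n0 : (0 : R) < n.+2%:R by rewrite ltr0n.
have h : ln (1 + - (n.+2%:R : R)^-1) <= - (n.+2%:R)^-1.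
  by apply: le_ln1Dx; rewrite ltrN2 invf_lt1 // ltr1n.
have e : (n.+1%:R : R) = n.+2%:R * (1 + - (n.+2%:R)^-1).
  by rewrite mulrDr mulr1 mulrN divff ?gt_eqF // -[n.+2%:R]natr1 addrK.
have p : (0 : R) < 1 + - (n.+2%:R)^-1 by rewrite subr_gt0 invf_lt1 // ltr1n.
rewrite e lnM ?posrE // -addrA gerDl -lerBrDr sub0r.
exact: h.
Qed.

End Logarithm.

Opaque lg.

Section PolyaVinogradov.
Variable R : realType.

Lemma half_harmonic_le (f : nat -> R) q : (0 < q)%N ->
  (forall g, (0 < g)%N -> (2 * g < q)%N -> f g <= q%:R / g%:R) ->
  \sum_(1 <= g < q | (2 * g < q)%N) f g <= q%:R * lg R q.
Proof.
move=> q0 fle; apply: (@le_trans _ _ (\sum_(1 <= g < q) q%:R * g%:R^-1)).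
  rewrite big_mkcond big_nat_cond [X in _ <= X]big_nat_cond.
  apply: ler_sum => g /andP[/andP[g1 _] _]; case: ifP => g2; first exact: fle.
  by rewrite mulr_ge0 // invr_ge0.
rewrite -mulr_sumr ler_wpM2l //; apply: le_trans (harmonic_le _ _).
by rewrite [X in _ <= X]big_nat_recr //= lerDl invr_ge0.
Qed.

(** Each dual sum is a geometric sum of ratio e(g / s), at most s / g for g < s / 2. The total s lg
    s is divided by the modulus sqrt s of the Gauss sum. *)
Lemma polya_vinogradov s b j0 J : odd s -> squarefree s -> (1 < s)%N ->
  `|\sum_(j0 <= j < J) kronecker (b + 8 * j) s|%:~R <= 2 * Num.sqrt s%:R * lg R s.
Proof.
move=> os ss s1; have s0 := ltnW s1.
have := @character_sum_dual R s os ss s1 b (index_iota j0 J).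
have -> : \sum_(j0 <= j < J) chi R s (b + 8 * j) = (\sum_(j0 <= j < J) kronecker (b + 8 * j) s)%:~R.
  by rewrite rmorph_sum.
rewrite nm_int; set X : R := _%:~R.
set T := nm _ => XT; have {}XT : Num.sqrt s%:R * X <= 2 * (s%:R * lg R s).
  apply: le_trans XT _; rewrite ler_wpM2l // /T.
  apply: le_trans (nm_sum _ _ _) _; apply: half_harmonic_le => // g g0 gs.
  rewrite !nmM nm_dual_phase mul1r; apply: le_trans (ler_piMl (nm_ge0 _) (nm_chi_le1 _ _ s0)) _.
  rewrite /dual_sum /index_iota -[j0]addn0 iotaDl big_map.
  move: (J - (j0 + 0))%N => m.
  have -> : \sum_(j <- iota 0 m) expiq R s (g * (j0 + j)) =
     expiq R s (g * j0) * dirichlet m (g%:R / s%:R).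
    rewrite -{1}[m]subn0 -/(index_iota 0 m) big_mkord mulr_sumr; apply: eq_bigr => j _.
    by rewrite mulnDr expiqD; congr (_ * _); rewrite /expiq mulnC natrM -mulrA.
  rewrite nmM nm_expi mul1r; apply: le_trans (dirichlet_le_inv _ _) _; last by rewrite invf_div.
  rewrite divr_gt0 ?ltr0n //= ler_pdivrMr ?ltr0n // mulrAC ler_pdivlMr // mul1r -natrM ler_nat.
  by rewrite mulnC ltnW.
have r0 : 0 < Num.sqrt (s%:R : R) by rewrite sqrtr_gt0 ltr0n.
rewrite -(ler_pM2l r0); apply: le_trans XT _.
have := sqr_sqrtr (ler0n R s); rewrite expr2 => {1}<-.
by apply: le_of_eq; ring.
Qed.

Lemma polya_vinogradov_mod8 s b x0 x1 : odd s -> squarefree s -> (1 < s)%N ->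
  `|\sum_(x0 <= n < x1 | (n %% 8 == b)%N) kronecker n s|%:~R <= 2 * Num.sqrt s%:R * lg R s.
Proof.
move=> os ss s1; have pos : 0 <= 2 * Num.sqrt s%:R * lg R s.
  by rewrite !mulr_ge0 ?sqrtr_ge0 ?lg_ge0.
have [x01|/ltnW x10] := leqP x0 x1; last by rewrite big_geq // normr0.
have [b8|b8] := ltnP b 8.
  by rewrite (sum_progression xpredT _ b8 x01) /=; apply: polya_vinogradov.
rewrite big1 ?normr0 // => n /eqP nb; have := ltn_pmod n (isT : 0 < 8)%N.
by rewrite nb ltnNge b8.
Qed.

Lemma odd_sqr_mod8 e : odd e -> (e * e = 1 %[mod 8])%N.
Proof.
move=> oe; rewrite -modnMm; have : odd (e %% 8) by move: oe; rewrite {1}(divn_eq e 8) oddD oddM andbF.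
by have := ltn_pmod e (isT : 0 < 8)%N; case: (e %% 8)%N => [|[|[|[|[|[|[|[|?]]]]]]]].
Qed.

(** An odd e is its own inverse modulo 8. *)
Lemma mul_class e m r : odd e -> (r < 8)%N -> ((e * m) %% 8 == r)%N = (m %% 8 == (e * r) %% 8)%N.
Proof.
move=> oe r8; have e2 := odd_sqr_mod8 oe; apply/eqP/eqP => [<-|mE].
  by rewrite modnMmr mulnA -[RHS]modnMml e2 modnMml mul1n.
by rewrite -modnMmr mE modnMmr mulnA -modnMml e2 modnMml mul1n modn_small.
Qed.

(* Reciprocity turns [n |-> (k / n)] on a class mod 8 into a character modulo the odd squarefree part of [k]. *)
Lemma reciprocal_character_sum k b x0 x1 u s t : u \in [:: 1; 2]%N -> odd s -> squarefree s ->
  (1 < s)%N -> (0 < t)%N -> k = (u * s * t ^ 2)%N ->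
  odd b -> (b < 8)%N ->
  `|\sum_(x0 <= n < x1 | (n %% 8 == b)%N) kronecker k n|%:~R <= 2 * Num.sqrt k%:R * lg R k.
Proof.
move=> uI os ss s1 t0 kE ob b8.
have oddn n : (n %% 8 == b)%N -> odd n.
  by move=> /eqP nb; move: ob; rewrite -nb [in odd n](divn_eq n 8) oddD oddM andbF.
pose c := kronecker u b * (-1) ^+ (s./2 * b./2).
have c1 : `|c| <= 1.
  rewrite normrM normrX normrN1 expr1n mulr1 kronecker_norm_le1 //; exact: odd_gt0.
have -> : \sum_(x0 <= n < x1 | (n %% 8 == b)%N) kronecker k n =
   c * \sum_(e <- subprods (primes t)) liou e *
      \sum_(x0 <= n < x1 | (n %% 8 == b)%N) (e %| n)%:R * kronecker n s.
  transitivity (c * \sum_(x0 <= n < x1 | (n %% 8 == b)%N) (coprime n t)%:R * kronecker n s).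
    rewrite mulr_sumr; apply: eq_bigr => n nb; have on := oddn n nb.
    rewrite kE !kroneckerMl // -expr2 -[kronecker t n ^+ 2]/(_ ^+ 2) kronecker_sqr ?odd_gt0 //.
    rewrite (jacobi_reciprocity os on) (@eq_jacobi_sign s n b) //; last first.
      by rewrite -(eqP nb) modn_mod.
    have -> : kronecker u n = kronecker u b.
      move: uI; rewrite !inE => /orP[]/eqP->; first by rewrite !kronecker1l.
      by apply: eq_kronecker2 => //; rewrite -(eqP nb) modn_mod.
    by rewrite coprime_sym /c; ring.
  congr (_ * _); under eq_bigr do rewrite coprime_sieve // mulr_suml.
  rewrite exchange_big /=; apply: eq_bigr => e _; rewrite mulr_sumr.
  by apply: eq_bigr => n _; rewrite mulrA.
have allp : all prime (primes t) by apply/allP => p; rewrite mem_primes => /and3P[].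
have inner e : e \in subprods (primes t) ->
   `|\sum_(x0 <= n < x1 | (n %% 8 == b)%N) (e %| n)%:R * kronecker n s|%:~R
     <= 2 * Num.sqrt s%:R * lg R s.
  move=> ei; have e0 := subprods_gt0 allp ei.
  have -> : \sum_(x0 <= n < x1 | (n %% 8 == b)%N) (e %| n)%:R * kronecker n s =
     \sum_(x0 <= n < x1 | (n %% 8 == b)%N && (n %% e == 0)%N) kronecker n s.
    rewrite big_mkcondr /=; apply: eq_bigr => n _; rewrite /dvdn.
    by case: eqP; rewrite ?mul1r ?mul0r.
  have pos : 0 <= 2 * Num.sqrt s%:R * lg R s by rewrite !mulr_ge0 ?sqrtr_ge0 ?lg_ge0.
  have [x01|/ltnW x10] := leqP x0 x1; last by rewrite big_geq // normr0.
  rewrite sum_progression //.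
  have [oe|ne] := boolP (odd e); last first.
    rewrite big1 ?normr0 // => j /eqP jb; move: ob; rewrite -jb add0n.
    have -> : odd ((e * j) %% 8) = odd (e * j) by rewrite [in RHS](divn_eq (e * j) 8) oddD oddM andbF.
    by rewrite oddM (negbTE ne).
  under eq_bigr do rewrite add0n kroneckerMl //.
  rewrite -mulr_sumr normrM intrM.
  apply: le_trans (ler_wpM2r _ (_ : _ <= 1)) _; first by rewrite ler0z.
    by rewrite -[1]/(1%:~R) ler_int kronecker_norm_le1 // odd_gt0.
  rewrite mul1r.
  rewrite (eq_bigl (fun j => j %% 8 == (e * b) %% 8)%N); first exact: polya_vinogradov_mod8.
  by move=> j; rewrite add0n mul_class.
rewrite normrM intrM; apply: le_trans (ler_wpM2r _ (_ : _ <= 1)) _; first by rewrite ler0z.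
  by rewrite -[1]/(1%:~R) ler_int.
rewrite mul1r.
apply: (@le_trans _ _ (\sum_(e <- subprods (primes t)) 2 * Num.sqrt s%:R * lg R s)).
  apply: le_trans (_ : (\sum_(e <- subprods (primes t)) `|\sum_(x0 <= n < x1 | (n %% 8 == b)%N) (e %| n)%:R * kronecker n s|)%:~R <= _).
    rewrite ler_int; apply: le_trans (ler_norm_sum _ _ _) _.
    by apply: ler_sum => e _; rewrite normrM liou_norm mul1r.
  by rewrite rmorph_sum /= big_seq [X in _ <= X]big_seq; apply: ler_sum => e; exact: inner.
rewrite big_const_seq count_predT size_subprods iter_addr_0 -mulr_natr.
(* The sieve has 2^omega(t) <= t terms, each bounded by the inequality modulo s. The loss is
   absorbed because s t^2 <= k. *)
have pt : (2 ^ size (primes t) <= t)%N.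
  apply: leq_trans (dvdn_leq t0 (prod_primes_dvd t0)).
  elim: (primes t) allp => [|p ps IH] /=; first by rewrite big_nil.
  by move=> /andP[/prime_gt1 p1 /IH h]; rewrite expnS big_cons leq_mul.
have s0 := ltnW s1.
have sk : (s <= k)%N.
  rewrite kE -mulnA mulnCA leq_pmulr // muln_gt0 expn_gt0 t0 /=.
  by move: uI; rewrite !inE => /orP[]/eqP->.
have lk : lg R s <= lg R k by exact: lg_le.
have stk : Num.sqrt (s%:R : R) * (2 ^ size (primes t))%:R <= Num.sqrt k%:R.
  apply: le_trans (_ : Num.sqrt s%:R * t%:R <= _).
    by rewrite ler_wpM2l ?sqrtr_ge0 // ler_nat.
  rewrite -[t%:R](ger0_norm (ler0n _ _)) -sqrtr_sqr -sqrtrM ?ler0n // ler_sqrt ?ler0n //.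
  rewrite -natrX -natrM ler_nat kE -mulnA leq_pmull //.
  by move: uI; rewrite !inE => /orP[]/eqP->.
have l0 := lg_ge0 R s; have k0 := sqrtr_ge0 (k%:R : R).
have : Num.sqrt s%:R * (2 ^ size (primes t))%:R * lg R s <= Num.sqrt k%:R * lg R k.
  by apply: ler_pM => //; rewrite mulr_ge0 ?sqrtr_ge0.
by move=> h; move: (ler_wpM2l (ler0n R 2) h); congr (_ <= _); ring.
Qed.

End PolyaVinogradov.

(** * Second moments of short sums *)

Section Diagonal.
Variable R : realType.

(** A number with kernel s is u s t^2 with t its [sqpart] and u = 1 or 2; each of the two values of
    u contributes a harmonic sum over t. *)
Lemma sum_okern_le Z s :
  \sum_(1 <= h < Z.+1 | okern h == s) ((sqpart h)%:R : R)^-1 <= 2 * lg R Z.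
Proof.
apply: (@le_trans _ _ (\sum_(1 <= h < Z.+1) \sum_(u <- [:: 1; 2]%N) \sum_(1 <= t < Z.+1)
    (h == u * s * t ^ 2)%N%:R * (t%:R : R)^-1)).
  rewrite big_mkcond big_nat_cond [X in _ <= X]big_nat_cond; apply: ler_sum => h /andP[/andP[h1 hZ] _].
  have F0 (u : nat) : 0 <= \sum_(1 <= t < Z.+1) (h == u * s * t ^ 2)%N%:R * (t%:R : R)^-1.
    by apply: sumr_ge0 => t _; rewrite mulr_ge0 ?ler0n ?invr_ge0.
  case: eqP => [hs|_]; last by rewrite big_cons big_seq1 addr_ge0.
  have [_ _ [u uI hE]] := okernP h1; rewrite hs in hE.
  have t0 := sqpart_gt0 h1; have tZ : (sqpart h < Z.+1)%N.
    apply: leq_ltn_trans hZ; apply: leq_trans (dvdn_leq h1 (sqpart_dvd h1)).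
    by rewrite expnS expn1 leq_pmulr.
  apply: (@le_trans _ _ (\sum_(1 <= t < Z.+1) (h == u * s * t ^ 2)%N%:R * (t%:R : R)^-1)).
    rewrite (bigD1_seq (sqpart h)) ?mem_index_iota ?iota_uniq ?t0 //= -hE eqxx mul1r lerDl.
    by apply: sumr_ge0 => t _; rewrite mulr_ge0 ?ler0n ?invr_ge0.
  rewrite big_cons big_seq1; move: uI; rewrite !inE => /orP[]/eqP->.
    by rewrite lerDl.
  by rewrite lerDr.
rewrite exchange_big /= big_cons big_seq1 (_ : 2 * lg R Z = lg R Z + lg R Z); last by ring.
have step u : \sum_(1 <= h < Z.+1) \sum_(1 <= t < Z.+1) (h == u * s * t ^ 2)%N%:R * (t%:R : R)^-1 <= lg R Z.
  apply: le_trans (harmonic_le R Z); rewrite exchange_big /=; apply: ler_sum => t _.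
  rewrite -mulr_suml ler_piMl ?invr_ge0 //.
  set m := (u * s * t ^ 2)%N; rewrite -natr_sum -[1]/(1%:R) ler_nat.
  have [mi|mi] := boolP (m \in index_iota 1 Z.+1).
    rewrite (bigD1_seq m) ?iota_uniq //= eqxx big1 ?addn0 // => h /negbTE -> //.
  by rewrite big_seq big1 // => h hi; case: eqP => // e; move: mi; rewrite -e hi.
exact: lerD.
Qed.

Lemma sqrt_inv_le h : (0 < h)%N ->
  (Num.sqrt (h%:R : R))^-1 <= (Num.sqrt ((okern h)%:R : R))^-1 * ((sqpart h)%:R)^-1.
Proof.
move=> h0; have [oh sh [u uI hE]] := okernP h0; have t0 := sqpart_gt0 h0.
rewrite -invfM lef_pV2 ?posrE; last first.
- by rewrite mulr_gt0 ?sqrtr_gt0 ?ltr0n // squarefree_gt0.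
- by rewrite sqrtr_gt0 ltr0n.
rewrite -[(sqpart h)%:R](ger0_norm (ler0n _ _)) -sqrtr_sqr -sqrtrM ?ler0n // ler_sqrt ?ler0n //.
rewrite -natrX -natrM ler_nat {3}hE -mulnA leq_pmull //.
by move: uI; rewrite !inE => /orP[]/eqP->.
Qed.

(** Pairs are grouped by their common kernel s: since h >= s times the square of [sqpart h], the sum
    is at most that of 1 / s times the square of the sum in [sum_okern_le], that is lg * (2
    lg)^2. *)
Lemma diagonal_sum_le Z :
  \sum_(1 <= h < Z.+1) \sum_(1 <= k < Z.+1 | okern h == okern k) (Num.sqrt ((h * k)%:R : R))^-1
    <= 4 * lg R Z ^+ 3.
Proof.
pose f h : R := ((sqpart h)%:R)^-1.
have f0 h : 0 <= f h by rewrite invr_ge0.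
apply: (@le_trans _ _ (\sum_(1 <= h < Z.+1) \sum_(1 <= k < Z.+1 | okern h == okern k)
    \sum_(1 <= s < Z.+1 | okern h == s) s%:R^-1 * (f h * f k))).
  rewrite big_nat_cond [X in _ <= X]big_nat_cond; apply: ler_sum => h /andP[/andP[h1 hZ] _].
  rewrite big_nat_cond [X in _ <= X]big_nat_cond; apply: ler_sum => k /andP[/andP[k1 kZ] /eqP hk].
  have [oh sh [u uI hE]] := okernP h1.
  have s0 : (0 < okern h)%N by exact: squarefree_gt0.
  have sZ : (okern h < Z.+1)%N.
    apply: leq_ltn_trans hZ; rewrite {2}hE -mulnA mulnCA leq_pmulr // muln_gt0 expn_gt0 sqpart_gt0 //=.
    by rewrite andbT; move: uI; rewrite !inE => /orP[]/eqP->.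
  rewrite [X in _ <= X]big_mkcond (bigD1_seq (okern h)) ?mem_index_iota ?iota_uniq ?s0 //= eqxx.
  rewrite -[X in X <= _]addr0; apply: lerD; last first.
    by apply: sumr_ge0 => s _; case: ifP => // _; rewrite !mulr_ge0 ?invr_ge0.
  rewrite natrM sqrtrM ?ler0n // invfM.
  apply: le_trans (ler_pM _ _ (sqrt_inv_le h1) (sqrt_inv_le k1)) _; rewrite ?invr_ge0 ?sqrtr_ge0 //.
  rewrite -hk mulrACA -invfM -expr2 sqr_sqrtr ?ler0n //.
have -> : \sum_(1 <= h < Z.+1) \sum_(1 <= k < Z.+1 | okern h == okern k)
    \sum_(1 <= s < Z.+1 | okern h == s) s%:R^-1 * (f h * f k) =
  \sum_(1 <= s < Z.+1) s%:R^-1 * (\sum_(1 <= h < Z.+1 | okern h == s) f h) ^+ 2.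
  transitivity (\sum_(1 <= h < Z.+1) \sum_(1 <= s < Z.+1) \sum_(1 <= k < Z.+1)
     (okern h == s)%:R * (okern k == s)%:R * (s%:R^-1 * (f h * f k))).
    apply: eq_bigr => h _; rewrite exchange_big /= big_mkcond; apply: eq_bigr => s _ /=.
    case: eqP => [<-|_]; last by rewrite big1 // => k _; rewrite !mul0r.
    rewrite big_mkcond; apply: eq_bigr => k _; rewrite eq_sym.
    by case: eqP => _; rewrite ?mul1r ?mul0r.
  rewrite exchange_big /=; apply: eq_bigr => s _.
  rewrite expr2 big_distrlr /= mulr_sumr [RHS]big_mkcond; apply: eq_bigr => h _.
  case: eqP => [_|_]; last by rewrite big1 // => k _; rewrite !mul0r.
  rewrite mulr_sumr [RHS]big_mkcond; apply: eq_bigr => k _.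
  by case: eqP => _; rewrite ?mul1r ?mulr0 ?mul0r.
apply: (@le_trans _ _ (\sum_(1 <= s < Z.+1) s%:R^-1 * (2 * lg R Z) ^+ 2)).
  apply: ler_sum => s _; rewrite ler_wpM2l ?invr_ge0 // lerXn2r ?nnegrE ?sum_okern_le //.
    by apply: sumr_ge0 => h _; exact: f0.
  by rewrite mulr_ge0 // lg_ge0.
rewrite -mulr_suml; apply: le_trans (ler_wpM2r (sqr_ge0 _) (harmonic_le R Z)) _.
by apply: le_of_eq; ring.
Qed.

Lemma off_diagonal_le h k b x0 x1 : (0 < h)%N -> (0 < k)%N -> okern h != okern k ->
  odd b -> (b < 8)%N ->
  `|\sum_(x0 <= n < x1 | (n %% 8 == b)%N) kronecker (h * k) n|%:~R
     <= 2 * Num.sqrt (h * k)%:R * lg R (h * k).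
Proof.
move=> h0 k0 hk ob b8; have [u [s [t [uI os ss [s1 E]]]]] := okernM_neq h0 k0 hk.
have t0 : (0 < t)%N.
  by case: (posnP t) => // t0; have := muln_gt0 h k; rewrite E t0 muln0 h0 k0.
exact: (@reciprocal_character_sum R _ b x0 x1 u s t).
Qed.

End Diagonal.

Section DirectBound.
Variable R : realType.

Lemma sum_sub_le (I : eqType) (s t : seq I) (F : I -> R) : uniq s -> {subset s <= t} ->
  (forall i, 0 <= F i) -> \sum_(i <- s) F i <= \sum_(i <- t) F i.
Proof.
move=> us st F0; elim: s us t st => [|x s IH] /=; first by move=> _ t _; rewrite big_nil sumr_ge0.
move=> /andP[xs us] t st; rewrite big_cons [X in _ <= X](big_rem x) ?st ?mem_head //= lerD2l.
apply: IH => // y ys; have yt : y \in t by apply: st; rewrite inE ys orbT.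
move: yt; rewrite (perm_mem (perm_to_rem (st x (mem_head _ _)))) inE.
by case/orP => // /eqP yx; rewrite -yx ys in xs.
Qed.

Lemma sum_const_seq (I : Type) (s : seq I) (c : R) : \sum_(i <- s) c = c * (size s)%:R.
Proof. by rewrite big_const_seq count_predT iter_addr_0 mulr_natr. Qed.

Lemma odd_mod8 n b : odd b -> (n %% 8 == b)%N -> odd n.
Proof. by move=> ob /eqP nb; move: ob; rewrite -nb {2}(divn_eq n 8) oddD oddM andbF. Qed.

Lemma kronecker_prod_norm_le1 a c n : (0 < n)%N -> `|kronecker a n * kronecker c n| <= 1.
Proof. by move=> n0; rewrite normrM mulr_ile1 ?normr_ge0 ?kronecker_norm_le1. Qed.

Lemma count_class_le N b : odd b -> (\sum_(0 <= q < N.+1 | (q %% 8 == b)%N) 1 <= N)%N.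
Proof.
move=> ob; rewrite big_ltn_cond //= ifN.
  rewrite big_mkcond; apply: (@leq_trans (\sum_(1 <= i < N.+1) 1)).
    by apply: leq_sum => i _; case: ifP.
  by rewrite sum_nat_const_nat subn1 muln1.
by rewrite mod0n; case: (b) ob.
Qed.

Lemma pair_sum_le N b h k : odd b ->
  `|\sum_(0 <= q < N.+1 | (q %% 8 == b)%N) kronecker h q * kronecker k q| <= N%:R.
Proof.
move=> ob; apply: le_trans (ler_norm_sum _ _ _) _.
apply: (@le_trans _ _ (\sum_(0 <= q < N.+1 | (q %% 8 == b)%N) 1%:R)).
  apply: ler_sum => q qb; apply: kronecker_prod_norm_le1; apply: odd_gt0; exact: odd_mod8 qb.
by rewrite -natr_sum ler_nat count_class_le.
Qed.

(** Meant for about sqrt N terms: every off-diagonal pair costs Z lg Z by Polya-Vinogradov, so that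
    all of them together match the diagonal, of order Z N. *)
Lemma direct_second_moment N b Z (ms : seq nat) : odd b -> (b < 8)%N -> uniq ms ->
  {subset ms <= index_iota 1 Z.+1} ->
  (\sum_(0 <= q < N.+1 | (q %% 8 == b)%N) (\sum_(m <- ms) kronecker m q) ^+ 2)%:~R
    <= 4 * Z%:R * lg R Z ^+ 3 * (N%:R + (size ms)%:R ^+ 2 :> R).
Proof.
move=> ob b8 ums msZ.
have -> : \sum_(0 <= q < N.+1 | (q %% 8 == b)%N) (\sum_(m <- ms) kronecker m q) ^+ 2 =
  \sum_(h <- ms) \sum_(k <- ms) \sum_(0 <= q < N.+1 | (q %% 8 == b)%N) kronecker h q * kronecker k q.
  under eq_bigr do rewrite expr2 big_distrlr /=.
  by rewrite exchange_big; apply: eq_bigr => h _; rewrite exchange_big.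
(* As h and k are at most Z, the factor Z / sqrt (h k) is at least 1; it is inserted so that the
   diagonal pairs can be counted by [diagonal_sum_le]. *)
pose w h k : R := (okern h == okern k)%:R * (Z%:R * (Num.sqrt (h * k)%:R)^-1).
have w0 h k : 0 <= w h k by rewrite !mulr_ge0 // invr_ge0 sqrtr_ge0.
have l1 := lg_ge1 R Z; have l0 := lg_ge0 R Z.
apply: (@le_trans _ _ (\sum_(h <- ms) \sum_(k <- ms) (N%:R * w h k + 4 * Z%:R * lg R Z))).
  rewrite rmorph_sum /= big_seq [X in _ <= X]big_seq; apply: ler_sum => h /msZ.
  rewrite mem_index_iota => /andP[h0 hZ].
  rewrite rmorph_sum /= big_seq [X in _ <= X]big_seq; apply: ler_sum => k /msZ.
  rewrite mem_index_iota => /andP[k0 kZ].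
  apply: le_trans (ler_norm _) _; rewrite -intr_norm.
  have hkZ : Num.sqrt ((h * k)%:R : R) <= Z%:R.
    rewrite -[Z%:R](ger0_norm (ler0n _ _)) -sqrtr_sqr ler_sqrt ?sqr_ge0 //.
    by rewrite -natrX ler_nat -mulnn leq_mul.
  have [hk|hk] := eqVneq (okern h) (okern k).
    apply: (@le_trans _ _ N%:R); first by rewrite -[N%:R]mulrz_nat ler_int pair_sum_le.
    rewrite /w hk eqxx mul1r -[X in X <= _]addr0 lerD ?mulr_ge0 // ler_peMr //.
    by rewrite -(ler_pdivrMr _ _ (_ : 0 < _)) ?invr_gt0 ?sqrtr_gt0 ?ltr0n ?muln_gt0 ?h0 // invrK mul1r.
  rewrite -[X in X <= _]add0r lerD ?mulr_ge0 //.
  under eq_bigr => q qb do rewrite -kroneckerMl ?(odd_mod8 ob qb) //.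
  apply: le_trans (off_diagonal_le _ _ _ h0 k0 hk ob b8) _.
  apply: (@le_trans _ _ (2 * Z%:R * (2 * lg R Z))).
    apply: ler_pM; rewrite ?mulr_ge0 ?sqrtr_ge0 ?lg_ge0 //; first by rewrite ler_wpM2l.
    by apply: le_trans (lgX2 _ _); apply: lg_le; rewrite -mulnn leq_mul.
  by apply: le_of_eq; ring.
under eq_bigr do rewrite big_split /= -mulr_sumr.
rewrite big_split /= -mulr_sumr.
have W : \sum_(h <- ms) \sum_(k <- ms) w h k <= Z%:R * (4 * lg R Z ^+ 3).
  apply: (@le_trans _ _ (\sum_(1 <= h < Z.+1) \sum_(1 <= k < Z.+1) w h k)).
    apply: (@le_trans _ _ (\sum_(h <- ms) \sum_(1 <= k < Z.+1) w h k)).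
      by apply: ler_sum => h _; apply: sum_sub_le.
    by apply: sum_sub_le => // h; apply: sumr_ge0.
  apply: le_trans (_ : _ <= _) (ler_wpM2l (ler0n _ _) (diagonal_sum_le R Z)).
  apply: le_of_eq; rewrite mulr_sumr; apply: eq_bigr => h _.
  rewrite mulr_sumr [RHS]big_mkcond; apply: eq_bigr => k _; rewrite /w.
  by case: eqP => _; rewrite ?mul1r ?mul0r.
have C : \sum_(h <- ms) \sum_(k <- ms) (4 * Z%:R * lg R Z) = 4 * Z%:R * lg R Z * (size ms)%:R ^+ 2.
  by rewrite !sum_const_seq; ring.
rewrite C [X in _ <= X]mulrDr; apply: lerD.
  by apply: le_trans (ler_wpM2l (ler0n _ _) W) _; apply: le_of_eq; ring.
rewrite ler_wpM2r ?sqr_ge0 // ler_wpM2l ?mulr_ge0 //.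
by rewrite exprS ler_peMr // exprn_ege1.
Qed.

End DirectBound.

(** * The dual sum *)

Section DualCoefficients.
Variable R : realType.

(** A pair of values of size at most A whose relative change is at most e. Under products A
    multiplies and e adds, so a coefficient can be treated factor by factor. *)
Definition relvar (A e : R) (u v : R[i]) := [/\ nm u <= A, nm v <= A & nm (v - u) <= A * e].

Lemma relvar_mul A e B d u v u' v' : relvar A e u v -> relvar B d u' v' ->
  relvar (A * B) (e + d) (u * u') (v * v').
Proof.
move=> [uA vA uv] [uB vB uv']; split; rewrite ?nmM; try by apply: ler_pM; rewrite ?nm_ge0.
have -> : v * v' - u * u' = (v - u) * v' + u * (v' - u') by ring.
apply: le_trans (nmD _ _) _; rewrite !nmM mulrDr; apply: lerD.
  by rewrite mulrAC; apply: ler_pM; rewrite ?nm_ge0.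
by rewrite -mulrA; apply: ler_pM; rewrite ?nm_ge0.
Qed.

Lemma relvar_conj A e u v : relvar A e u v -> relvar A e u^*%C v^*%C.
Proof. by move=> [uA vA uv]; split; rewrite ?nmJ // -rmorphB nmJ. Qed.

Lemma relvar_le A e B d u v : A <= B -> e <= d -> 0 <= e -> 0 <= A -> relvar A e u v -> relvar B d u v.
Proof.
move=> AB ed e0 A0 [uA vA uv]; split; [exact: le_trans AB|exact: le_trans AB|].
by apply: le_trans uv _; apply: ler_pM.
Qed.

Variables (N J L r : nat).
Hypotheses (L0 : (0 < L)%N) (LJ : (L <= J)%N) (NL : (N <= L ^ 2)%N) (r8 : (r <= 8)%N).

Definition freq g n : R := g%:R / n%:R.

(* The g-th Fourier coefficient of the d-sum of length J, averaged over two shifts of length L and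
   divided by the modulus of the Gauss sum. Averaging twice gives the decay (L / g) ^ 2; a single
   average would give L / g, which is not summable against the variation in n. *)
Definition dual_coef g n : R[i] :=
  expi (freq g n * (r%:R / 8)) * dirichlet J (freq g n) *
  ((L%:R^-1)%:C%C * dirichlet L (freq g n)) ^+ 2 * ((Num.sqrt n%:R)^-1)%:C%C.

(** It bounds the averaged kernel min(L, n / g) / L uniformly in n, using n <= N <= L^2. *)
Definition damp g : R := Num.min 1 (L%:R / g%:R).

Lemma damp_ge0 g : 0 <= damp g.
Proof. by rewrite le_min ler01 divr_ge0. Qed.

Lemma freq_range g n : (0 < g)%N -> (2 * g < n)%N -> 0 < freq g n <= 1 / 2.
Proof.
move=> g0 gn; have n0 : (0 : R) < n%:R by rewrite ltr0n; lia.
rewrite /freq divr_gt0 // ?ltr0n //= ler_pdivrMr // mulrAC ler_pdivlMr // mul1r -natrM ler_nat.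
by lia.
Qed.

Lemma inv_freq g n : (freq g n)^-1 = n%:R / g%:R. Proof. exact: invf_div. Qed.

Lemma nm_invL : nm ((L%:R^-1 : R)%:C%C) = L%:R^-1.
Proof. by rewrite nm_real ger0_norm // invr_ge0. Qed.

Lemma dirichletL_sup g n : (0 < g)%N -> (2 * g < n)%N -> (n <= N)%N ->
  nm ((L%:R^-1)%:C%C * dirichlet L (freq g n)) <= damp g.
Proof.
move=> g0 gn nN; have LR : (0 : R) < L%:R by rewrite ltr0n.
rewrite nmM nm_invL mulrC ler_pdivrMr //.
rewrite /damp mulrC minr_pMr ?(ltW LR) // le_min mulr1 dirichlet_le /=.
apply: le_trans (dirichlet_le_inv _ (freq_range g0 gn)) _; rewrite inv_freq mulrA.
by rewrite ler_wpM2r ?invr_ge0 // -natrM ler_nat mulnn (leq_trans nN).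
Qed.

Lemma freq_diff g n : (0 < n)%N -> `|freq g n.+1 - freq g n| <= g%:R / n%:R ^+ 2.
Proof.
move=> n0; have nR : (0 : R) < n%:R by rewrite ltr0n.
have nR1 : (0 : R) < n.+1%:R by rewrite ltr0n.
have -> : freq g n.+1 - freq g n = - (g%:R / (n.+1%:R * n%:R)).
  by rewrite /freq -natr1; field; rewrite natr1 !gt_eqF.
rewrite normrN ger0_norm; last by rewrite divr_ge0 // mulr_ge0 // ltW.
rewrite ler_wpM2l // lef_pV2 ?posrE ?exprn_gt0 ?mulr_gt0 // expr2 ler_wpM2r ?(ltW nR) //.
by rewrite ler_nat.
Qed.

Lemma nm_invsqrt n : nm (((Num.sqrt (n%:R : R))^-1)%:C%C) = (Num.sqrt n%:R)^-1.
Proof. by rewrite nm_real ger0_norm // invr_ge0 sqrtr_ge0. Qed.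

Lemma nm_dual_coef g n : nm (dual_coef g n) =
  nm (dirichlet J (freq g n)) * nm ((L%:R^-1)%:C%C * dirichlet L (freq g n)) ^+ 2 / Num.sqrt n%:R.
Proof. by rewrite /dual_coef nmM nmM nmX nmM nm_expi mul1r nm_invsqrt. Qed.

Lemma dual_coef_sup g n : (0 < g)%N -> (2 * g < n)%N -> (n <= N)%N ->
  nm (dual_coef g n) <= Num.sqrt n%:R * (damp g ^+ 2 / g%:R).
Proof.
move=> g0 gn nN; have nR : (0 : R) < Num.sqrt n%:R by rewrite sqrtr_gt0 ltr0n; lia.
rewrite nm_dual_coef ler_pdivrMr //.
have -> : Num.sqrt n%:R * (damp g ^+ 2 / g%:R) * Num.sqrt n%:R = n%:R / g%:R * damp g ^+ 2.
  by rewrite mulrAC -expr2 sqr_sqrtr // mulrA mulrAC mulrA.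
apply: ler_pM; rewrite ?exprn_ge0 ?nm_ge0 //.
  by rewrite -inv_freq; apply: dirichlet_le_inv; exact: freq_range.
by rewrite lerXn2r ?nnegrE ?nm_ge0 ?damp_ge0 ?dirichletL_sup.
Qed.

Lemma dual_coef_sup_diag g n : (0 < g)%N -> (2 * g < n)%N -> (n <= N)%N ->
  nm (dual_coef g n) <= Num.sqrt (J%:R / g%:R).
Proof.
move=> g0 gn nN; have n0 : (0 < n)%N by lia.
have nR : (0 : R) < Num.sqrt n%:R by rewrite sqrtr_gt0 ltr0n.
rewrite nm_dual_coef ler_pdivrMr // -sqrtrM ?divr_ge0 //.
have D : nm (dirichlet J (freq g n)) <= Num.sqrt (J%:R / g%:R * n%:R).
  rewrite -[nm _]ger0_norm ?nm_ge0 // -sqrtr_sqr ler_sqrt ?mulr_ge0 ?invr_ge0 //.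
  rewrite expr2 mulrAC -mulrA; apply: ler_pM; rewrite ?nm_ge0 ?dirichlet_le //.
  by rewrite -inv_freq; apply: dirichlet_le_inv; exact: freq_range.
rewrite -[X in _ <= X]mulr1; apply: ler_pM; rewrite ?exprn_ge0 ?nm_ge0 // expr_le1 ?nm_ge0 //.
by apply: le_trans (dirichletL_sup g0 gn nN) _; rewrite ge_min lexx.
Qed.

Lemma dual_coef_relvar g n : (0 < g)%N -> (2 * g < n)%N -> (n < N)%N ->
  relvar (2 * Num.sqrt n%:R * (damp g ^+ 2 / g%:R)) (64 * J%:R * (g%:R / n%:R ^+ 2) + n%:R^-1)
    (dual_coef g n) (dual_coef g n.+1).
Proof.
move=> g0 gn nN; have n0 : (0 < n)%N by lia.
have gn1 : (2 * g < n.+1)%N by lia.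
have n2 : (n.+1 <= 2 * n)%N by lia.
have nR : (0 : R) < n%:R by rewrite ltr0n.
have gR : (0 : R) < g%:R by rewrite ltr0n.
have LR : (0 : R) < L%:R by rewrite ltr0n.
have LJR : L%:R <= J%:R :> R by rewrite ler_nat.
have J1 : 1 <= J%:R :> R by rewrite ler1n; lia.
set d := g%:R / n%:R ^+ 2; have d0 : 0 <= d by rewrite divr_ge0 // sqr_ge0.
have fd := freq_diff g n0; rewrite -/d in fd.
have f1 := freq_range g0 gn; have f2 := freq_range g0 gn1.
have nn1 : n%:R / g%:R <= n.+1%:R / g%:R :> R by rewrite ler_wpM2r ?invr_ge0 ?ler_nat // ltW.
have R1 : relvar 1 (16 * d) (expi (freq g n * (r%:R / 8))) (expi (freq g n.+1 * (r%:R / 8))).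
  split; rewrite ?nm_expi ?mul1r //; apply: le_trans (expi_lip _ _) _.
  rewrite ler_wpM2l // -mulrBl normrM -[d]mulr1; apply: ler_pM; rewrite ?normr_ge0 //.
  by rewrite ger0_norm ?divr_ge0 // ler_pdivrMr // mul1r ler_nat.
have R2 : relvar (n.+1%:R / g%:R) (16 * J%:R * d) (dirichlet J (freq g n)) (dirichlet J (freq g n.+1)).
  split.
  - by apply: le_trans (dirichlet_le_inv _ f1) _; rewrite inv_freq.
  - by apply: le_trans (dirichlet_le_inv _ f2) _; rewrite inv_freq.
  rewrite nmB distrC in fd *; apply: le_trans (dirichlet_lip_inv _ _ f2) _.
  rewrite inv_freq mulrC ler_wpM2l ?divr_ge0 //.
  by rewrite ler_wpM2l // mulr_ge0.
have R3 : relvar (damp g) (16 * L%:R * d) ((L%:R^-1)%:C%C * dirichlet L (freq g n))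
    ((L%:R^-1)%:C%C * dirichlet L (freq g n.+1)).
  split; [by apply: dirichletL_sup => //; lia|by apply: dirichletL_sup|].
  rewrite -mulrBr nmM nm_invL ler_pdivrMl //.
  have X1 : nm (dirichlet L (freq g n.+1) - dirichlet L (freq g n)) <= 16 * L%:R ^+ 2 * d.
    apply: le_trans (dirichlet_lip _ _ _) _; rewrite ler_wpM2l // mulr_ge0 // sqr_ge0.
  have X2 : nm (dirichlet L (freq g n.+1) - dirichlet L (freq g n)) <= 16 * L%:R * d * (n.+1%:R / g%:R).
    rewrite nmB; apply: le_trans (dirichlet_lip_inv _ _ f2) _; rewrite inv_freq distrC.
    by rewrite ler_wpM2r ?divr_ge0 // ler_wpM2l // mulr_ge0.
  rewrite /damp; case: (leP 1 (L%:R / g%:R)) => _.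
    by rewrite mul1r; apply: le_trans X1 _; apply: le_of_eq; ring.
  have K : n.+1%:R / g%:R <= L%:R * (L%:R / g%:R) :> R.
    by rewrite mulrA ler_wpM2r ?invr_ge0 ?(ltW gR) // -natrM ler_nat mulnn (leq_trans nN).
  apply: le_trans X2 _; have -> : L%:R * (L%:R / g%:R * (16 * L%:R * d)) = 16 * L%:R * d * (L%:R * (L%:R / g%:R)).
    by ring.
  by rewrite ler_wpM2l // !mulr_ge0.
have R4 : relvar (Num.sqrt n%:R)^-1 (n%:R^-1) ((Num.sqrt (n%:R : R))^-1)%:C%C ((Num.sqrt (n.+1%:R : R))^-1)%:C%C.
  have s0 : 0 < Num.sqrt (n%:R : R) by rewrite sqrtr_gt0.
  have s1 : Num.sqrt (n%:R : R) <= Num.sqrt n.+1%:R by rewrite ler_sqrt ?ler_nat.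
  have s10 := lt_le_trans s0 s1.
  have i1 : (Num.sqrt (n.+1%:R : R))^-1 <= (Num.sqrt n%:R)^-1 by rewrite lef_pV2 ?posrE.
  split; rewrite ?nm_invsqrt //.
  rewrite -rmorphB nm_real distrC ger0_norm ?subr_ge0 //.
  have e1 := sqr_sqrtr (ler0n R n); have e2 := sqr_sqrtr (ler0n R n.+1).
  move: s0 s1 s10 e1 e2; set x := Num.sqrt _; set y := Num.sqrt _ => x0 xy y0 e1 e2.
  rewrite -e1 -[X in X <= _]opprB opprB.
  have e3 : y ^+ 2 = x ^+ 2 + 1 by rewrite e1 e2 natr1.
  rewrite -(ler_pM2r (_ : 0 < x ^+ 3 * y)) ?mulr_gt0 ?exprn_gt0 //.
  have -> : (x^-1 - y^-1) * (x ^+ 3 * y) = x ^+ 2 * (y - x) by field; rewrite !gt_eqF.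
  have -> : x^-1 * (x ^+ 2)^-1 * (x ^+ 3 * y) = y by field; rewrite !gt_eqF.
  nra.
have := relvar_mul (relvar_mul (relvar_mul R1 R2) (relvar_mul R3 R3)) R4.
rewrite -!expr2 mul1r; apply: relvar_le.
- have -> : n.+1%:R / g%:R * damp g ^+ 2 / Num.sqrt n%:R = n.+1%:R / Num.sqrt n%:R * (damp g ^+ 2 / g%:R) :> R.
    by ring.
  rewrite ler_wpM2r ?divr_ge0 ?sqr_ge0 ?(ltW gR) // ler_pdivrMr ?sqrtr_gt0 // -mulrA -expr2 sqr_sqrtr ?(ltW nR) //.
  by move: n2; rewrite -(ler_nat R) natrM.
(* The relative changes add up: 16 for the phase, 16 J for the long kernel, 16 L for each of the two
   short ones. With 1 <= J and L <= J the total is at most 64 J. *)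
- have := ler_wpM2r d0 LJR; have := ler_wpM2r d0 J1; lra.
- have : 0 <= J%:R * d by rewrite mulr_ge0.
  have : 0 <= L%:R * d by rewrite mulr_ge0.
  have : 0 <= (n%:R : R)^-1 by rewrite invr_ge0.
  lra.
by rewrite !mulr_ge0 ?invr_ge0 ?sqrtr_ge0 ?damp_ge0.
Qed.

End DualCoefficients.

Section AveragedSecondMoment.
Variable R : realType.

Lemma abel_summation (a f : nat -> R[i]) x0 x1 (P : R) : (x0 <= x1)%N ->
  (forall x, (x <= x1.+1)%N -> nm (\sum_(x0 <= n < x) a n) <= P) ->
  nm (\sum_(x0 <= n < x1.+1) a n * f n) <=
    P * (nm (f x1) + \sum_(x0 <= n < x1) nm (f n.+1 - f n)).
Proof.
move=> x01 aP; pose A x := \sum_(x0 <= n < x) a n.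
have E x : (x0 <= x)%N -> \sum_(x0 <= n < x.+1) a n * f n =
    A x.+1 * f x - \sum_(x0 <= n < x) A n.+1 * (f n.+1 - f n).
  elim: x => [|x IH].
    by rewrite leqn0 => /eqP x00; rewrite /A x00 [X in _ - X]big_geq // subr0 !big_nat1.
  rewrite leq_eqVlt => /orP[/eqP xE|xx].
    by rewrite /A xE [in X in _ - X]big_geq // subr0 !big_nat1.
  rewrite big_nat_recr //= ?IH //; last exact: leqW.
  rewrite [in RHS]big_nat_recr //= opprD addrA.
  by rewrite [A x.+2]/A big_nat_recr ?leqW //= -/(A x.+1); ring.
rewrite E // mulrDr; apply: le_trans (nmD _ _) _; rewrite nmN nmM; apply: lerD.
  by rewrite ler_wpM2r ?nm_ge0 // aP.
apply: le_trans (nm_sum _ _ _) _; rewrite mulr_sumr big_nat_cond [X in _ <= X]big_nat_cond.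
apply: ler_sum => n /andP[/andP[_ nx] _]; rewrite nmM ler_wpM2r ?nm_ge0 // aP //.
by lia.
Qed.

Lemma second_moment_expand (I : eqType) (Q : seq nat) (P : pred nat) (G : seq I) (x : nat -> I -> R[i]) :
  \sum_(q <- Q | P q) nm (\sum_(g <- G) x q g) ^+ 2 <=
  \sum_(g <- G) \sum_(h <- G) nm (\sum_(q <- Q | P q) x q g * (x q h)^*%C).
Proof.
rewrite -[X in X <= _]ger0_norm; last by apply: sumr_ge0 => q _; exact: sqr_ge0.
rewrite -nm_real rmorph_sum /=.
have -> : \sum_(q <- Q | P q) ((nm (\sum_(g <- G) x q g) ^+ 2)%:C)%C =
    \sum_(g <- G) \sum_(h <- G) \sum_(q <- Q | P q) x q g * (x q h)^*%C.
  under eq_bigr do rewrite nm_sqr rmorph_sum big_distrlr /=.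
  by rewrite exchange_big; apply: eq_bigr => g _; rewrite exchange_big.
apply: le_trans (nm_sum _ _ _) _; apply: ler_sum => g _; exact: nm_sum.
Qed.

Variables (N J L r b : nat).
Hypotheses (L0 : (0 < L)%N) (LJ : (L <= J)%N) (NL : (N <= L ^ 2)%N) (LN : (L ^ 2 <= 4 * N)%N).
Hypotheses (r8 : (r <= 8)%N) (ob : odd b) (b8 : (b < 8)%N).

(** A list with repetitions: L^2 translates of the interval of length J, so that its exponential sum
    factors as a kernel of length J times the square of one of length L. *)
Definition twice_shifted : seq nat :=
  [seq (j + t)%N | j <- iota 0 J, t <- [seq (t1 + t2)%N | t1 <- iota 0 L, t2 <- iota 0 L]].

(** The part of the dual phase that depends on q only through its class b modulo 8, hence is
    constant in the sum over q. *)
Definition class_phase g : R[i] := expi (- ((g * b * r)%:R / 8)).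

(** Extension by zero makes the range of g independent of q, so that the sums over g and q can be
    exchanged. *)
Definition dual_term q g : R[i] :=
  if (2 * g < q)%N then chi R q g * (class_phase g * dual_coef R J L r g q) else 0.

Lemma dirichlet_expiq K g q : \sum_(j <- iota 0 K) expiq R q (g * j) = dirichlet K (freq R g q).
Proof.
rewrite -{1}[K]subn0 -/(index_iota 0 K) big_mkord; apply: eq_bigr => j _.
by rewrite /expiq mulnC natrM -mulrA.
Qed.

Lemma dual_sum_twice_shifted g q : dual_sum R q twice_shifted g =
  dirichlet J (freq R g q) * dirichlet L (freq R g q) ^+ 2.
Proof.
rewrite /dual_sum big_allpairs_dep -dirichlet_expiq mulr_suml; apply: eq_bigr => j _.
rewrite big_allpairs_dep -dirichlet_expiq expr2 mulr_suml mulr_sumr; apply: eq_bigr => t _.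
by rewrite mulr_sumr mulr_sumr; apply: eq_bigr => t' _; rewrite !mulnDr !expiqD.
Qed.

(** As 8 [inv8] = q^2 - 1, the phase is - g r q / 8 + g r / (8 q). The first term depends, up to an
    integer, only on q modulo 8; the second varies slowly with q. *)
Lemma dual_phaseE q g : odd q -> (q %% 8 == b)%N ->
  dual_phase R q r g = class_phase g * expi (freq R g q * (r%:R / 8)).
Proof.
move=> oq /eqP qb; have q0 : (q%:R : R) != 0 by rewrite pnatr_eq0 -lt0n odd_gt0.
rewrite /dual_phase /expiq expiJ /class_phase -expiD.
have e : (inv8 q)%:R = (q%:R ^+ 2 - 1) / 8 :> R.
  apply: (mulfI (_ : (8 : R) != 0)); first by rewrite pnatr_eq0.
  have /(congr1 (fun n => n%:R : R)) := inv8E oq; rewrite natrD natrM natrX => <-.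
  by rewrite addrK [RHS]mulrC divfK // pnatr_eq0.
have qE : q%:R = 8 * (q %/ 8)%:R + b%:R :> R.
  by rewrite {1}(divn_eq q 8) qb natrD natrM mulrC.
have -> : - ((g * inv8 q * r)%:R / q%:R) =
    - ((g * b * r)%:R / 8) + freq R g q * (r%:R / 8) + - (g * r * (q %/ 8))%:R :> R.
  rewrite /freq !natrM e -[b%:R](addKr (8 * (q %/ 8)%:R)) -qE; field.
  by rewrite q0.
by rewrite [in LHS]expiD -expiJ expi_nat conjc1 mulr1.
Qed.

Lemma averaged_dual q : odd q -> squarefree q -> (1 < q <= N)%N -> (q %% 8 == b)%N ->
  nm (\sum_(j <- twice_shifted) chi R q (r + 8 * j)) <=
  2 * L%:R ^+ 2 * nm (\sum_(1 <= g < N.+1) dual_term q g).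
Proof.
move=> oq sq /andP[q1 qN] qb; have q0 := ltnW q1.
have s0 : 0 < Num.sqrt (q%:R : R) by rewrite sqrtr_gt0 ltr0n.
rewrite -(ler_pM2l s0); apply: le_trans (character_sum_dual R oq sq q1 _ _) _.
have -> : \sum_(1 <= g < q | (2 * g < q)%N) chi R q g * (dual_phase R q r g * dual_sum R q twice_shifted g) =
   (L%:R ^+ 2 * Num.sqrt q%:R)%:C%C * \sum_(1 <= g < N.+1) dual_term q g.
  rewrite (big_nat_widen _ _ N.+1) ?leqW // mulr_sumr big_mkcond; apply: eq_bigr => g _.
  rewrite /dual_term; have -> : ((2 * g < q) && (g < q))%N = (2 * g < q)%N by lia.
  case: ifP => gq; last by rewrite mulr0.
  rewrite dual_phaseE // dual_sum_twice_shifted /dual_coef exprMn.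
  have e1 : ((L%:R ^+ 2 * Num.sqrt q%:R : R)%:C%C) * ((L%:R^-1)%:C%C ^+ 2 * ((Num.sqrt q%:R)^-1)%:C%C) = 1.
    rewrite -(rmorphXn (real_complex R)) -!(rmorphM (real_complex R)) /= -(rmorph1 (real_complex R)); congr (_%:C)%C.
    by field; rewrite gt_eqF //= pnatr_eq0 -lt0n.
  by rewrite -[LHS]mul1r -e1; ring.
rewrite nmM nm_real ger0_norm ?mulr_ge0 ?sqrtr_ge0 ?sqr_ge0 //.
by apply: le_of_eq; ring.
Qed.

Lemma dual_diagonal g h : (0 < g)%N -> (0 < h)%N ->
  nm (\sum_(0 <= q < N.+1 | (q %% 8 == b)%N) dual_term q g * (dual_term q h)^*%C) <=
    N%:R * (J%:R * (Num.sqrt (g * h)%:R)^-1).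
Proof.
move=> g0 h0; apply: le_trans (nm_sum _ _ _) _.
set B := J%:R * _; have B0 : 0 <= B by rewrite mulr_ge0 // invr_ge0 sqrtr_ge0.
have T q k : (q %% 8 == b)%N -> (q <= N)%N -> (0 < k)%N -> nm (dual_term q k) <= Num.sqrt (J%:R / k%:R).
  move=> qb qN k0; rewrite /dual_term; case: ifP => kq; last by rewrite nm0 sqrtr_ge0.
  rewrite nmM nmM nm_expi mul1r; apply: le_trans (ler_piMl (nm_ge0 _) (nm_chi_le1 _ _ _)) _.
    by apply: odd_gt0; exact: odd_mod8 qb.
  by apply: (dual_coef_sup_diag R (N := N)).
apply: (@le_trans _ _ (\sum_(0 <= q < N.+1 | (q %% 8 == b)%N) B)).
  rewrite big_nat_cond [X in _ <= X]big_nat_cond; apply: ler_sum => q /andP[/andP[_ qN] qb].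
  rewrite nmM nmJ; have -> : B = Num.sqrt (J%:R / g%:R) * Num.sqrt (J%:R / h%:R).
    rewrite -sqrtrM ?divr_ge0 // /B mulrACA -expr2 -invfM -natrM sqrtrM ?sqr_ge0 //.
    by rewrite sqrtr_sqr ger0_norm // sqrtrV // ler0n.
  by apply: ler_pM; rewrite ?nm_ge0 // T.
rewrite (eq_bigr (fun=> 1%:R * B)) => [|q _]; last by rewrite mul1r.
by rewrite -mulr_suml -natr_sum ler_wpM2r // ler_nat count_class_le.
Qed.

Definition weight g : R := damp R L g ^+ 2 / g%:R.

Lemma weight_ge0 g : 0 <= weight g.
Proof. by rewrite divr_ge0 // sqr_ge0. Qed.

(* The coefficients depend on the modulus q, so Abel summation is needed before Polya-Vinogradov. *)
Lemma dual_off_diagonal g h : (0 < g <= N)%N -> (0 < h <= N)%N -> okern g != okern h ->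
  nm (\sum_(0 <= q < N.+1 | (q %% 8 == b)%N) dual_term q g * (dual_term q h)^*%C) <=
    1024 * lg R N ^+ 2 * (Num.sqrt (g * h)%:R * (weight g * weight h) * (N%:R + J%:R * (g%:R + h%:R))).
Proof.
move=> /andP[g0 gN] /andP[h0 hN] gh.
(* The conditions 2 g < n and 2 h < n become one lower limit of summation, so the partial sums are
   still character sums over intervals. *)
have Mb n : ((2 * maxn g h).+1 <= n)%N = ((2 * g < n) && (2 * h < n))%N by lia.
have Ms : {subset index_iota (2 * maxn g h).+1 N <= index_iota 1 N.+1}.
  by move=> n; rewrite !mem_index_iota; lia.
set P := 4 * Num.sqrt (g * h)%:R * lg R N.
have l1 := lg_ge1 R N; have l0 := lg_ge0 R N.
have P0 : 0 <= P by rewrite !mulr_ge0 ?sqrtr_ge0.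
set W := weight g * weight h; have W0 : 0 <= W by rewrite mulr_ge0 ?weight_ge0.
pose f n := dual_coef R J L r g n * (dual_coef R J L r h n)^*%C.
pose a n : R[i] := if (n %% 8 == b)%N then (kronecker (g * h) n)%:~R else 0.
set M := (2 * maxn g h).+1.
pose K := class_phase g * (class_phase h)^*%C.
have nmK : nm K = 1 by rewrite nmM nmJ !nm_expi mulr1.
have JJ : 0 <= J%:R * (g%:R + h%:R) :> R by apply: mulr_ge0 => //; exact: addr_ge0.
have N0 : 0 <= N%:R :> R by [].
have rhs0 : 0 <= 1024 * lg R N ^+ 2 * (Num.sqrt (g * h)%:R * W * (N%:R + J%:R * (g%:R + h%:R))).
  apply: (mulr_ge0 (mulr_ge0 (ler0n _ 1024) (sqr_ge0 _))).
  exact: (mulr_ge0 (mulr_ge0 (sqrtr_ge0 _) W0) (addr_ge0 N0 JJ)).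
have E : \sum_(0 <= q < N.+1 | (q %% 8 == b)%N) dual_term q g * (dual_term q h)^*%C =
    K * \sum_(M <= q < N.+1) a q * f q.
  rewrite [LHS]big_mkcond mulr_sumr [RHS](big_nat_widenl M 0) // [RHS]big_mkcond.
  apply: eq_bigr => q _; rewrite /a /dual_term /M.
  case: ifP => qb; last by rewrite mul0r mulr0; case: ifP.
  rewrite andTb Mb.
  case: ifP => gq; last by rewrite mul0r.
  case: ifP => hq; last by rewrite rmorph0 mulr0.
  rewrite /= kroneckerMl ?(odd_mod8 ob qb) // intrM -/(chi R q g) -/(chi R q h) /K /f.
  move: (dual_coef _ _ _ _ g q) (dual_coef _ _ _ _ h q) (class_phase g) (class_phase h) => D1 D2 u1 u2.
  by rewrite !rmorphM /= chi_conj; ring.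
rewrite E nmM nmK mul1r.
have [MN|NM] := leqP M N; last by rewrite big_geq // nm0.
have aP x : (x <= N.+1)%N -> nm (\sum_(M <= n < x) a n) <= P.
  move=> _; rewrite -big_mkcond -rmorph_sum /= nm_int.
  apply: le_trans (off_diagonal_le _ _ _ g0 h0 gh ob b8) _.
  rewrite /P (_ : 4 * _ * _ = 2 * Num.sqrt (g * h)%:R * (2 * lg R N)); last by ring.
  rewrite ler_wpM2l ?mulr_ge0 ?sqrtr_ge0 //.
  by apply: le_trans (lgX2 _ _); apply: lg_le; rewrite -mulnn leq_mul.
apply: le_trans (abel_summation f MN aP) _.
have supN : nm (f N) <= N%:R * W.
  have /andP[gN2 hN2] : (2 * g < N)%N && (2 * h < N)%N by rewrite -Mb.
  have c1 : nm (dual_coef R J L r g N) <= Num.sqrt N%:R * weight g.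
    exact: (dual_coef_sup R L0 LJ NL r8 g0 gN2 (leqnn N)).
  have c2 : nm (dual_coef R J L r h N) <= Num.sqrt N%:R * weight h.
    exact: (dual_coef_sup R L0 LJ NL r8 h0 hN2 (leqnn N)).
  rewrite nmM nmJ; have := ler_pM (nm_ge0 _) (nm_ge0 _) c1 c2.
  by rewrite mulrACA -expr2 sqr_sqrtr.
have dif n : (M <= n < N)%N -> nm (f n.+1 - f n) <=
    W * (256 * J%:R * (g%:R + h%:R) * n%:R^-1 + 8).
  move=> /andP[Mn nN].
  have /andP[gn hn] : (2 * g < n)%N && (2 * h < n)%N by rewrite -Mb.
  have R1 := dual_coef_relvar R L0 LJ NL r8 g0 gn nN.
  have R2 := relvar_conj (dual_coef_relvar R L0 LJ NL r8 h0 hn nN).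
  have [_ _] := relvar_mul R1 R2.
  have n0 : (n%:R : R) != 0 by rewrite pnatr_eq0 -lt0n (leq_ltn_trans _ gn).
  rewrite -/(weight g) -/(weight h) => H; apply: le_trans H _.
  rewrite le_eqVlt; apply/orP; left; apply/eqP.
  have e := sqr_sqrtr (ler0n R n); rewrite /W.
  transitivity (4 * (Num.sqrt n%:R) ^+ 2 * (weight g * weight h) *
     (64 * J%:R * (g%:R / n%:R ^+ 2) + n%:R^-1 + (64 * J%:R * (h%:R / n%:R ^+ 2) + n%:R^-1))); first by ring.
  by rewrite e; field.
have difsum : \sum_(M <= n < N) nm (f n.+1 - f n) <=
    W * (256 * J%:R * (g%:R + h%:R) * lg R N + 8 * N%:R).
  apply: (@le_trans _ _ (\sum_(M <= n < N) W * (256 * J%:R * (g%:R + h%:R) * n%:R^-1 + 8))).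
    by rewrite big_nat_cond [X in _ <= X]big_nat_cond; apply: ler_sum => n /andP[mn _]; exact: dif.
  rewrite -mulr_sumr ler_wpM2l // big_split /= lerD //.
    rewrite -mulr_sumr ler_wpM2l ?mulr_ge0 ?addr_ge0 //.
    apply: le_trans (harmonic_le R N); apply: sum_sub_le => [||n]; first exact: iota_uniq.
      exact: Ms.
    by rewrite /= invr_ge0.
  by rewrite sumr_const_nat -[X in X <= _]mulr_natr ler_wpM2l // ler_nat leq_subr.
(* The terms in N have total constant 1 + 8, those in J have 256. With the factor 4 of [P] this
   yields 1024. *)
have B : nm (f N) + \sum_(M <= n < N) nm (f n.+1 - f n) <= 256 * W * lg R N * (N%:R + J%:R * (g%:R + h%:R)).
  apply: le_trans (lerD supN difsum) _.
  have h1 : W * N%:R <= W * N%:R * lg R N by rewrite ler_peMr // mulr_ge0.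
  have h2 : 0 <= W * N%:R by rewrite mulr_ge0.
  lra.
apply: le_trans (ler_wpM2l P0 B) _.
by apply: le_of_eq; rewrite /P; ring.
Qed.

End AveragedSecondMoment.

(** * Summation over the dual frequencies *)

Section SquarefreeModuli.
Variable R : realType.

Lemma sqr_sum_le (I : Type) (s : seq I) (F : I -> R) :
  (\sum_(i <- s) F i) ^+ 2 <= (size s)%:R * \sum_(i <- s) F i ^+ 2.
Proof.
elim: s => [|x s IH]; first by rewrite !big_nil mul0r expr0n.
rewrite !big_cons /=; move: IH; set A := \sum_(i <- s) F i; set B := \sum_(i <- s) _ => IH.
rewrite -natr1; have s0 : 0 <= (size s)%:R :> R by [].
suff : 2 * F x * A <= (size s)%:R * F x ^+ 2 + B by move=> h; nra.
have [s00|sn0] := eqVneq (size s) 0%N.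
  have -> : A = 0 by rewrite /A (size0nil s00) big_nil.
  by rewrite mulr0 s00 mul0r add0r sumr_ge0 // => i _; exact: sqr_ge0.
have sp : 0 < (size s)%:R :> R by rewrite ltr0n lt0n.
rewrite -(ler_pM2l sp); have := sqr_ge0 ((size s)%:R * F x - A); nra.
Qed.

Section WeightBounds.
Variables (N J L : nat).
Hypotheses (L0 : (0 < L)%N) (LJ : (L <= J)%N) (NL : (N <= L ^ 2)%N) (LN : (L ^ 2 <= 4 * N)%N).

(** The second bound is where two averagings are needed: for g > L the left side is L^2 / sqrt g,
    whereas a single factor [damp] would leave L sqrt g, unbounded in g. *)
Lemma weight_bound g : (0 < g)%N ->
  Num.sqrt g%:R * weight R L g <= Num.sqrt L%:R / g%:R /\
  Num.sqrt g%:R * weight R L g * g%:R <= L%:R * Num.sqrt L%:R / g%:R.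
Proof.
move=> g0; have gR : (0 : R) < g%:R by rewrite ltr0n.
have LR : (0 : R) < L%:R by rewrite ltr0n.
have x0 : 0 < Num.sqrt (g%:R : R) by rewrite sqrtr_gt0.
have y0 : 0 < Num.sqrt (L%:R : R) by rewrite sqrtr_gt0.
have xg := sqr_sqrtr (ltW gR); have yL := sqr_sqrtr (ltW LR).
suff [h1 h2] : Num.sqrt g%:R * damp R L g ^+ 2 <= Num.sqrt L%:R /\
    Num.sqrt g%:R * damp R L g ^+ 2 * g%:R <= L%:R * Num.sqrt L%:R.
  rewrite /weight [Num.sqrt g%:R * _]mulrA; split; first by rewrite ler_pM2r ?invr_gt0.
  by rewrite mulrAC ler_pM2r ?invr_gt0.
rewrite /damp; case: (leP 1 (L%:R / g%:R)) => [|].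
  rewrite ler_pdivlMr // mul1r => gL; rewrite expr1n mulr1.
  have xy : Num.sqrt (g%:R : R) <= Num.sqrt L%:R by rewrite ler_sqrt ?(ltW LR).
  by split=> //; rewrite mulrC; apply: ler_pM; rewrite ?sqrtr_ge0.
rewrite ltr_pdivrMr // mul1r => Lg.
have yx : Num.sqrt (L%:R : R) <= Num.sqrt g%:R by rewrite ler_sqrt ?(ltW gR) ?(ltW Lg).
move: x0 y0 yx xg yL; set x := Num.sqrt g%:R; set y := Num.sqrt L%:R => x0 y0 yx <- <-.
have -> : x * (y ^+ 2 / x ^+ 2) ^+ 2 = y * (y / x) ^+ 3 by field; rewrite gt_eqF.
have yx1 : 0 <= y / x <= 1 by rewrite divr_ge0 ?(ltW x0) ?(ltW y0) //= ler_pdivrMr // mul1r.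
have [a0 a1] := andP yx1.
split.
  by rewrite ler_piMr ?(ltW y0) // exprn_ile1.
have -> : y * (y / x) ^+ 3 * x ^+ 2 = y ^+ 2 * y * (y / x) by field; rewrite gt_eqF.
by rewrite ler_piMr // mulr_ge0 ?sqr_ge0 // ?(ltW y0).
Qed.

(** By [weight_bound] each term is at most (N L + 2 J L^2) / (g h), and L <= J together with L^2 <=
    4 N gives 9 N J. *)
Lemma off_diagonal_weight_sum :
  \sum_(1 <= g < N.+1) \sum_(1 <= h < N.+1)
     Num.sqrt (g * h)%:R * (weight R L g * weight R L h) * (N%:R + J%:R * (g%:R + h%:R))
  <= 9 * N%:R * J%:R * lg R N ^+ 2.
Proof.
have LJR : L%:R <= J%:R :> R by rewrite ler_nat.
have NR : 0 <= N%:R :> R by []. have JR : 0 <= J%:R :> R by []. have LR : 0 <= L%:R :> R by [].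
have L2 : L%:R ^+ 2 <= 4 * N%:R :> R by rewrite -natrX -natrM ler_nat.
apply: (@le_trans _ _ (\sum_(1 <= g < N.+1) \sum_(1 <= h < N.+1) 9 * N%:R * J%:R * (g%:R^-1 * h%:R^-1))).
  rewrite big_nat_cond [X in _ <= X]big_nat_cond; apply: ler_sum => g /andP[/andP[g0 _] _].
  rewrite big_nat_cond [X in _ <= X]big_nat_cond; apply: ler_sum => h /andP[/andP[h0 _] _].
  rewrite natrM sqrtrM //.
  have [ag bg] := weight_bound g0; have [ah bh] := weight_bound h0.
  have ag0 : 0 <= Num.sqrt g%:R * weight R L g by rewrite mulr_ge0 ?sqrtr_ge0 ?weight_ge0.
  have ah0 : 0 <= Num.sqrt h%:R * weight R L h by rewrite mulr_ge0 ?sqrtr_ge0 ?weight_ge0.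
  have bg0 : 0 <= Num.sqrt g%:R * weight R L g * g%:R by rewrite mulr_ge0.
  have bh0 : 0 <= Num.sqrt h%:R * weight R L h * h%:R by rewrite mulr_ge0.
  have e1 := ler_pM ag0 ah0 ag ah; have e2 := ler_pM bg0 ah0 bg ah; have e3 := ler_pM ag0 bh0 ag bh.
  have yL := sqr_sqrtr LR; have i0 : 0 <= (g%:R : R)^-1 * (h%:R)^-1 by rewrite mulr_ge0 ?invr_ge0.
  move: e1 e2 e3 ag0 ah0 bg0 bh0; set a := Num.sqrt g%:R * _; set c := Num.sqrt h%:R * _.
  set y := Num.sqrt L%:R in yL *; set G := (g%:R : R)^-1 in i0 *; set H := (h%:R : R)^-1 in i0 *.
  move=> e1 e2 e3 ag0 ah0 bg0 bh0.
  have -> : Num.sqrt g%:R * Num.sqrt h%:R * (weight R L g * weight R L h) * (N%:R + J%:R * (g%:R + h%:R)) =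
     N%:R * (a * c) + J%:R * (a * g%:R * c) + J%:R * (a * (c * h%:R)) by rewrite /a /c; ring.
  have f1 : N%:R * (a * c) <= N%:R * (L%:R * (G * H)).
    by rewrite ler_wpM2l // (le_trans e1) // -yL; apply: le_of_eq; ring.
  have f2 : J%:R * (a * g%:R * c) <= J%:R * (L%:R ^+ 2 * (G * H)).
    by rewrite ler_wpM2l // (le_trans e2) // -yL; apply: le_of_eq; ring.
  have f3 : J%:R * (a * (c * h%:R)) <= J%:R * (L%:R ^+ 2 * (G * H)).
    by rewrite ler_wpM2l // (le_trans e3) // -yL; apply: le_of_eq; ring.
  have k1 : N%:R * (L%:R * (G * H)) <= N%:R * (J%:R * (G * H)).
    by rewrite ler_wpM2l // ler_wpM2r.
  have k2 : J%:R * (L%:R ^+ 2 * (G * H)) <= J%:R * (4 * N%:R * (G * H)).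
    by rewrite ler_wpM2l // ler_wpM2r.
  lra.
have -> : \sum_(1 <= g < N.+1) \sum_(1 <= h < N.+1) 9 * N%:R * J%:R * (g%:R^-1 * h%:R^-1) =
   9 * N%:R * J%:R * (\sum_(1 <= g < N.+1) (g%:R)^-1) ^+ 2 :> R.
  by rewrite expr2 big_distrlr mulr_sumr; apply: eq_bigr => g _; rewrite mulr_sumr.
rewrite ler_wpM2l ?mulr_ge0 // lerXn2r ?nnegrE ?lg_ge0 ?harmonic_le //.
by apply: sumr_ge0 => g _; rewrite invr_ge0.
Qed.

Variables (r b : nat).
Hypotheses (r8 : (r <= 8)%N) (ob : odd b) (b8 : (b < 8)%N).

Lemma averaged_second_moment :
  \sum_(0 <= q < N.+1 | (q %% 8 == b)%N && (squarefree q && (1 < q)%N))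
     ((\sum_(j <- twice_shifted J L) kronecker (r + 8 * j) q) ^+ 2)%:~R
  <= L%:R ^+ 4 * (4 * 10 ^+ 4 * N%:R * J%:R * lg R N ^+ 4).
Proof.
have l1 := lg_ge1 R N; have l0 := lg_ge0 R N.
have NJ : 0 <= N%:R * J%:R :> R by rewrite mulr_ge0.
apply: (@le_trans _ _ (\sum_(0 <= q < N.+1 | (q %% 8 == b)%N)
   4 * L%:R ^+ 4 * nm (\sum_(g <- index_iota 1 N.+1) dual_term R J L r b q g) ^+ 2)).
  rewrite big_mkcondr big_nat_cond [X in _ <= X]big_nat_cond; apply: ler_sum => q /andP[/andP[_ qN] qb] /=.
  case: ifP => [/andP[sq q1]|_]; last first.
    by rewrite mulr_ge0 ?sqr_ge0 // mulr_ge0 // exprn_ge0.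
  have qN' : (1 < q <= N)%N by rewrite q1.
  have H := averaged_dual R L0 LJ NL LN r8 ob b8 (odd_mod8 ob qb) sq qN' qb.
  have -> : ((\sum_(j <- twice_shifted J L) kronecker (r + 8 * j) q) ^+ 2)%:~R =
     nm (\sum_(j <- twice_shifted J L) chi R q (r + 8 * j)) ^+ 2.
    rewrite -[\sum_(j <- _) chi R _ _]rmorph_sum /= nm_int -[in RHS]rmorphXn /= -normrX ger0_norm //.
    exact: sqr_ge0.
  apply: le_trans (_ : (2 * L%:R ^+ 2 * nm (\sum_(1 <= g < N.+1) dual_term R J L r b q g)) ^+ 2 <= _).
    by rewrite lerXn2r ?nnegrE ?nm_ge0 // mulr_ge0 ?nm_ge0 // mulr_ge0 // sqr_ge0.
  by apply: le_of_eq; ring.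
rewrite -mulr_sumr.
set T := \sum_(0 <= q < N.+1 | _) _.
(* The constants are 4 from the diagonal and 1024 * 9 from the other pairs, together below 10^4. *)
suff TB : T <= 10 ^+ 4 * N%:R * J%:R * lg R N ^+ 4.
  have L4 : 0 <= L%:R ^+ 4 :> R by rewrite exprn_ge0.
  have := ler_wpM2l L4 TB; have X0 : 0 <= L%:R ^+ 4 * (N%:R * J%:R * lg R N ^+ 4).
    by rewrite mulr_ge0 // mulr_ge0 // exprn_ge0.
  lra.
apply: le_trans (second_moment_expand _ _ _ _) _.
pose dg g h : R := (okern g == okern h)%:R * (N%:R * (J%:R * (Num.sqrt (g * h)%:R)^-1)).
pose od g h : R := Num.sqrt (g * h)%:R * (weight R L g * weight R L h) * (N%:R + J%:R * (g%:R + h%:R)).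
have dg0 g h : 0 <= dg g h by rewrite !mulr_ge0 ?invr_ge0 ?sqrtr_ge0.
have od0 g h : 0 <= od g h.
  apply: mulr_ge0; last by rewrite addr_ge0 // mulr_ge0 // addr_ge0.
  by apply: mulr_ge0; [exact: sqrtr_ge0 | apply: mulr_ge0; exact: weight_ge0].
have c0 : 0 <= 1024 * lg R N ^+ 2 by exact: mulr_ge0 (ler0n _ 1024) (sqr_ge0 _).
apply: (@le_trans _ _ (\sum_(1 <= g < N.+1) \sum_(1 <= h < N.+1) (dg g h + 1024 * lg R N ^+ 2 * od g h))).
  rewrite big_nat_cond [X in _ <= X]big_nat_cond; apply: ler_sum => g /andP[/andP[g0 gN] _].
  rewrite big_nat_cond [X in _ <= X]big_nat_cond; apply: ler_sum => h /andP[/andP[h0 hN] _].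
  have [gh|gh] := eqVneq (okern g) (okern h).
    apply: le_trans (dual_diagonal R L0 LJ NL r8 ob g0 h0) _.
    by rewrite /dg gh eqxx mul1r lerDl mulr_ge0.
  have gN' : (0 < g <= N)%N by rewrite g0. have hN' : (0 < h <= N)%N by rewrite h0.
  apply: le_trans (dual_off_diagonal R L0 LJ NL LN r8 ob b8 gN' hN' gh) _.
  by rewrite lerDr.
under eq_bigr do rewrite big_split /= -mulr_sumr.
rewrite big_split /= -mulr_sumr.
have D : \sum_(1 <= g < N.+1) \sum_(1 <= h < N.+1) dg g h <= N%:R * J%:R * (4 * lg R N ^+ 3).
  apply: le_trans (_ : _ <= _) (ler_wpM2l NJ (diagonal_sum_le R N)).
  apply: le_of_eq; rewrite mulr_sumr; apply: eq_bigr => g _.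
  rewrite mulr_sumr [RHS]big_mkcond; apply: eq_bigr => h _; rewrite /dg.
  by case: eqP => _; rewrite ?mul1r ?mul0r // mulrA.
have O := ler_wpM2l c0 off_diagonal_weight_sum.
apply: le_trans (lerD D O) _.
have l34 : N%:R * J%:R * lg R N ^+ 3 <= N%:R * J%:R * lg R N ^+ 4.
  by rewrite ler_wpM2l // [X in _ <= X]exprS ler_peMl // exprn_ge0.
have -> : 1024 * lg R N ^+ 2 * (9 * N%:R * J%:R * lg R N ^+ 2) = 1024 * 9 * (N%:R * J%:R * lg R N ^+ 4) by ring.
have : 0 <= N%:R * J%:R * lg R N ^+ 4 by rewrite mulr_ge0 // exprn_ge0.
move: l34; set u := lg R N ^+ 4; set v := lg R N ^+ 3; lra.
Qed.

End WeightBounds.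
End SquarefreeModuli.

(** * Second moments for all sums over progressions mod 8 *)

Section SquarefreeMeanValue.
Variable R : realType.

Lemma ler_psum_natr (s : seq nat) (P Q : pred nat) (F : nat -> R) : (forall q, P q -> Q q) ->
  (forall q, 0 <= F q) -> \sum_(q <- s | P q) F q <= \sum_(q <- s | Q q) F q.
Proof.
move=> PQ F0; rewrite big_mkcond [X in _ <= X]big_mkcond; apply: ler_sum => q _.
by case: ifP => [/PQ ->//|_]; case: ifP.
Qed.

Lemma sum_shift_telescope (k : nat -> int) J t :
  \sum_(0 <= j < J) k (j + t)%N =
  \sum_(0 <= j < J) k j + \sum_(J <= j < J + t) k j - \sum_(0 <= j < t) k j.
Proof.
have -> : \sum_(0 <= j < J) k (j + t)%N = \sum_(t <= j < J + t) k j.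
  by rewrite -{2}[t]add0n big_addn addnK.
have e1 : \sum_(0 <= j < J + t) k j = \sum_(0 <= j < J) k j + \sum_(J <= j < J + t) k j.
  by rewrite (big_cat_nat _ (n := J)) ?leq_addr.
have e2 : \sum_(0 <= j < J + t) k j = \sum_(0 <= j < t) k j + \sum_(t <= j < J + t) k j.
  by rewrite (big_cat_nat _ (n := t)) ?leq_addl.
by rewrite -e1 e2 [_ + \sum_(t <= _ < _) _]addrC addrK.
Qed.

(** The modulus 1 is left out because its symbol is constantly 1. *)
Definition sfree q := squarefree q && (1 < q)%N.

Definition progression_sum r J q : int := \sum_(0 <= j < J) kronecker (r + 8 * j) q.

Lemma progression_direct N b Z r a J : odd b -> (b < 8)%N -> (0 < r)%N -> (r + 8 * (a + J) <= Z)%N ->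
  (\sum_(0 <= q < N.+1 | (q %% 8 == b)%N && sfree q)
    ((\sum_(a <= j < a + J) kronecker (r + 8 * j) q) ^+ 2)%:~R : R) <=
    4 * Z%:R * lg R Z ^+ 3 * (N%:R + J%:R ^+ 2).
Proof.
move=> ob b8 r0 rZ.
pose ms := [seq (r + 8 * j)%N | j <- index_iota a (a + J)].
have szms : size ms = J by rewrite size_map size_iota addKn.
have ums : uniq ms.
  by rewrite map_inj_uniq ?iota_uniq // => x y /eqP; rewrite eqn_add2l eqn_pmul2l // => /eqP.
have msZ : {subset ms <= index_iota 1 Z.+1}.
  by move=> m /mapP[j]; rewrite !mem_index_iota => /andP[aj jJ] ->; apply/andP; split; lia.
have := direct_second_moment R N ob b8 ums msZ; rewrite szms; apply: le_trans.
rewrite rmorph_sum /=; apply: le_trans (ler_psum_natr (Q := fun q => (q %% 8 == b)%N) _ _ _) _.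
- by move=> q /andP[].
- by move=> q; rewrite ler0z sqr_ge0.
by under [X in _ <= X]eq_bigr do rewrite big_map.
Qed.

(** The factor 3 of the three-term square inequality turns the averaged part into 12 * 10^4, rounded
    up, and each of the two families of short sums into 75 * 10^2. *)
Definition main_const : R := 4 * 10 ^+ 5 + 150 * 10 ^+ 2 * lg R 32 ^+ 3.

Lemma lg32_ge0 : 0 <= lg R 32 ^+ 3. Proof. by rewrite exprn_ge0 // lg_ge0. Qed.

Lemma lg_cube_le c N Z : (Z <= c * N)%N -> lg R Z ^+ 3 <= lg R c ^+ 3 * lg R N ^+ 3.
Proof.
move=> ZN; rewrite -exprMn lerXn2r ?nnegrE ?mulr_ge0 ?lg_ge0 //.
by apply: le_trans (lgM _ _ _); exact: lg_le.
Qed.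

(** A translate by t differs from the original sum by two sums of length t <= 2 L, one at each end.
    For these [progression_direct] has N + t^2 <= 17 N, so they cost no more than the averaged
    sum. *)
Lemma progression_main N J L r b : (0 < L)%N -> (L <= J)%N -> (J <= N)%N ->
  (N <= L ^ 2)%N -> (L ^ 2 <= 4 * N)%N -> (0 < r <= 8)%N -> odd b -> (b < 8)%N ->
  (\sum_(0 <= q < N.+1 | (q %% 8 == b)%N && sfree q) (progression_sum r J q ^+ 2)%:~R : R)
   <= main_const * N%:R * J%:R * lg R N ^+ 4.
Proof.
move=> L0 LJ JN NL LN /andP[r0 r8] ob b8.
have LR : (0 : R) < L%:R by rewrite ltr0n.
have L4 : (0 : R) < L%:R ^+ 4 by rewrite exprn_gt0.
set ts := [seq (t1 + t2)%N | t1 <- iota 0 L, t2 <- iota 0 L].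
have szt : size ts = (L ^ 2)%N by rewrite size_allpairs !size_iota mulnn.
pose avg q : R := (\sum_(j <- twice_shifted J L) kronecker (r + 8 * j) q)%:~R.
pose tail t q : R := (\sum_(J <= j < J + t) kronecker (r + 8 * j) q)%:~R.
pose head t q : R := (\sum_(0 <= j < 0 + t) kronecker (r + 8 * j) q)%:~R.
have split q : L%:R ^+ 2 * (progression_sum r J q)%:~R =
    avg q - \sum_(t <- ts) tail t q + \sum_(t <- ts) head t q.
  have -> : avg q = \sum_(t <- ts) ((progression_sum r J q)%:~R + tail t q - head t q).
    rewrite /avg big_allpairs_dep exchange_big /= rmorph_sum; apply: eq_bigr => t _ /=.
    have := sum_shift_telescope (fun j => kronecker (r + 8 * j) q) J t.
    by rewrite {1}/index_iota subn0 => ->; rewrite /head add0n -intrD -intrB.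
  by rewrite sumrB big_split /= sum_const_seq szt natrX; ring.
have l1 := lg_ge1 R N; have l0 := lg_ge0 R N.
have NJ : 0 <= N%:R * J%:R :> R by rewrite mulr_ge0.
have l34 : N%:R * J%:R * lg R N ^+ 3 <= N%:R * J%:R * lg R N ^+ 4.
  by rewrite ler_wpM2l // [X in _ <= X]exprS ler_peMl // exprn_ge0.
have edge a t : (a <= J)%N -> t \in ts ->
    (\sum_(0 <= q < N.+1 | (q %% 8 == b)%N && sfree q)
       ((\sum_(a <= j < a + t) kronecker (r + 8 * j) q)%:~R ^+ 2)) <=
      25 * 10 ^+ 2 * lg R 32 ^+ 3 * (N%:R * J%:R * lg R N ^+ 3).
  move=> aJ /allpairsP[[t1 t2] /= []]; rewrite !mem_iota /= !add0n => t1L t2L tE.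
  have tL : (t <= 2 * L)%N by rewrite tE; lia.
  (* Here r <= 8 and t <= 2 L <= 2 J, so the largest argument is at most 8 + 24 J. Then 4 * 32 * 17
     <= 25 * 10^2. *)
  have Z : (r + 8 * (a + t) <= 32 * J)%N by lia.
  rewrite (eq_bigr (fun q => ((\sum_(a <= j < a + t) kronecker (r + 8 * j) q) ^+ 2)%:~R)); last first.
    by move=> q _; rewrite rmorphXn.
  apply: le_trans (progression_direct N ob b8 r0 Z) _.
  have Nt : N%:R + t%:R ^+ 2 <= 17 * N%:R :> R.
    rewrite -natrX -natrD -natrM ler_nat.
    have : (t ^ 2 <= (2 * L) ^ 2)%N by rewrite leq_exp2r.
    by rewrite expnMn; lia.
  have lZ : lg R (32 * J) ^+ 3 <= lg R 32 ^+ 3 * lg R N ^+ 3 by apply: lg_cube_le; rewrite leq_mul.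
  rewrite natrM; apply: (@le_trans _ _ (4 * (32 * J%:R) * (lg R 32 ^+ 3 * lg R N ^+ 3) * (17 * N%:R))).
    have P1 : 0 <= 4 * (32 * J%:R) :> R by rewrite mulr_ge0 // mulr_ge0.
    have P2 : 0 <= lg R (32 * J) ^+ 3 by rewrite exprn_ge0 // lg_ge0.
    exact: (ler_pM (mulr_ge0 P1 P2) (addr_ge0 (ler0n _ _) (sqr_ge0 _)) (ler_wpM2l P1 lZ) Nt).
  have : 0 <= lg R 32 ^+ 3 * (N%:R * J%:R * lg R N ^+ 3).
    by rewrite mulr_ge0 ?lg32_ge0 // mulr_ge0 // exprn_ge0.
  lra.
rewrite -(ler_pM2l L4) mulr_sumr.
apply: (@le_trans _ _ (\sum_(0 <= q < N.+1 | (q %% 8 == b)%N && sfree q)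
    (3 * avg q ^+ 2 + 3 * L%:R ^+ 2 * \sum_(t <- ts) (tail t q) ^+ 2 + 3 * L%:R ^+ 2 * \sum_(t <- ts) (head t q) ^+ 2))).
  apply: ler_sum => q _.
  have -> : L%:R ^+ 4 * (progression_sum r J q ^+ 2)%:~R =
     (avg q - \sum_(t <- ts) tail t q + \sum_(t <- ts) head t q) ^+ 2.
    by rewrite -split rmorphXn exprMn -exprM.
  have c1 := sqr_sum_le ts (fun t => tail t q); have c2 := sqr_sum_le ts (fun t => head t q).
  rewrite szt natrX in c1 c2; move: c1 c2.
  set x := avg q; set y := \sum_(t <- ts) tail t q; set z := \sum_(t <- ts) head t q.
  have := sqr_ge0 (x + y); have := sqr_ge0 (x - z); have := sqr_ge0 (y + z); nra.
rewrite !big_split /= -!mulr_sumr.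
rewrite [X in _ + 3 * L%:R ^+ 2 * X + _]exchange_big /= [X in _ + 3 * L%:R ^+ 2 * X]exchange_big /=.
have A := averaged_second_moment R L0 LJ NL LN r8 ob b8.
have B1 : \sum_(t <- ts) \sum_(0 <= q < N.+1 | (q %% 8 == b)%N && sfree q) tail t q ^+ 2 <=
   25 * 10 ^+ 2 * lg R 32 ^+ 3 * (N%:R * J%:R * lg R N ^+ 3) * L%:R ^+ 2.
  rewrite -[L%:R ^+ 2]natrX -szt -sum_const_seq big_seq [X in _ <= X]big_seq; apply: ler_sum => t ti.
  exact: edge.
have B2 : \sum_(t <- ts) \sum_(0 <= q < N.+1 | (q %% 8 == b)%N && sfree q) head t q ^+ 2 <=
   25 * 10 ^+ 2 * lg R 32 ^+ 3 * (N%:R * J%:R * lg R N ^+ 3) * L%:R ^+ 2.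
  rewrite -[L%:R ^+ 2]natrX -szt -sum_const_seq big_seq [X in _ <= X]big_seq; apply: ler_sum => t ti.
  exact: edge.
have A' : \sum_(0 <= q < N.+1 | (q %% 8 == b)%N && sfree q) avg q ^+ 2 <=
    L%:R ^+ 4 * (4 * 10 ^+ 4 * N%:R * J%:R * lg R N ^+ 4).
  by apply: le_trans A; apply: le_of_eq; apply: eq_bigr => q _; rewrite rmorphXn.
have L2 : 0 <= 3 * L%:R ^+ 2 :> R by rewrite mulr_ge0 // sqr_ge0.
have D1 := ler_wpM2l L2 B1; have D2 := ler_wpM2l L2 B2; have D3 := ler_wpM2l (ler0n R 3) A'.
apply: le_trans (lerD (lerD D3 D1) D2) _.
have E1 : 3 * L%:R ^+ 2 * (25 * 10 ^+ 2 * lg R 32 ^+ 3 * (N%:R * J%:R * lg R N ^+ 3) * L%:R ^+ 2) =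
   L%:R ^+ 4 * (75 * 10 ^+ 2 * (lg R 32 ^+ 3 * (N%:R * J%:R * lg R N ^+ 3))) by ring.
rewrite E1 mulrCA -!mulrDr ler_wpM2l ?(ltW L4) // /main_const.
have := ler_wpM2l lg32_ge0 l34.
have : 0 <= N%:R * J%:R * lg R N ^+ 4 by rewrite mulr_ge0 // exprn_ge0.
set l3 := lg R 32 ^+ 3; set v := lg R N ^+ 3; set u := lg R N ^+ 4; lra.
Qed.

End SquarefreeMeanValue.

(** * All lengths of the d-sum, and all odd classes of squarefree n *)

Section OddModuli.
Variable R : realType.

Lemma sqrt_scale N : (0 < N)%N ->
  exists L, [/\ (0 < L)%N, (N <= L ^ 2)%N, (L ^ 2 <= 4 * N)%N & (L <= N)%N].
Proof.
move=> N0; have ex : exists L, (N <= L ^ 2)%N by exists N; rewrite -mulnn leq_pmulr.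
case: (ex_minnP ex) => L NL Lmin; exists L.
have L0 : (0 < L)%N by case: (posnP L) NL => // ->; rewrite exp0n // leqn0 => /eqP e; rewrite e in N0.
split=> //; last by apply: Lmin; rewrite -mulnn leq_pmulr.
have [L1|L2] := leqP L 1; first by apply: leq_trans (_ : 1 ^ 2 <= _)%N; [rewrite leq_exp2r|lia].
have : (L.-1 ^ 2 < N)%N by rewrite ltnNge; apply/negP => /Lmin; lia.
have : (L <= 2 * L.-1)%N by lia.
by rewrite -(leq_exp2r _ _ (isT : 0 < 2)%N) expnMn; lia.
Qed.

(** The sum of the constants of the three ranges of J: intermediate, below L (where 320 = 4 * 16 *
    5), and above N. *)
Definition class_const : R := main_const R + 320 * lg R 32 ^+ 3 + 4.

Lemma class_const_ge0 : 0 <= class_const.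
Proof.
have := lg32_ge0 R; rewrite /class_const /main_const; set u := lg R 32 ^+ 3; lra.
Qed.

(** The factor min(N, J), rather than J, is what later confines the loss of the squarefree sieve to
    powers of log N. *)
Lemma progression_mean_class N J r b : (0 < N)%N -> (0 < r <= 8)%N -> odd b -> (b < 8)%N ->
  (\sum_(0 <= q < N.+1 | (q %% 8 == b)%N && sfree q) (progression_sum r J q ^+ 2)%:~R : R)
   <= class_const * (N%:R * (minn N J)%:R * lg R N ^+ 4).
Proof.
move=> N0 rr ob b8; have [r0 r8] := andP rr.
have l1 := lg_ge1 R N; have l0 := lg_ge0 R N; have l32 := lg32_ge0 R.
have U0 K : 0 <= N%:R * K%:R * lg R N ^+ 4 by rewrite mulr_ge0 // ?exprn_ge0 // mulr_ge0.
have fin (c : R) K : 0 <= c -> c <= class_const -> c * (N%:R * K%:R * lg R N ^+ 4) <= class_const * (N%:R * K%:R * lg R N ^+ 4).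
  by move=> _ cc; rewrite ler_wpM2r.
case: (posnP J) => [->|J0].
  rewrite big1 ?mulr_ge0 ?class_const_ge0 ?exprn_ge0 // => q _.
  by rewrite /progression_sum big_geq // expr0n.
have [L [L0 NL LN LleN]] := sqrt_scale N0.
have [NJ|JN] := ltnP N J.
  apply: le_trans (fin 4 N _ _) => //; last first.
    by rewrite /class_const /main_const; move: l32; set u := lg R 32 ^+ 3; lra.
  apply: (@le_trans _ _ (\sum_(0 <= q < N.+1 | (q %% 8 == b)%N) 4 * N%:R * lg R N ^+ 4)).
    rewrite big_mkcondr big_nat_cond [X in _ <= X]big_nat_cond; apply: ler_sum => q /andP[/andP[_ qN] qb].
    have l4 : 1 <= lg R N ^+ 2 by rewrite exprn_ege1.
    case: ifP => [/andP[sq q1]|_]; last by rewrite mulr_ge0 ?exprn_ge0 // mulr_ge0.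
    have P := polya_vinogradov R r 0 J (odd_mod8 ob qb) sq q1.
    have q0 := ltnW q1.
    have -> : (progression_sum r J q ^+ 2)%:~R = (`|progression_sum r J q|%:~R) ^+ 2 :> R.
      by rewrite -[in LHS]real_normK ?num_real // rmorphXn.
    apply: (@le_trans _ _ ((2 * Num.sqrt q%:R * lg R q) ^+ 2)).
      rewrite lerXn2r ?nnegrE ?ler0z //.
      by rewrite mulr_ge0 ?lg_ge0 // mulr_ge0 // sqrtr_ge0.
    rewrite !exprMn sqr_sqrtr // (_ : 2 ^+ 2 = 4 :> R); last by ring.
    rewrite -!mulrA ler_wpM2l //; apply: ler_pM; rewrite ?sqr_ge0 //; first by rewrite ler_nat.
    apply: (@le_trans _ _ (lg R N ^+ 2)).
      by rewrite lerXn2r ?nnegrE ?lg_ge0 // lg_le.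
    by rewrite (_ : 4 = 2 + 2)%N // exprD ler_peMl // sqr_ge0.
  rewrite (eq_bigr (fun=> 1%:R * (4 * N%:R * lg R N ^+ 4))) => [|q _]; last by rewrite mul1r.
  rewrite -mulr_suml -natr_sum; apply: (@le_trans _ _ (N%:R * (4 * N%:R * lg R N ^+ 4))).
    by rewrite ler_wpM2r ?ler_nat ?count_class_le // mulr_ge0 ?exprn_ge0 // mulr_ge0.
  by apply: le_of_eq; ring.
have [LJ|JL] := leqP L J.
  apply: le_trans (progression_main R L0 LJ JN NL LN rr ob b8) _.
  rewrite (_ : _ * N%:R * J%:R * _ = main_const R * (N%:R * J%:R * lg R N ^+ 4)); last by ring.
  by apply: fin; rewrite /class_const /main_const; move: l32; set u := lg R 32 ^+ 3; lra.
have Z : (r + 8 * (0 + J) <= 16 * J)%N by lia.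
rewrite (eq_bigr (fun q => ((\sum_(0 <= j < 0 + J) kronecker (r + 8 * j) q) ^+ 2)%:~R)) //.
apply: le_trans (progression_direct R N ob b8 r0 Z) _.
have lZ : lg R (16 * J) ^+ 3 <= lg R 32 ^+ 3 * lg R N ^+ 3 by apply: lg_cube_le; rewrite leq_mul.
have NJ2 : N%:R + J%:R ^+ 2 <= 5 * N%:R :> R.
  rewrite -natrX -natrD -natrM ler_nat.
  have : (J ^ 2 <= L ^ 2)%N by rewrite leq_exp2r // ltnW.
  by lia.
apply: (@le_trans _ _ (4 * (16 * J%:R) * (lg R 32 ^+ 3 * lg R N ^+ 3) * (5 * N%:R))).
  rewrite natrM; have P1 : 0 <= 4 * (16 * J%:R) :> R by rewrite mulr_ge0 // mulr_ge0.
  have P2 : 0 <= lg R (16 * J) ^+ 3 by rewrite exprn_ge0 // lg_ge0.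
  exact: (ler_pM (mulr_ge0 P1 P2) (addr_ge0 (ler0n _ _) (sqr_ge0 _)) (ler_wpM2l P1 lZ) NJ2).
apply: (@le_trans _ _ (320 * lg R 32 ^+ 3 * (N%:R * J%:R * lg R N ^+ 4))).
  have -> : 4 * (16 * J%:R) * (lg R 32 ^+ 3 * lg R N ^+ 3) * (5 * N%:R) =
    320 * lg R 32 ^+ 3 * (N%:R * J%:R * lg R N ^+ 3) by ring.
  apply: (ler_wpM2l (mulr_ge0 (ler0n _ 320) l32)); apply: ler_wpM2l; first exact: mulr_ge0.
  by rewrite [X in _ <= X]exprS ler_peMl // exprn_ge0.
apply: fin; first exact: mulr_ge0 (ler0n _ 320) l32.
by rewrite /class_const /main_const; move: l32; set u := lg R 32 ^+ 3; lra.
Qed.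

Definition class_sum r Y n : int := \sum_(1 <= m < Y.+1 | (m %% 8 == r)%N) kronecker m n.

Lemma class_sumE r Y n : (0 < r < 8)%N ->
  class_sum r Y n = progression_sum r ((Y + 8 - r) %/ 8) n.
Proof.
move=> /andP[r0 r8]; rewrite /class_sum (sum_progression xpredT _ r8) //.
have -> : ((1 + (8 - 1) - r) %/ 8 = 0)%N by rewrite divn_small //; lia.
by have -> : (Y.+1 + (8 - 1) - r = Y + 8 - r)%N by lia.
Qed.

Lemma class_sum_squarefree_moduli N Y r : (0 < N)%N -> (0 < r < 8)%N ->
  (\sum_(0 <= q < N.+1 | odd q && sfree q) (class_sum r Y q ^+ 2)%:~R : R)
   <= 4 * class_const * (N%:R * (minn N Y)%:R * lg R N ^+ 4).
Proof.
move=> N0 rr; have rr' : (0 < r <= 8)%N by case/andP: rr => -> /ltnW.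
apply: (@le_trans _ _ (\sum_(b <- [:: 1; 3; 5; 7]%N)
   \sum_(0 <= q < N.+1 | (q %% 8 == b)%N && sfree q) (class_sum r Y q ^+ 2)%:~R)).
  under [X in _ <= X]eq_bigr do rewrite big_mkcond.
  rewrite [X in _ <= X]exchange_big [X in X <= _]big_mkcond; apply: ler_sum => q _ /=.
  have s0 : 0 <= (class_sum r Y q ^+ 2)%:~R :> R by rewrite ler0z sqr_ge0.
  rewrite !big_cons big_nil addr0.
  case: ifP => [/andP[oq sq]|_]; last by rewrite !addr_ge0 //; case: ifP.
  rewrite sq !andbT; have : odd (q %% 8) by move: oq; rewrite {1}(divn_eq q 8) oddD oddM andbF.
  have := ltn_pmod q (isT : 0 < 8)%N.
  by case: (q %% 8)%N => [|[|[|[|[|[|[|[|?]]]]]]]] //= _ _; rewrite ?addr0 ?add0r.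
have step b : odd b -> (b < 8)%N ->
   \sum_(0 <= q < N.+1 | (q %% 8 == b)%N && sfree q) (class_sum r Y q ^+ 2)%:~R
     <= class_const * (N%:R * (minn N Y)%:R * lg R N ^+ 4).
  move=> ob b8; under eq_bigr do rewrite (class_sumE _ _ rr).
  apply: le_trans (progression_mean_class _ N0 rr' ob b8) _.
  rewrite ler_wpM2l ?class_const_ge0 // ler_wpM2r ?exprn_ge0 ?lg_ge0 // ler_wpM2l // ler_nat.
  rewrite leq_min geq_minl (leq_trans (geq_minr _ _)) //.
  by case/andP: rr => r0 r8; lia.
apply: (@le_trans _ _ (\sum_(b <- [:: 1; 3; 5; 7]%N) class_const * (N%:R * (minn N Y)%:R * lg R N ^+ 4))).
  rewrite big_seq [X in _ <= X]big_seq; apply: ler_sum => b.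
  by rewrite !inE => /or4P[]/eqP->; apply: step.
by rewrite sum_const_seq /=; apply: le_of_eq; ring.
Qed.

End OddModuli.

(** * From squarefree to arbitrary odd non-square n *)

Section NonsquareModuli.
Variable R : realType.

(** Primes from 5 on contribute at least 4 each; only 3 falls short, and it occurs at most once,
    whence the ratio 4/3. *)
Lemma four_pow_le (ps : seq nat) : uniq ps -> all (fun p => 2 < p)%N ps -> all prime ps ->
  (3 * 4 ^ size ps <= 4 * \prod_(p <- ps) p)%N.
Proof.
have no3 (s : seq nat) : 3 \notin s -> all (fun p => 2 < p)%N s -> all prime s ->
    (4 ^ size s <= \prod_(p <- s) p)%N.
  elim: s => [|p s IH]; first by rewrite big_nil.
  rewrite inE negb_or /= => /andP[p3 s3] /andP[p2 s2] /andP[prp prs].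
  rewrite big_cons expnS; apply: leq_mul; last exact: IH.
  by move: p3; lia.
elim: ps => [|p ps IH] /=; first by rewrite big_nil.
move=> /andP[pps ups] /andP[p2 ps2] /andP[prp prps]; rewrite big_cons expnS.
have [p3|p3] := eqVneq p 3%N.
  rewrite p3 in pps *; have := no3 _ pps ps2 prps; lia.
have p4 : (4 <= p)%N by move: p3; lia.
have := IH ups ps2 prps; set a := (4 ^ _)%N; set c := \prod_(_ <- _) _ => h.
have : (4 * c <= p * c)%N by rewrite leq_mul2r p4 orbT.
lia.
Qed.

Lemma four_pow_primes t : odd t -> (4 ^ size (primes t) <= 2 * t)%N.
Proof.
move=> ot; have t0 := odd_gt0 ot.
have h : (3 * 4 ^ size (primes t) <= 4 * \prod_(p <- primes t) p)%N.
  apply: four_pow_le; first exact: primes_uniq.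
    apply/allP => p; rewrite mem_primes => /and3P[prp _ pt].
    by apply: odd_prime_gt2 => //; apply: odd_dvdn pt ot.
  by apply/allP => p; rewrite mem_primes => /and3P[].
by have := dvdn_leq t0 (prod_primes_dvd t0); lia.
Qed.

Lemma class_range e r : odd e -> (0 < r < 8)%N -> (0 < (e * r) %% 8 < 8)%N.
Proof.
move=> oe /andP[r0 r8]; rewrite ltn_pmod // andbT lt0n; apply/negP => er0.
have /eqP := er0; rewrite -(mod0n 8) => /eqP; rewrite eqn_mod_dvd // subn0 Gauss_dvdr.
  by move=> /dvdn_leq -/(_ r0); lia.
by rewrite (_ : 8 = 2 ^ 3)%N // coprimeXl // coprime2n.
Qed.

Lemma class_sum_mul r Y q e : odd q -> odd e -> (0 < r < 8)%N ->
  \sum_(1 <= m < Y.+1 | (m %% 8 == r)%N) (e %| m)%:R * kronecker m q =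
  kronecker e q * class_sum ((e * r) %% 8)%N (Y %/ e)%N q.
Proof.
move=> oq oe /andP[r0 r8]; have e0 := odd_gt0 oe.
transitivity (\sum_(1 <= m < Y.+1 | (m %% 8 == r)%N && (m %% e == 0)%N) kronecker m q).
  rewrite [RHS]big_mkcondr /=; apply: eq_bigr => m _; rewrite /dvdn.
  by case: eqP; rewrite ?mul1r ?mul0r.
rewrite sum_progression //.
have -> : ((1 + (e - 1) - 0) %/ e = 1)%N by rewrite subn0 subnKC // divnn e0.
have -> : ((Y.+1 + (e - 1) - 0) %/ e = (Y %/ e).+1)%N.
  by rewrite subn0 (_ : Y.+1 + (e - 1) = Y + e)%N ?divnDr ?divnn ?e0 ?addn1 //; lia.
rewrite /class_sum mulr_sumr; apply: eq_big => j; first by rewrite add0n mul_class.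
by rewrite add0n kroneckerMl.
Qed.

Lemma class_sum_nonsquarefree r Y q t : odd q -> odd t -> (0 < r < 8)%N ->
  class_sum r Y (q * t ^ 2)%N = \sum_(e <- subprods (primes t))
     liou e * kronecker e q * class_sum ((e * r) %% 8)%N (Y %/ e)%N q.
Proof.
move=> oq ot rr; have t0 := odd_gt0 ot; have q0 := odd_gt0 oq.
transitivity (\sum_(1 <= m < Y.+1 | (m %% 8 == r)%N) (coprime m t)%:R * kronecker m q).
  apply: eq_bigr => m _; rewrite kroneckerM ?expn_gt0 ?t0 // -mulnn kroneckerM // -expr2.
  by rewrite kronecker_sqr // mulrC.
under eq_bigr do rewrite coprime_sieve // mulr_suml.
rewrite exchange_big /=; apply: eq_big_seq => e ei.
have oe : odd e.
  apply: odd_dvdn ot; apply: dvdn_trans (subprods_dvd ei) (prod_primes_dvd t0).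
rewrite -mulrA -class_sum_mul // mulr_sumr; apply: eq_bigr => m _.
by rewrite mulrA.
Qed.

(** The Cauchy-Schwarz majorant of the square of the sum at q t^2, after coprimality to t has been
    sieved into 2^omega(t) terms. *)
Definition sieved_square r Y t q : R :=
  (2 ^ size (primes t))%:R *
  \sum_(e <- subprods (primes t)) (class_sum ((e * r) %% 8)%N (Y %/ e)%N q ^+ 2)%:~R.

Lemma sieved_square_ge0 r Y t q : 0 <= sieved_square r Y t q.
Proof. by rewrite mulr_ge0 // sumr_ge0 // => e _; rewrite ler0z sqr_ge0. Qed.

Lemma class_sum_sqr_le r Y q t : odd q -> odd t -> (0 < r < 8)%N ->
  (class_sum r Y (q * t ^ 2)%N ^+ 2)%:~R <= sieved_square r Y t q.
Proof.
move=> oq ot rr; rewrite class_sum_nonsquarefree // rmorphXn /= rmorph_sum /=.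
apply: le_trans (sqr_sum_le _ _) _; rewrite size_subprods /sieved_square ler_wpM2l //.
apply: ler_sum => e _; rewrite -rmorphXn /= ler_int !exprMn liou_sqr mul1r.
by rewrite ler_piMl ?sqr_ge0 // kronecker_sqr ?odd_gt0 //; case: coprime.
Qed.

(** Each n is recovered from the pair (f n, g n), so on a fibre of f the map g is injective, and by
    positivity of H its image may be enlarged to a full interval. It serves both for the square part
    of n and for its power of 2. *)
Lemma sum_by_factor N (P : pred nat) (F : nat -> R) (H : nat -> nat -> R) (T : seq nat)
    (u f g : nat -> nat) : uniq T ->
  (forall n, P n -> (n <= N)%N -> [/\ (0 < n)%N, n = (g n * u (f n))%N & f n \in T]) ->
  (forall t q, 0 <= H t q) -> (forall n, P n -> F n <= H (f n) (g n)) ->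
  \sum_(0 <= n < N.+1 | P n) F n <=
  \sum_(t <- T | (u t <= N)%N) \sum_(0 <= q < (N %/ u t).+1) H t q.
Proof.
move=> uT fact H0 FH.
apply: (@le_trans _ _ (\sum_(0 <= n < N.+1 | P n) \sum_(t <- T | (u t <= N)%N)
    (f n == t)%:R * H t (g n))).
  rewrite big_nat_cond [X in _ <= X]big_nat_cond; apply: ler_sum => n /andP[/andP[_ nN] Pn].
  have [n0 nE fT] := fact n Pn nN.
  have uN : (u (f n) <= N)%N.
    rewrite -ltnS; apply: leq_ltn_trans nN; rewrite {2}nE leq_pmull //.
    by move: n0; rewrite {1}nE muln_gt0 => /andP[].
  rewrite big_mkcond (bigD1_seq (f n)) //= uN eqxx mul1r.
  rewrite -[X in X <= _]addr0 lerD ?FH // sumr_ge0 // => t _.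
  by case: ifP => // _; rewrite mulr_ge0.
rewrite exchange_big /=; apply: ler_sum => t t2.
rewrite (eq_bigr (fun n => if f n == t then H t (g n) else 0)); last first.
  by move=> n _; case: eqP; rewrite ?mul1r ?mul0r.
rewrite -big_mkcondr /= -big_filter -(big_map g xpredT (H t)).
apply: sum_sub_le => [||q]; last exact: H0.
  rewrite map_inj_in_uniq ?filter_uniq ?iota_uniq // => x y; rewrite !mem_filter !mem_index_iota /= !ltnS.
  move=> /andP[/andP[Px /eqP xt] xN] /andP[/andP[Py /eqP yt] yN] e.
  have [_ -> _] := fact x Px xN; have [_ -> _] := fact y Py yN.
  by rewrite e xt yt.
move=> q /mapP[n]; rewrite mem_filter mem_index_iota => /andP[/andP[Pn /eqP nt] /=].
rewrite ltnS => nN ->; have [n0 nE _] := fact n Pn nN.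
have ut : (0 < u t)%N by move: n0; rewrite {1}nE nt muln_gt0 => /andP[].
by rewrite mem_index_iota /= ltnS leq_divRL // -nt -nE.
Qed.

Lemma sum_by_sqpart N (P : pred nat) (F : nat -> R) (H : nat -> nat -> R) :
  (forall n, P n -> (0 < n)%N) ->
  (forall t q, 0 <= H t q) -> (forall n, P n -> F n <= H (sqpart n) (sqfpart n)) ->
  \sum_(0 <= n < N.+1 | P n) F n <=
  \sum_(1 <= t < N.+1 | (t ^ 2 <= N)%N) \sum_(0 <= q < (N %/ t ^ 2).+1) H t q.
Proof.
move=> P0 H0 FH.
apply: (@sum_by_factor N P F H (index_iota 1 N.+1) (fun t => t ^ 2)%N sqpart sqfpart) => //.
  exact: iota_uniq.
move=> n Pn nN; have n0 := P0 n Pn; split=> //; first exact: sqpartE.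
rewrite mem_index_iota sqpart_gt0 //= ltnS (leq_trans _ nN) //.
by apply: leq_trans (dvdn_leq n0 (sqpart_dvd n0)); rewrite expnS expn1 leq_pmulr // sqpart_gt0.
Qed.

(** Writing n = q t^2, the squarefree q exceeds 1 because n is not a square. The sieve over t loses
    2^omega(t) twice against N / t^2; since 4^omega(t) <= 2 t, the sum over t is harmonic and costs
    one logarithm. *)
Lemma class_sum_nonsquare_moduli N Y r : (0 < r < 8)%N ->
  (\sum_(0 <= n < N.+1 | odd n && ~~ is_square n) (class_sum r Y n ^+ 2)%:~R : R)
   <= 8 * class_const R * (N%:R * (minn N Y)%:R * lg R N ^+ 5).
Proof.
move=> rr; have l0 := lg_ge0 R N; have c0 := class_const_ge0 R.
pose H t q : R := if odd t && (odd q && sfree q) then sieved_square r Y t q else 0.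
have H0 t q : 0 <= H t q by rewrite /H; case: ifP => // _; exact: sieved_square_ge0.
apply: le_trans (sum_by_sqpart N (H := H) _ H0 _) _.
- by move=> n /andP[/odd_gt0].
- move=> n /andP[on nsq]; have n0 := odd_gt0 on; have nE := sqpartE n0.
  have sf := sqfpart_squarefree n0; have q0 := squarefree_gt0 sf.
  have [oq ot] : odd (sqfpart n) /\ odd (sqpart n).
    by move: on; rewrite {1}nE -mulnn !oddM => /andP[-> /andP[->]].
  have q1 : (1 < sqfpart n)%N.
    rewrite ltn_neqAle q0 andbT eq_sym; apply: contra nsq => /eqP e.
    by apply/is_squareP; exists (sqpart n); rewrite {1}nE e mul1n.
  by rewrite /H oq ot /sfree sf q1 /= {1}nE class_sum_sqr_le.
have B t : (0 < t)%N -> (t ^ 2 <= N)%N ->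
    \sum_(0 <= q < (N %/ t ^ 2).+1) H t q <=
      8 * class_const R * (N%:R * (minn N Y)%:R * lg R N ^+ 4) * t%:R^-1.
  move=> t0 tN; have t20 : (0 < t ^ 2)%N by rewrite expn_gt0 t0.
  have Nt : (0 < N %/ t ^ 2)%N by rewrite divn_gt0.
  have tR : (0 : R) < t%:R by rewrite ltr0n.
  have U : 0 <= class_const R * (N%:R * (minn N Y)%:R * lg R N ^+ 4).
    by rewrite mulr_ge0 // mulr_ge0 ?exprn_ge0 // mulr_ge0.
  have [ot|et] := boolP (odd t); last first.
    rewrite big1 => [|q _]; last by rewrite /H (negbTE et).
    by rewrite -mulrA !mulr_ge0 ?exprn_ge0 // invr_ge0.
  apply: (@le_trans _ _ ((2 ^ size (primes t))%:R * \sum_(e <- subprods (primes t))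
      \sum_(0 <= q < (N %/ t ^ 2).+1 | odd q && sfree q) (class_sum ((e * r) %% 8)%N (Y %/ e)%N q ^+ 2)%:~R)).
    rewrite exchange_big mulr_sumr /= [X in _ <= X]big_mkcond; apply: ler_sum => q _.
    by rewrite /H ot /=; case: ifP.
  apply: (@le_trans _ _ ((2 ^ size (primes t))%:R * \sum_(e <- subprods (primes t))
      4 * class_const R * (N%:R * (minn N Y)%:R * lg R N ^+ 4) / t%:R ^+ 2)).
    rewrite ler_wpM2l // big_seq [X in _ <= X]big_seq; apply: ler_sum => e ei.
    have oe : odd e by apply: odd_dvdn ot; apply: dvdn_trans (subprods_dvd ei) (prod_primes_dvd t0).
    apply: le_trans (class_sum_squarefree_moduli R _ Nt (class_range oe rr)) _.
    have h1 : (N %/ t ^ 2)%:R <= N%:R / t%:R ^+ 2 :> R.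
      by rewrite ler_pdivlMr ?exprn_gt0 // -natrX -natrM ler_nat leq_divM.
    have h2 : (minn (N %/ t ^ 2)%N (Y %/ e)%N)%:R <= (minn N Y)%:R :> R.
      rewrite ler_nat leq_min (leq_trans (geq_minl _ _)) ?leq_div //.
      by rewrite (leq_trans (geq_minr _ _)) // leq_div.
    have h3 : lg R (N %/ t ^ 2)%N ^+ 4 <= lg R N ^+ 4.
      by rewrite lerXn2r ?nnegrE ?lg_ge0 // lg_le // leq_div.
    have h4 : (N %/ t ^ 2)%:R * (minn (N %/ t ^ 2)%N (Y %/ e)%N)%:R * lg R (N %/ t ^ 2)%N ^+ 4 <=
        N%:R / t%:R ^+ 2 * (minn N Y)%:R * lg R N ^+ 4.
      exact: (ler_pM (mulr_ge0 (ler0n _ _) (ler0n _ _)) (exprn_ge0 _ (lg_ge0 _ _))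
        (ler_pM (ler0n _ _) (ler0n _ _) h1 h2) h3).
    apply: le_trans (ler_wpM2l (mulr_ge0 (ler0n _ 4) c0) h4) _.
    by apply: le_of_eq; ring.
  rewrite sum_const_seq size_subprods.
  have h4 : (2 ^ size (primes t))%:R * (2 ^ size (primes t))%:R <= 2 * t%:R :> R.
    by rewrite -natrM -expnMn -natrM ler_nat four_pow_primes.
  have W : 0 <= 4 * class_const R * (N%:R * (minn N Y)%:R * lg R N ^+ 4) / t%:R ^+ 2.
    by rewrite -[4 * _ * _]mulrA mulr_ge0 ?mulr_ge0 // invr_ge0 sqr_ge0.
  rewrite mulrCA; apply: le_trans (ler_wpM2l W h4) _.
  apply: le_of_eq; field.
  by rewrite gt_eqF.
apply: (@le_trans _ _ (\sum_(1 <= t < N.+1) 8 * class_const R * (N%:R * (minn N Y)%:R * lg R N ^+ 4) * t%:R^-1)).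
  rewrite big_mkcond big_nat_cond [X in _ <= X]big_nat_cond; apply: ler_sum => t /andP[/andP[t0 _] _].
  case: ifP => [|_]; first exact: B.
  by rewrite -[8 * _ * _]mulrA !mulr_ge0 ?exprn_ge0 // invr_ge0.
rewrite -mulr_sumr.
have V : 0 <= 8 * class_const R * (N%:R * (minn N Y)%:R * lg R N ^+ 4).
  by rewrite -mulrA !mulr_ge0 ?exprn_ge0.
apply: le_trans (ler_wpM2l V (harmonic_le R N)) _.
by apply: le_of_eq; ring.
Qed.

End NonsquareModuli.

Lemma sqrD_le (T : realDomainType) (x y : T) : (x + y) ^+ 2 <= 2 * x ^+ 2 + 2 * y ^+ 2.
Proof.
rewrite -subr_ge0 (_ : _ - _ = (x - y) ^+ 2) ?sqr_ge0 //; ring.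
Qed.

(** * Even n, for d in the class 1 modulo 4 *)

Section AllNonsquares.
Variable R : realType.

Lemma kronecker_mull d e n : kronecker (d * e) n = kronecker d n * kronecker e n.
Proof.
rewrite -[RHS]pmul_mul; apply: eq_pmul => p prp pn.
have [->|op] := even_prime prp; first exact: kronecker_prime2M.
exact: kronecker_primeM.
Qed.

Definition quarter_sum c Y n : int := \sum_(1 <= m < Y.+1 | (m %% 4 == c)%N) kronecker m n.

Lemma kronecker_pow2 m a : kronecker m (2 ^ a) = kronecker_prime m 2 ^+ a.
Proof.
elim: a => [|a IH]; first by rewrite kronecker1.
by rewrite expnS kroneckerM ?expn_gt0 // IH kronecker_prime_l // exprS.
Qed.

Lemma sum_quarter (V : nmodType) (F : nat -> V) c Y : (c < 4)%N ->
  \sum_(1 <= m < Y.+1 | (m %% 4 == c)%N) F m =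
  \sum_(1 <= m < Y.+1 | (m %% 8 == c)%N) F m + \sum_(1 <= m < Y.+1 | (m %% 8 == c + 4)%N) F m.
Proof.
move=> c4; rewrite (bigID (fun m => m %% 8 == c)%N) /=; congr (_ + _); apply: eq_bigl => m; lia.
Qed.

Lemma quarter_sum_odd c Y n : (c < 4)%N ->
  quarter_sum c Y n = class_sum c Y n + class_sum (c + 4) Y n.
Proof. exact: sum_quarter. Qed.

(** Among d = 1 mod 4, (d / 2) is 1 on the class 1 and -1 on the class 5 modulo 8. *)
Lemma quarter_sum_pow2 Y n a : (0 < n)%N ->
  quarter_sum 1 Y (n * 2 ^ a) = class_sum 1 Y n + (-1) ^+ a * class_sum 5 Y n.
Proof.
move=> n0; rewrite /quarter_sum sum_quarter // /class_sum mulr_sumr; congr (_ + _).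
  apply: eq_bigr => m /eqP m1; rewrite kroneckerM ?expn_gt0 // kronecker_pow2.
  have om : odd m by rewrite (divn_eq m 8) oddD oddM andbF m1.
  by rewrite kronecker_prime2 om m1 expr1n mulr1.
apply: eq_bigr => m /eqP m1; rewrite kroneckerM ?expn_gt0 // kronecker_pow2.
have om : odd m by rewrite (divn_eq m 8) oddD oddM andbF m1.
by rewrite kronecker_prime2 om m1 mulrC.
Qed.

Lemma class_sum_one r Y : (0 < r < 8)%N -> class_sum r Y 1 = ((Y + 8 - r) %/ 8)%N%:Z.
Proof.
move=> rr; rewrite class_sumE // /progression_sum.
under eq_bigr do rewrite kronecker1.
by rewrite sumr_const_nat subn0 natz.
Qed.

(* After sieving by the divisors e of t only the sizes of two residue classes mod 8 are compared. *)
Lemma class_sum_square_diff Y t : odd t ->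
  `|class_sum 1 Y (t ^ 2) - class_sum 5 Y (t ^ 2)| <= (2 ^ size (primes t))%:Z.
Proof.
move=> ot; rewrite -[(t ^ 2)%N]mul1n !class_sum_nonsquarefree // -sumrB.
apply: le_trans (ler_norm_sum _ _ _) _; rewrite -size_subprods.
apply: (@le_trans _ _ (\sum_(e <- subprods (primes t)) 1)); last first.
  by rewrite big_const_seq count_predT iter_addr_0 natz.
rewrite big_seq [X in _ <= X]big_seq; apply: ler_sum => e ei.
have oe : odd e.
  exact: odd_dvdn (dvdn_trans (subprods_dvd ei) (prod_primes_dvd (odd_gt0 ot))) ot.
rewrite kronecker1 !mulr1 -mulrBr normrM liou_norm mul1r muln1.
have r1 := class_range oe (isT : 0 < 1 < 8)%N; have r5 := class_range oe (isT : 0 < 5 < 8)%N.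
rewrite muln1 in r1; rewrite !class_sum_one //.
move: ((e * 5) %% 8)%N (e %% 8)%N (Y %/ e)%N r5 r1 => a b c; lia.
Qed.

(** Twice 32 and twice 2: the two classes modulo 8 give 2 * (8 + 8), the squares give 2, and the sum
    over powers of 2 doubles both. *)
Definition moment_const : R := 64 * class_const R + 4.

Lemma moment_const_ge0 : 0 <= moment_const.
Proof. by rewrite addr_ge0 // mulr_ge0 // class_const_ge0. Qed.

Lemma geometric_half K : \sum_(0 <= a < K) ((2 ^ a)%N%:R : R)^-1 <= 2.
Proof.
suff -> : \sum_(0 <= a < K) ((2 ^ a)%N%:R : R)^-1 = 2 - 2 / (2 ^ K)%:R by rewrite gerBl divr_ge0.
elim: K => [|K IH]; first by rewrite big_geq // divr1 subrr.
rewrite big_nat_recr //= IH expnS natrM.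
have : (2 ^ K)%:R != 0 :> R by rewrite pnatr_eq0 expn_eq0.
by move: (2 ^ K)%:R => x x0; field.
Qed.

Lemma square_sqpart n : (0 < n)%N -> is_square n -> n = (sqpart n ^ 2)%N.
Proof.
move=> n0 /is_squareP[k kE]; have k0 : (0 < k)%N by move: n0; rewrite kE expn_gt0 orbF.
have kn : (k < n.+1)%N by rewrite ltnS kE expnS expn1 leq_pmulr.
have kd : (k ^ 2 %| n)%N by rewrite kE.
have := @leq_bigmax_cond _ [pred t : 'I_n.+1 | (t ^ 2 %| n)%N] (fun t => nat_of_ord t) (Ordinal kn) kd.
rewrite -/(sqpart n) /= => ks; apply/eqP; rewrite eqn_leq; apply/andP; split.
  by rewrite {1}kE leq_exp2r.
by rewrite dvdn_leq // sqpart_dvd.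
Qed.

Lemma sum_square_sqpart M :
  \sum_(0 <= q < M.+1 | (0 < q)%N && is_square q) 2 * (sqpart q)%:R <= 2 * (M%:R * lg R M) :> R.
Proof.
pose H t q : R := if q == 1%N then 2 * t%:R else 0.
apply: le_trans (sum_by_sqpart M (H := H) _ _ _) _.
- by move=> n /andP[].
- by move=> t q; rewrite /H; case: ifP => // _; rewrite mulr_ge0.
- move=> n /andP[n0 /is_squareP[k kE]]; rewrite /H.
  suff -> : sqfpart n = 1%N by rewrite eqxx.
  have sq : is_square n by apply/is_squareP; exists k.
  by rewrite /sqfpart -{1}(square_sqpart n0 sq) divnn n0.
apply: (@le_trans _ _ (\sum_(1 <= t < M.+1) 2 * M%:R * t%:R^-1)).
  rewrite big_mkcond big_nat_cond [X in _ <= X]big_nat_cond; apply: ler_sum => t /andP[/andP[t0 _] _].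
  have tR : (0 : R) < t%:R by rewrite ltr0n.
  case: ifP => [tM|_]; last by rewrite mulr_ge0 ?invr_ge0 // mulr_ge0.
  apply: (@le_trans _ _ (2 * t%:R)).
    rewrite /H -big_mkcond /= big_nat_cond.
    have [e|e] := leqP 1 (M %/ t ^ 2).
      rewrite -big_nat_cond (big_nat_widen _ _ _ _ _ (leqnn _)) big_mkcond.
      rewrite (bigD1_seq 1%N) ?mem_index_iota ?iota_uniq //= big1 ?addr0 //.
        by rewrite ltnS e.
      by move=> i i1; rewrite (negbTE i1).
    rewrite -big_nat_cond big1_seq ?mulr_ge0 // => i /andP[/eqP ->].
    by rewrite mem_index_iota; lia.
  by rewrite -mulrA ler_wpM2l // ler_pdivlMr // -natrM ler_nat mulnn.
rewrite -mulr_sumr -mulrA ler_wpM2l // ler_wpM2l // harmonic_le //.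
Qed.

(** Let g be the odd part of n. A non-square g falls under the bound for odd moduli. If g = t^2,
    then the two classes modulo 8 enter with opposite signs, and the square of their difference is
    at most 4^omega(t) <= 2 t, which is small enough to be summed over the squares. *)
Lemma quarter_sum_all_moduli N Y :
  (\sum_(0 <= n < N.+1 | (0 < n)%N && ~~ is_square n) (quarter_sum 1 Y n ^+ 2)%:~R : R)
   <= moment_const * (N%:R * (minn N Y)%:R * lg R N ^+ 5).
Proof.
have l1 := lg_ge1 R N; have l0 := lg_ge0 R N; have c0 := class_const_ge0 R.
have K0 : 0 <= N%:R * (minn N Y)%:R * lg R N ^+ 5 by rewrite mulr_ge0 ?exprn_ge0 // mulr_ge0.
(* The contribution of square odd parts carries no factor Y; for Y > 0 it is absorbed because min(N,
   Y) is at least 1. *)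
have [Y0|Y0] := posnP Y.
  rewrite big1 ?mulr_ge0 ?moment_const_ge0 // => n _.
  by rewrite /quarter_sum Y0 big_geq // expr0n.
pose H1 q : R := if odd q && ~~ is_square q then
  2 * (class_sum 1 Y q ^+ 2)%:~R + 2 * (class_sum 5 Y q ^+ 2)%:~R else 0.
pose H2 q : R := if (0 < q)%N && is_square q then 2 * (sqpart q)%:R else 0.
have H10 q : 0 <= H1 q by rewrite /H1; case: ifP => // _; rewrite addr_ge0 // mulr_ge0 // ler0z sqr_ge0.
have H20 q : 0 <= H2 q by rewrite /H2; case: ifP => // _; rewrite mulr_ge0.
pose f n := logn 2 n; pose g n := (n %/ 2 ^ logn 2 n)%N.
have nE n : n = (g n * 2 ^ f n)%N by rewrite /g /f divnK // pfactor_dvdnn.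
have og n : (0 < n)%N -> odd (g n).
  move=> n0; have [m cm mE] := pfactor_coprime (isT : prime 2) n0.
  by rewrite /g {1}mE mulnK ?expn_gt0 // -coprime2n.
apply: le_trans (@sum_by_factor R N _ _ (fun _ q => H1 q + H2 q) (index_iota 0 N.+1) (fun a => 2 ^ a)%N f g _ _ _ _) _.
- exact: iota_uniq.
- move=> n /andP[n0 _] nN; split=> //; rewrite mem_index_iota /= ltnS (leq_trans _ nN) //.
  by apply: leq_trans (ltnW (ltn_expl (f n) (isT : 1 < 2)%N)) _; rewrite dvdn_leq // pfactor_dvdnn.
- by move=> t q; rewrite addr_ge0.
- move=> n /andP[n0 nsq]; have o := og n n0; have g0 := odd_gt0 o.
  rewrite {1}[n]nE quarter_sum_pow2 //.
  have [sq|gnsq] := boolP (is_square (g n)); last first.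
    rewrite -[X in X <= _]addr0 lerD // /H1 o gnsq /=.
    rewrite -!(intrM _ 2) -intrD ler_int.
    have := sqrD_le (class_sum 1 Y (g n)) ((-1) ^+ f n * class_sum 5 Y (g n)).
    by rewrite [(_ * class_sum 5 _ _) ^+ 2]exprMn sign_sqr mul1r.
  (* With a square odd part, an even power of 2 would make n a square. *)
  have of_ : odd (f n).
    apply: contraNT nsq => ef; have [k kE] := is_squareP _ sq.
    apply/is_squareP; exists (k * 2 ^ (f n)./2)%N.
    by rewrite {1}[n]nE kE expnMn -expnM muln2 -{1}(odd_double_half (f n)) (negbTE ef).
  rewrite -signr_odd of_ expr1 mulN1r -[X in X <= _]add0r lerD //.
  have gE : g n = (sqpart (g n) ^ 2)%N.
    exact: square_sqpart.
  rewrite /H2 g0 sq /=; set t := sqpart (g n) in gE *.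
  have ot : odd t by move: o; rewrite gE -mulnn oddM => /andP[].
  rewrite gE; have D := class_sum_square_diff Y ot.
  apply: (@le_trans _ _ ((4 ^ size (primes t))%N%:R)); last first.
    by rewrite -natrM ler_nat four_pow_primes.
  rewrite (_ : 4 = 2 * 2)%N // expnMn -[(_ * _)%N%:R]mulrz_nat ler_int -real_normK ?num_real // natrM -expr2.
  by rewrite lerXn2r ?nnegrE ?normr_ge0 // natz.
have B a : (2 ^ a <= N)%N -> \sum_(0 <= q < (N %/ 2 ^ a).+1) (H1 q + H2 q) <=
    (32 * class_const R + 2) * (N%:R * (minn N Y)%:R * lg R N ^+ 5) * ((2 ^ a)%N%:R)^-1.
  move=> aN; set M := (N %/ 2 ^ a)%N.
  have tR : (0 : R) < (2 ^ a)%N%:R by rewrite ltr0n expn_gt0.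
  have M0 : (0 < M)%N by rewrite divn_gt0 ?expn_gt0.
  have h1 : M%:R <= N%:R / (2 ^ a)%N%:R :> R by rewrite ler_pdivlMr // -natrM ler_nat leq_divM.
  have MN : (M <= N)%N by rewrite leq_div.
  have h2 : (minn M Y)%:R <= (minn N Y)%:R :> R by rewrite ler_nat leq_min geq_minr (leq_trans (geq_minl _ _)).
  have h3 : lg R M ^+ 5 <= lg R N ^+ 5 by rewrite lerXn2r ?nnegrE ?lg_ge0 // lg_le.
  have h4 : M%:R * (minn M Y)%:R * lg R M ^+ 5 <= N%:R / (2 ^ a)%N%:R * (minn N Y)%:R * lg R N ^+ 5.
    exact: (ler_pM (mulr_ge0 (ler0n _ _) (ler0n _ _)) (exprn_ge0 _ (lg_ge0 _ _))
        (ler_pM (ler0n _ _) (ler0n _ _) h1 h2) h3).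
  rewrite big_split /= [X in X + _](_ : _ = 2 * \sum_(0 <= q < M.+1 | odd q && ~~ is_square q) (class_sum 1 Y q ^+ 2)%:~R
     + 2 * \sum_(0 <= q < M.+1 | odd q && ~~ is_square q) (class_sum 5 Y q ^+ 2)%:~R); last first.
    by rewrite -big_mkcond big_split /= -!mulr_sumr.
  rewrite -big_mkcond.
  have b1 := class_sum_nonsquare_moduli R M Y (isT : 0 < 1 < 8)%N.
  have b5 := class_sum_nonsquare_moduli R M Y (isT : 0 < 5 < 8)%N.
  have b2 := sum_square_sqpart M.
  have h5 : M%:R * lg R M <= N%:R / (2 ^ a)%N%:R * (minn N Y)%:R * lg R N ^+ 5.
    apply: le_trans h4; apply: ler_pM; rewrite ?lg_ge0 //.
      by rewrite ler_peMr // ler1n leq_min M0.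
    by rewrite exprS ler_peMr ?lg_ge0 // exprn_ege1 // lg_ge1.
  have e : (32 * class_const R + 2) * (N%:R * (minn N Y)%:R * lg R N ^+ 5) * ((2 ^ a)%N%:R)^-1 =
    32 * (class_const R * (N%:R / (2 ^ a)%N%:R * (minn N Y)%:R * lg R N ^+ 5)) + 2 * (N%:R / (2 ^ a)%N%:R * (minn N Y)%:R * lg R N ^+ 5).
    by ring.
  rewrite e.
  have h6 := ler_wpM2l c0 h4.
  move: b1 b5 b2 h5 h6; set K := N%:R / _ * _ * _; set K' := M%:R * _ * _; set cc := class_const R.
  set s1 := \sum_(_ <= _ < _ | _) _; set s5 := \sum_(_ <= _ < _ | _) _; set s2 := \sum_(_ <= _ < _ | _) _.
  lra.
apply: (@le_trans _ _ (\sum_(0 <= a < N.+1) (32 * class_const R + 2) * (N%:R * (minn N Y)%:R * lg R N ^+ 5) * ((2 ^ a)%N%:R)^-1)).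
  rewrite big_mkcond; apply: ler_sum => a _; case: ifP => [|_]; first exact: B.
  by rewrite mulr_ge0 ?invr_ge0 // mulr_ge0 // addr_ge0 // mulr_ge0.
rewrite -mulr_sumr.
have V : 0 <= (32 * class_const R + 2) * (N%:R * (minn N Y)%:R * lg R N ^+ 5).
  by rewrite mulr_ge0 // addr_ge0 // mulr_ge0.
apply: le_trans (ler_wpM2l V (geometric_half _)) _.
by apply: le_of_eq; rewrite /moment_const; ring.
Qed.

Lemma quarter_sum_odd_moduli N Y c : (0 < c < 4)%N ->
  (\sum_(0 <= n < N.+1 | odd n && ~~ is_square n) (quarter_sum c Y n ^+ 2)%:~R : R)
   <= moment_const * (N%:R * (minn N Y)%:R * lg R N ^+ 5).
Proof.
move=> /andP[c0 c4].
have K0 : 0 <= N%:R * (minn N Y)%:R * lg R N ^+ 5 by rewrite mulr_ge0 ?exprn_ge0 ?lg_ge0 // mulr_ge0.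
have r1 : (0 < c < 8)%N by lia. have r2 : (0 < c + 4 < 8)%N by lia.
have b1 := class_sum_nonsquare_moduli R N Y r1; have b2 := class_sum_nonsquare_moduli R N Y r2.
apply: (@le_trans _ _ (2 * \sum_(0 <= n < N.+1 | odd n && ~~ is_square n) (class_sum c Y n ^+ 2)%:~R +
   2 * \sum_(0 <= n < N.+1 | odd n && ~~ is_square n) (class_sum (c + 4) Y n ^+ 2)%:~R)).
  rewrite !mulr_sumr -big_split; apply: ler_sum => n _ /=.
  rewrite quarter_sum_odd // -!(intrM _ 2) -intrD ler_int.
  exact: sqrD_le.
have := mulr_ge0 (class_const_ge0 R) K0; move: b1 b2; rewrite /moment_const.
set K := N%:R * _ * _ in K0 *; set cc := class_const R.
set s1 := \sum_(_ <= _ < _ | _) _; set s2 := \sum_(_ <= _ < _ | _) _; lra.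
Qed.

End AllNonsquares.

(** * Fundamental discriminants *)

Section SquarefreeSieve.
Variable R : realType.

Definition squarefree_quarter_sum c X n : int :=
  \sum_(1 <= d < X.+1 | (d %% 4 == c)%N && squarefree d) kronecker d n.

(** As c is not 0, no d in the class is divisible by 4 and the sieve by odd k applies; k^2 = 1 mod 4
    keeps d / k^2 in the class c. *)
Lemma squarefree_quarter_sumE c X n : (0 < c < 4)%N -> squarefree_quarter_sum c X n =
  \sum_(k <- subprods (odd_primes X)) liou k * (kronecker k n ^+ 2 * quarter_sum c (X %/ k ^ 2)%N n).
Proof.
move=> /andP[c0 c4].
transitivity (\sum_(1 <= d < X.+1 | (d %% 4 == c)%N) (squarefree d)%:R * kronecker d n).
  rewrite /squarefree_quarter_sum big_mkcondr /=; apply: eq_bigr => d _.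
  by case: squarefree; rewrite ?mul1r ?mul0r.
transitivity (\sum_(1 <= d < X.+1 | (d %% 4 == c)%N) \sum_(k <- subprods (odd_primes X))
    liou k * ((k ^ 2 %| d)%N%:R * kronecker d n)).
  rewrite big_nat_cond [RHS]big_nat_cond; apply: eq_bigr => d /andP[/andP[d0 dX] /eqP dc].
  rewrite (@squarefree_sieve X) ?d0 //; last by rewrite /dvdn dc -lt0n.
  by rewrite mulr_suml; apply: eq_bigr => k _; rewrite mulrA.
rewrite exchange_big /=; apply: eq_big_seq => k ki; rewrite -mulr_sumr; congr (_ * _).
have ok := subprods_odd ki; have k0 := odd_gt0 ok; have k20 : (0 < k ^ 2)%N by rewrite expn_gt0 k0.
transitivity (\sum_(1 <= d < X.+1 | (d %% 4 == c)%N && (d %% k ^ 2 == 0)%N) kronecker d n).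
  rewrite [RHS]big_mkcondr /=; apply: eq_bigr => d _; rewrite /dvdn.
  by case: eqP; rewrite ?mul1r ?mul0r.
rewrite sum_progression //.
have -> : ((1 + (k ^ 2 - 1) - 0) %/ k ^ 2 = 1)%N by rewrite subn0 subnKC // divnn k20.
have -> : ((X.+1 + (k ^ 2 - 1) - 0) %/ k ^ 2 = (X %/ k ^ 2).+1)%N.
  by rewrite subn0 (_ : X.+1 + (k ^ 2 - 1) = X + k ^ 2)%N ?divnDr ?divnn ?k20 ?addn1 //; lia.
rewrite /quarter_sum mulr_sumr; apply: eq_big => j; last first.
  by rewrite add0n -mulnn -mulnA (kronecker_mull k) (kronecker_mull k) expr2 mulrA.
rewrite add0n; have k2 : (k ^ 2 = 1 %[mod 4])%N.
  rewrite -modnXm; have : odd (k %% 4) by move: ok; rewrite {1}(divn_eq k 4) oddD oddM andbF.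
  by have := ltn_pmod k (isT : 0 < 4)%N; case: (k %% 4)%N => [|[|[|[|?]]]].
by rewrite -modnMml k2 modnMml mul1n.
Qed.

(** The block from a i to a (i + 1) has a terms, each at most 1 / (a i). The bound therefore depends
    on the ratio M of the end points and not on their size. *)
Lemma block_harmonic_le a M : (0 < a)%N -> (0 < M)%N ->
  \sum_(a <= k < a * M) (k%:R : R)^-1 <= \sum_(1 <= i < M) (i%:R : R)^-1.
Proof.
move=> a0; elim: M => // M IH _; have [->|M0] := posnP M; first by rewrite muln1 !big_geq.
rewrite big_nat_recr //= mulnS addnC (big_cat_nat _ (n := (a * M)%N)) ?leq_addr ?leq_pmulr //=.
apply: lerD; first exact: IH.
have aR : (0 : R) < a%:R by rewrite ltr0n. have MR : (0 : R) < M%:R by rewrite ltr0n.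
apply: (@le_trans _ _ (\sum_(a * M <= k < a * M + a) ((a * M)%N%:R : R)^-1)).
  rewrite big_nat_cond [X in _ <= X]big_nat_cond; apply: ler_sum => k /andP[/andP[k1 _] _].
  have aM : (0 < a * M)%N by rewrite muln_gt0 a0.
  by rewrite lef_pV2 ?posrE ?ltr0n ?ler_nat // (leq_trans aM).
rewrite sumr_const_nat addKn -[X in X <= _]mulr_natr natrM le_eqVlt; apply/orP; left; apply/eqP.
by field; rewrite !gt_eqF.
Qed.

Lemma scale_exists N X : (0 < N)%N -> exists a, (a ^ 2 * N <= X)%N /\ (X < a.+1 ^ 2 * N)%N.
Proof.
move=> N0; have ex : exists a, (X < a.+1 ^ 2 * N)%N.
  by exists X; rewrite (leq_trans (_ : _ <= X.+1)%N) // (leq_trans _ (leq_pmulr _ N0)) // -mulnn leq_pmulr.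
case: (ex_minnP ex) => a Xa amin; exists a; split=> //.
case: a amin {Xa} => [|a] amin; first by rewrite exp0n.
by rewrite leqNgt; apply/negP => /amin; rewrite ltnn.
Qed.

(* With a ~ sqrt (X / N), the Cauchy-Schwarz weight 1 / max (k, a) keeps the loss at log N rather
   than log X. *)
Definition sieve_weight a k : R := ((maxn k a)%:R)^-1.

Lemma sieve_weight_gt0 a k : (0 < k)%N -> 0 < sieve_weight a k.
Proof. by move=> k0; rewrite invr_gt0 ltr0n leq_max k0. Qed.

(** The k up to a have weight 1 / a and contribute at most 1; the larger ones give a harmonic sum
    whose end points have ratio at most 2 N. *)
Lemma sieve_weight_sum a N X : (0 < N)%N -> (X < a.+1 ^ 2 * N)%N ->
  \sum_(1 <= k < X.+1 | (k ^ 2 <= X)%N) sieve_weight a k <= (1 + lg R 2) * lg R N.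
Proof.
move=> N0 Xa; have l1 := lg_ge1 R N; have l2 := lg_ge1 R 2.
rewrite (bigID (fun k => k <= a)%N) /=.
have A : \sum_(1 <= k < X.+1 | (k ^ 2 <= X)%N && (k <= a)%N) sieve_weight a k <= 1.
  apply: (@le_trans _ _ (\sum_(1 <= k < a.+1) (a%:R)^-1)).
    rewrite -big_filter.
    apply: (@le_trans _ _ (\sum_(k <- [seq k <- index_iota 1 X.+1 | (k ^ 2 <= X)%N && (k <= a)%N]) (a%:R : R)^-1)).
      rewrite big_seq [X in _ <= X]big_seq; apply: ler_sum => k; rewrite mem_filter => /andP[/andP[_ ka] _].
      by rewrite /sieve_weight (maxn_idPr ka).
    apply: sum_sub_le => [|k|k]; rewrite ?filter_uniq ?iota_uniq ?invr_ge0 //.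
    by rewrite mem_filter !mem_index_iota !ltnS => /andP[/andP[_ ->] /andP[-> _]].
  rewrite sumr_const_nat subn1 /= -[X in X <= _]mulr_natr.
  case: (posnP a) => [->|a0]; first by rewrite mulr0.
  by rewrite mulVf // pnatr_eq0 -lt0n.
have B : \sum_(1 <= k < X.+1 | (k ^ 2 <= X)%N && ~~ (k <= a)%N) sieve_weight a k <= lg R (2 * N).
  pose s := [seq k <- index_iota 1 X.+1 | (k ^ 2 <= X)%N && ~~ (k <= a)%N].
  apply: (@le_trans _ _ (\sum_(k <- s) (k%:R : R)^-1)).
    rewrite -big_filter big_seq [X in _ <= X]big_seq; apply: ler_sum => k.
    rewrite mem_filter -ltnNge => /andP[/andP[_ ka] _].
    by rewrite /sieve_weight (maxn_idPl (ltnW ka)).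
  have us : uniq s by rewrite filter_uniq // iota_uniq.
  case: (posnP a) => [a0|a0].
    apply: le_trans (le_trans (harmonic_le R N) (lg_le R (leq_pmull N (isT : 0 < 2)%N))).
    apply: sum_sub_le => // k.
    rewrite mem_filter !mem_index_iota => /andP[/andP[kX _] /andP[k0 _]]; rewrite k0 /= ltnS.
    rewrite a0 exp1n mul1n in Xa; apply: ltnW; apply: leq_ltn_trans Xa.
    by apply: leq_trans kX; rewrite -mulnn leq_pmulr.
  (* From k^2 <= X < (a + 1)^2 N and a >= 1 follows k < 2 a N. *)
  apply: (@le_trans _ _ (\sum_(a <= k < a * (2 * N)) (k%:R : R)^-1)).
    apply: sum_sub_le => // k.
    rewrite mem_filter !mem_index_iota -ltnNge => /andP[/andP[kX ka] _]; rewrite (ltnW ka) /=.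
    rewrite -(ltn_exp2r _ _ (isT : 0 < 2)%N) (leq_ltn_trans kX) // (leq_trans Xa) //.
    rewrite !expnMn mulnA [(N ^ 2)%N]expnS expn1 mulnA leq_mul2r; apply/orP; right.
    apply: leq_trans (leq_pmulr _ N0); rewrite mulnC -expnMn leq_exp2r //; lia.
  apply: le_trans (block_harmonic_le a0 _) _; first by rewrite muln_gt0.
  apply: le_trans (harmonic_le R _); rewrite [X in _ <= X]big_nat_recr ?muln_gt0 //= lerDl.
  by rewrite invr_ge0.
have C := lgM R 2 N; have : 1 <= lg R 2 * lg R N by rewrite mulr_ege1.
move: A B C; set s1 := \sum_(_ <= _ < _ | _) _; set s2 := \sum_(_ <= _ < _ | _) _; lra.
Qed.

Lemma weighted_cauchy (I : eqType) (s : seq I) (w x : I -> R) : (forall i, i \in s -> 0 < w i) ->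
  (\sum_(i <- s) x i) ^+ 2 <= (\sum_(i <- s) w i) * \sum_(i <- s) x i ^+ 2 / w i.
Proof.
elim: s => [|i s IH] w0; first by rewrite !big_nil mulr0 expr0n.
rewrite !big_cons; have wi := w0 i (mem_head _ _).
have ws j : j \in s -> 0 < w j by move=> js; apply: w0; rewrite inE js orbT.
have := IH ws; set A := \sum_(j <- s) x j; set W := \sum_(j <- s) w j; set B := \sum_(j <- s) _.
have W0 : 0 <= W by rewrite /W big_seq sumr_ge0 // => j /ws /ltW.
have B0 : 0 <= B by rewrite /B big_seq sumr_ge0 // => j /ws /ltW wj; rewrite divr_ge0 // sqr_ge0.
have xi : x i ^+ 2 = w i * (x i ^+ 2 / w i) by rewrite mulrCA divff ?mulr1 // gt_eqF.
move: xi; set X := x i ^+ 2 / w i => xi AWB.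
have X0 : 0 <= X by rewrite divr_ge0 ?sqr_ge0 // ltW.
suff : 2 * (x i * A) <= w i * B + W * X by move=> h; nra.
have h0 : 0 <= w i * B + W * X by rewrite addr_ge0 // mulr_ge0 // ltW.
apply: le_trans (ler_norm _) _; rewrite -(ger0_norm h0) -ler_sqr ?nnegrE ?normr_ge0 //.
rewrite !real_normK ?num_real // exprMn exprMn xi.
have h1 : 4 * (w i * X * A ^+ 2) <= 4 * (w i * X * (W * B)).
  by rewrite ler_wpM2l // ler_wpM2l // mulr_ge0 // ltW.
have h2 := sqr_ge0 (w i * B - W * X).
have -> : 2 ^+ 2 = 4 :> R by ring.
apply: le_trans h1 _; rewrite -subr_ge0.
by rewrite (_ : _ - _ = (w i * B - W * X) ^+ 2) //; ring.
Qed.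

(** The minimum is bounded by X / k^2 for k >= a, and by N <= X / a^2 for k < a. *)
Lemma sieve_weight_min a N X k : (0 < k)%N -> (a ^ 2 * N <= X)%N ->
  (N%:R * (minn N (X %/ k ^ 2))%:R : R) <= N%:R * X%:R * sieve_weight a k ^+ 2.
Proof.
move=> k0 aX; rewrite -mulrA ler_wpM2l // /sieve_weight exprVn.
have m0 : (0 < maxn k a)%N by rewrite leq_max k0.
rewrite ler_pdivlMr ?exprn_gt0 ?ltr0n // -natrX -natrM ler_nat.
case: (leqP a k) => [ak|ka].
  by apply: leq_trans (leq_divM X (k ^ 2)); rewrite leq_mul2r geq_minr orbT.
by apply: leq_trans aX; rewrite mulnC leq_mul2l geq_minl orbT.
Qed.

(** Cauchy-Schwarz divides the k-th moment by the weight w_k; as that moment is at most a multiple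
    of N X w_k^2, the total is N X times the square of the sum of the weights, which adds 2 to the
    exponent 5. The set Q is left general because the class 1 is used for all n, the classes 2 and 3
    for odd n only. *)
Lemma squarefree_second_moment N X c (Q : pred nat) (D : R) : (0 < N)%N -> (0 < c < 4)%N -> 0 <= D ->
  (forall n, Q n -> (0 < n)%N) ->
  (forall Y, \sum_(0 <= n < N.+1 | Q n) (quarter_sum c Y n ^+ 2)%:~R <=
     D * (N%:R * (minn N Y)%:R * lg R N ^+ 5)) ->
  \sum_(0 <= n < N.+1 | Q n) (squarefree_quarter_sum c X n ^+ 2)%:~R <=
     D * (1 + lg R 2) ^+ 2 * (N%:R * X%:R * lg R N ^+ 7).
Proof.
move=> N0 cc D0 Q0 HD; have [a [aX Xa]] := scale_exists X N0.
have l0 := lg_ge0 R N.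
pose s := [seq k <- subprods (odd_primes X) | (k ^ 2 <= X)%N].
have s0 k : k \in s -> (0 < k)%N.
  by rewrite mem_filter => /andP[_ /subprods_odd /odd_gt0].
have us : uniq s by rewrite filter_uniq // uniq_subprods ?odd_primes_uniq ?odd_primes_prime.
set W := \sum_(k <- s) sieve_weight a k.
have WB : W <= (1 + lg R 2) * lg R N.
  apply: le_trans (sieve_weight_sum N0 Xa); rewrite -[X in _ <= X]big_filter.
  apply: sum_sub_le => // [k|k]; last by rewrite invr_ge0.
  rewrite !mem_filter mem_index_iota ltnS => /andP[kX ki]; rewrite kX /=.
  have k0 := odd_gt0 (subprods_odd ki); rewrite k0 /=.
  by apply: leq_trans kX; rewrite -mulnn leq_pmulr.
have W0 : 0 <= W by apply: sumr_ge0 => i _; rewrite invr_ge0.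
pose v k n : R := (quarter_sum c (X %/ k ^ 2)%N n)%:~R.
have pt n : Q n -> (squarefree_quarter_sum c X n ^+ 2)%:~R <=
    W * \sum_(k <- s) v k n ^+ 2 / sieve_weight a k.
  move=> Qn; have n0 := Q0 n Qn.
  have -> : squarefree_quarter_sum c X n =
      \sum_(k <- s) liou k * (kronecker k n ^+ 2 * quarter_sum c (X %/ k ^ 2)%N n).
    rewrite squarefree_quarter_sumE // big_filter [RHS]big_mkcond; apply: eq_bigr => i _.
    case: leqP => // kX; rewrite divn_small // /quarter_sum big_geq // !mulr0 //.
  rewrite rmorphXn rmorph_sum /=.
  apply: le_trans (weighted_cauchy (w := sieve_weight a) _ _) _.
    by move=> k /s0; exact: sieve_weight_gt0.
  rewrite ler_wpM2l // big_seq [X in _ <= X]big_seq; apply: ler_sum => k /s0 k0.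
  rewrite ler_wpM2r ?invr_ge0 ?(ltW (sieve_weight_gt0 a k0)) //.
  rewrite /v -!rmorphXn /= ler_int exprMn liou_sqr mul1r exprMn ler_piMl ?sqr_ge0 //.
  by rewrite kronecker_sqr // expr_le1 //; case: coprime.
apply: (@le_trans _ _ (\sum_(0 <= n < N.+1 | Q n) W * \sum_(k <- s) v k n ^+ 2 / sieve_weight a k)).
  exact: ler_sum.
rewrite -mulr_sumr exchange_big /=.
have Z : 0 <= D * (N%:R * X%:R * lg R N ^+ 5).
  by rewrite mulr_ge0 // mulr_ge0 ?exprn_ge0 // mulr_ge0.
apply: (@le_trans _ _ (W * (D * (N%:R * X%:R * lg R N ^+ 5) * W))).
  rewrite ler_wpM2l // mulr_sumr big_seq [X in _ <= X]big_seq; apply: ler_sum => k /s0 k0.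
  have wk := sieve_weight_gt0 a k0; rewrite -mulr_suml ler_pdivrMr //.
  have h : \sum_(0 <= n < N.+1 | Q n) v k n ^+ 2 <= D * (N%:R * (minn N (X %/ k ^ 2))%:R * lg R N ^+ 5).
    by apply: le_trans (HD (X %/ k ^ 2)%N); apply: ler_sum => n _; rewrite /v -rmorphXn.
  apply: le_trans h _.
  have -> : D * (N%:R * X%:R * lg R N ^+ 5) * sieve_weight a k * sieve_weight a k =
      D * (N%:R * X%:R * sieve_weight a k ^+ 2 * lg R N ^+ 5) by ring.
  apply: (ler_wpM2l D0); apply: ler_wpM2r; first exact: exprn_ge0.
  exact: sieve_weight_min.
have W2 : W ^+ 2 <= ((1 + lg R 2) * lg R N) ^+ 2 by rewrite lerXn2r ?nnegrE // (le_trans W0).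
rewrite mulrCA -expr2; apply: le_trans (ler_wpM2l Z W2) _.
by apply: le_of_eq; ring.
Qed.

Definition disc_total X n : int := \sum_(1 <= d < X.+1 | even_fund_disc d) kronecker d n.

(** (4 / n) is the indicator of odd n, so discriminants divisible by 4 matter for odd n only, and
    even n have to be handled for the class 1 modulo 4 alone. *)
Lemma disc_totalE X n : (0 < n)%N -> disc_total X n = squarefree_quarter_sum 1 X n +
  (odd n)%:R * (squarefree_quarter_sum 2 (X %/ 4)%N n + squarefree_quarter_sum 3 (X %/ 4)%N n).
Proof.
move=> n0.
have -> : disc_total X n = squarefree_quarter_sum 1 X n +
   \sum_(1 <= d < X.+1 | ((d %/ 4) %% 4 \in [:: 2; 3])%N && squarefree (d %/ 4) && (d %% 4 == 0)%N) kronecker d n.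
  rewrite /disc_total (bigID (fun d => d %% 4 == 1)%N) /=; congr (_ + _).
    rewrite /squarefree_quarter_sum big_nat_cond [RHS]big_nat_cond; apply: eq_bigl => d.
    rewrite /even_fund_disc; case: (boolP (d %% 4 == 1)%N) => [d1|]; last by rewrite !andbF.
    have -> : (4 %| d)%N = false by rewrite /dvdn (eqP d1).
    by rewrite /= orbF andbT; case: d {d1} => [|d] //=.
  rewrite big_nat_cond [RHS]big_nat_cond; apply: eq_bigl => d.
  rewrite /even_fund_disc /dvdn; case: (boolP (d %% 4 == 0)%N) => d4.
    by rewrite (eqP d4) /= !andbT; case: d {d4}.
  rewrite /= orbF andbF; case: (d %% 4 == 1)%N; rewrite ?andbF //=.
rewrite sum_progression //.
have -> : ((X.+1 + (4 - 1) - 0) %/ 4 = (X %/ 4).+1)%N by lia.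
congr (_ + _).
have k4 : kronecker 4 n = (odd n)%:R.
  by rewrite -[4%N]/(2 * 2)%N kronecker_mull -expr2 kronecker_sqr // coprime2n.
have -> : ((1 + (4 - 1) - 0) %/ 4 = 1)%N by [].
transitivity ((odd n)%:R * \sum_(1 <= j < (X %/ 4).+1 | (j %% 4 \in [:: 2; 3])%N && squarefree j) kronecker j n).
  rewrite mulr_sumr; apply: eq_big => j; rewrite add0n; first by rewrite mulKn.
  by rewrite kronecker_mull k4.
congr (_ * _); rewrite (bigID (fun j => j %% 4 == 2)%N) /= /squarefree_quarter_sum.
by congr (_ + _); apply: eq_bigl => j; rewrite !inE; case: squarefree; rewrite ?andbF ?andbT //; lia.
Qed.

Lemma sum3_sqr_le (x y z : R) : (x + (y + z)) ^+ 2 <= 3 * x ^+ 2 + 3 * y ^+ 2 + 3 * z ^+ 2.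
Proof. have := sqr_ge0 (x - y); have := sqr_ge0 (y - z); have := sqr_ge0 (x - z); nra. Qed.

Definition mean_const : R := 9 * (moment_const R * (1 + lg R 2) ^+ 2).

Lemma mean_const_ge0 : 0 <= mean_const.
Proof. by rewrite mulr_ge0 // mulr_ge0 ?sqr_ge0 // moment_const_ge0. Qed.

Lemma disc_total_second_moment N X :
  \sum_(0 <= n < N.+1 | (0 < n)%N && ~~ is_square n) (disc_total X n ^+ 2)%:~R
    <= mean_const * (N%:R * X%:R * lg R N ^+ 7) :> R.
Proof.
have m0 := moment_const_ge0 R; have l0 := lg_ge0 R N.
have [->|N0] := posnP N.
  by rewrite big_mkcond big_nat1 /= !mul0r mulr0.
set B := moment_const R * (1 + lg R 2) ^+ 2.
have B0 : 0 <= B by rewrite mulr_ge0 // sqr_ge0.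
have s1 : \sum_(0 <= n < N.+1 | (0 < n)%N && ~~ is_square n) (squarefree_quarter_sum 1 X n ^+ 2)%:~R <=
    B * (N%:R * X%:R * lg R N ^+ 7).
  apply: squarefree_second_moment => // [n /andP[]//|Y]; exact: quarter_sum_all_moduli.
have s23 c : (0 < c < 4)%N ->
  \sum_(0 <= n < N.+1 | odd n && ~~ is_square n) (squarefree_quarter_sum c (X %/ 4)%N n ^+ 2)%:~R <=
    B * (N%:R * X%:R * lg R N ^+ 7).
  move=> cc; apply: (@le_trans _ _ (B * (N%:R * (X %/ 4)%N%:R * lg R N ^+ 7))).
    apply: squarefree_second_moment => // [n /andP[/odd_gt0]//|Y]; exact: quarter_sum_odd_moduli.
  apply: (ler_wpM2l B0); apply: ler_wpM2r; first exact: exprn_ge0.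
  by apply: ler_wpM2l => //; rewrite ler_nat leq_div.
have s2 := s23 2%N isT; have s3 := s23 3%N isT.
apply: (@le_trans _ _ (3 * \sum_(0 <= n < N.+1 | (0 < n)%N && ~~ is_square n) (squarefree_quarter_sum 1 X n ^+ 2)%:~R +
   3 * \sum_(0 <= n < N.+1 | odd n && ~~ is_square n) (squarefree_quarter_sum 2 (X %/ 4)%N n ^+ 2)%:~R +
   3 * \sum_(0 <= n < N.+1 | odd n && ~~ is_square n) (squarefree_quarter_sum 3 (X %/ 4)%N n ^+ 2)%:~R)).
  rewrite !mulr_sumr big_mkcond [X in _ <= X + _ + _]big_mkcond [X in _ <= _ + X + _]big_mkcond.
  rewrite [X in _ <= _ + X]big_mkcond -!big_split /=; apply: ler_sum => n _.
  have [n0|n0] := posnP n; first by rewrite n0 /= !addr0.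
  case: (is_square n); rewrite ?andbF ?addr0 // ?andbT /= disc_totalE //.
  rewrite rmorphXn rmorphD rmorphM rmorphD /= rmorph_nat.
  case: (odd n); rewrite ?mul1r ?mul0r ?addr0.
    by apply: le_trans (sum3_sqr_le _ _ _) _; rewrite !rmorphXn.
  rewrite rmorphXn /=; have := sqr_ge0 ((squarefree_quarter_sum 1 X n)%:~R : R).
  move: (_ ^+ 2) => x; lra.
rewrite /mean_const -/B; move: s1 s2 s3.
set x := \sum_(_ <= _ < _ | _) _; set y := \sum_(_ <= _ < _ | _) _; set z := \sum_(_ <= _ < _ | _) _.
set K := N%:R * _ * _; lra.
Qed.

End SquarefreeSieve.

(** * Residue conditions modulo M *)

Lemma square_mod_crt d M : squarefree M ->
  square_mod M d = all (fun p => square_mod p d) (primes M).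
Proof.
move=> sf; have M0 := squarefree_gt0 sf; apply/idP/allP => [/(square_modP _ M0)[y dy] p|].
  rewrite mem_primes => /and3P[prp _ pM]; apply/square_modP; first exact: prime_gt0.
  by exists y; rewrite -(modn_dvdm d pM) -(modn_dvdm (y ^ 2) pM) dy.
move: M M0 sf; apply: nat_mul_ind => [|p m prp m0 IH] sf H.
  by apply/square_modP => //; exists 0%N; rewrite !modn1.
have p0 := prime_gt0 prp.
have cop : coprime p m.
  rewrite prime_coprime //; apply/negP => pm; have /squarefreeP[_ /(_ p)] := sf.
  by rewrite -mulnn dvdn_mul // => /(_ isT) p1; rewrite p1 in prp.
have /(square_modP _ p0)[y1 dy1] : square_mod p d.
  by apply: H; rewrite primesM // primes_prime // inE eqxx.
have /(square_modP _ m0)[y2 dy2] : square_mod m d.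
  apply: IH; first by apply: squarefree_dvd sf; rewrite dvdn_mull.
  by move=> r rm; apply: H; rewrite primesM // rm orbT.
apply/square_modP; first by rewrite muln_gt0 p0.
exists (chinese p m y1 y2); apply/eqP; rewrite chinese_remainder //.
apply/andP; split; apply/eqP.
  by rewrite dy1 -[LHS]modnXm -(chinese_modl cop y1 y2) modnXm.
by rewrite dy2 -[LHS]modnXm -(chinese_modr cop y1 y2) modnXm.
Qed.

Lemma gcdn_sqr n k : (0 < n)%N -> gcdn (n ^ 2) (k ^ 2) = (gcdn n k ^ 2)%N.
Proof.
move=> n0; set g := gcdn n k; have g0 : (0 < g)%N by rewrite gcdn_gt0 n0.
have nE : n = (g * (n %/ g))%N by rewrite mulnC divnK // dvdn_gcdl.
have kE : k = (g * (k %/ g))%N by rewrite mulnC divnK // dvdn_gcdr.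
have cop : coprime (n %/ g) (k %/ g).
  by rewrite /coprime -(eqn_pmul2l g0) muln_gcdr -nE -kE muln1.
have /eqP c2 : coprime ((n %/ g) ^ 2) ((k %/ g) ^ 2) by rewrite coprimeXl ?coprimeXr.
by rewrite {1}nE {1}kE !expnMn -muln_gcdr c2 muln1.
Qed.

(** n is the square of gcd(n, k), because gcd(n^2, k^2) = gcd(n^2, n m) = n gcd(n, m) = n. *)
Lemma coprime_mul_square n m k : coprime n m -> (n * m = k ^ 2)%N -> is_square n.
Proof.
move=> /eqP cop E; apply/is_squareP; have [->|n0] := posnP n; first by exists 0%N.
exists (gcdn n k); rewrite -gcdn_sqr // -E -mulnn -muln_gcdr cop muln1 //.
Qed.

Section GeneralModulus.
Variable R : realType.
Variable M : nat.
Hypothesis sfM : squarefree M.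
Let M0 : (0 < M)%N := squarefree_gt0 sfM.

(** The prime 2 is omitted since every residue modulo 2 is a square. *)
Definition odd_primes_of := [seq p <- primes M | odd p].

Lemma odd_primes_of_prime : all prime odd_primes_of.
Proof. by apply/allP => p; rewrite mem_filter mem_primes => /and4P[]. Qed.

Lemma odd_primes_of_uniq : uniq odd_primes_of.
Proof. by rewrite filter_uniq // primes_uniq. Qed.

Lemma subprods_odd_primes_of m : m \in subprods odd_primes_of -> (0 < m)%N /\ (m %| M)%N.
Proof.
move=> mi; split; first exact: subprods_gt0 odd_primes_of_prime mi.
apply: dvdn_trans (subprods_dvd mi) _; apply: dvdn_trans (prod_primes_dvd M0).
by rewrite big_filter [X in (_ %| X)%N](bigID odd) /= dvdn_mulr.
Qed.

Lemma square_indicator d : coprime d M ->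
  (2 ^ size odd_primes_of)%N%:Z * (square_mod M d)%:R = \sum_(m <- subprods odd_primes_of) kronecker d m.
Proof.
move=> cdM; rewrite -(prod_one_add_subprods odd_primes_of_uniq odd_primes_of_prime).
- have -> : square_mod M d = all (fun p => square_mod p d) odd_primes_of.
    rewrite square_mod_crt // all_filter; apply: eq_in_all => p; rewrite mem_primes => /and3P[prp _ pM].
    case/even_prime: prp => [->|op] /=; last by rewrite op.
    by apply/square_modP => //; exists d; rewrite !modn2 oddX.
  have : forall p, p \in odd_primes_of -> [/\ prime p, odd p & ~~ (p %| d)%N].
    move=> p; rewrite mem_filter mem_primes => /and4P[op prp _ pM]; split=> //.
    by rewrite -prime_coprime // coprime_sym (coprime_dvdr pM cdM).
  elim: odd_primes_of => [|p ps IH] H; first by rewrite big_nil.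
  rewrite big_cons -IH; last by move=> q qi; apply: H; rewrite inE qi orbT.
  have [prp op pd] := H p (mem_head _ _).
  rewrite kronecker_prime_l // kronecker_prime_odd // (negbTE pd) /= expnS PoszM.
  case: (square_mod p d) => /=; last by rewrite subrr mul0r mulr0.
  by rewrite mulrA.
- exact: kronecker1.
move=> p m prp pm; rewrite kroneckerM ?(prime_gt0 prp) // lt0n.
by apply: contraNneq pm => ->.
Qed.

Definition twisted_sum X m n : int :=
  \sum_(1 <= d < X.+1 | even_fund_disc d && coprime d M) kronecker d m * kronecker d n.

(* The factor (M / m) ^ 2 forces d to be prime to M; it is the origin of the M ^ 2 in the bound. *)
Lemma twisted_sumE X m n : (m %| M)%N -> (0 < n)%N ->
  twisted_sum X m n = disc_total X (n * (m * (M %/ m) ^ 2)).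
Proof.
move=> mM n0; have m0 := dvdn_gt0 M0 mM.
have u0 : (0 < M %/ m)%N by rewrite divn_gt0 // dvdn_leq.
rewrite /twisted_sum /disc_total big_mkcondr /=; apply: eq_bigr => d _.
rewrite !kroneckerM ?muln_gt0 ?expn_gt0 ?m0 ?u0 // -expr2 kronecker_sqr //.
have -> : coprime d M = coprime d m && coprime d (M %/ m).
  by rewrite -coprimeMr mulnC divnK.
have [cm|cm] := boolP (coprime d m).
  by case: coprime; rewrite /= ?mulr1 ?mulr0 // mulrC.
by rewrite (kronecker_eq0 m0 cm) /= ?mul0r ?mulr0 ?mul0r.
Qed.

Definition level N := lg R (N * M ^ 2).

Lemma twisted_second_moment N X m : (m %| M)%N ->
  \sum_(2 <= n < N.+1 | coprime n M && ~~ is_square n) (twisted_sum X m n ^+ 2)%:~R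
    <= mean_const R * (N%:R * M%:R ^+ 2 * X%:R * level N ^+ 7) :> R.
Proof.
move=> mM; have m0 := dvdn_gt0 M0 mM.
have u0 : (0 < M %/ m)%N by rewrite divn_gt0 // dvdn_leq.
set c := (m * (M %/ m) ^ 2)%N; have c0 : (0 < c)%N by rewrite muln_gt0 m0 expn_gt0 u0.
have cM : (c <= M ^ 2)%N.
  have -> : (M ^ 2 = m * c)%N by rewrite /c mulnA mulnn -expnMn mulnC divnK.
  by rewrite leq_pmull.
pose F n : R := (disc_total X n ^+ 2)%:~R.
have F0 n : 0 <= F n by rewrite ler0z sqr_ge0.
apply: (@le_trans _ _ (\sum_(0 <= k < (N * c).+1 | (0 < k)%N && ~~ is_square k) F k)).
  rewrite big_nat_cond (eq_bigr (fun n => F (n * c)%N)); last first.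
    by move=> n /andP[/andP[n2 _] _]; rewrite twisted_sumE // (ltn_trans _ n2).
  rewrite -big_nat_cond -big_filter -(big_map (fun n => n * c)%N xpredT F) -[X in _ <= X]big_filter.
  apply: sum_sub_le => //.
    rewrite map_inj_uniq ?filter_uniq ?iota_uniq // => x y /eqP.
    by rewrite eqn_pmul2r // => /eqP.
  move=> k /mapP[n]; rewrite mem_filter mem_index_iota => /andP[/andP[cop nsq] /andP[n2 nN]] ->.
  have nN' : (n <= N)%N by rewrite -ltnS.
  rewrite mem_filter mem_index_iota /= ltnS leq_mul2r nN' orbT andbT muln_gt0 c0 (ltn_trans _ n2) //=.
  (* If n m (M / m)^2 is a square, so is n m; as n is prime to m, n itself would be a square. *)
  apply: contra nsq => /is_squareP[j jE].
  have /dvdnP[v vE] : (M %/ m %| j)%N by rewrite -(dvdn_pexp2r _ _ (isT : 0 < 2)%N) -jE mulnA dvdn_mull.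
  apply: (@coprime_mul_square n m v); first exact: coprime_dvdr mM cop.
  apply/eqP; rewrite -(eqn_pmul2r (_ : 0 < (M %/ m) ^ 2)%N) ?expn_gt0 ?u0 //.
  by rewrite -expnMn -vE -jE /c mulnA.
apply: le_trans (disc_total_second_moment R (N * c) X) _; apply: ler_wpM2l; first exact: mean_const_ge0.
apply: ler_pM; rewrite ?mulr_ge0 ?exprn_ge0 ?lg_ge0 //.
  by rewrite ler_wpM2r // natrM ler_wpM2l // -natrX ler_nat.
by rewrite lerXn2r ?nnegrE ?lg_ge0 // lg_le // leq_mul2l cM orbT.
Qed.

Definition residue_sum X n : int :=
  \sum_(1 <= d < X.+1 | even_fund_disc d && coprime d M) (square_mod M d)%:R * kronecker d n.

Lemma residue_sumE X n : (2 ^ size odd_primes_of)%N%:Z * residue_sum X n =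
  \sum_(m <- subprods odd_primes_of) twisted_sum X m n.
Proof.
rewrite mulr_sumr exchange_big /=; apply: eq_bigr => d /andP[_ cdM].
by rewrite mulrA square_indicator // mulr_suml.
Qed.

(** The sum over squares is the mean of 2^omega twisted sums, so Cauchy-Schwarz loses nothing in the
    number of divisors of M. *)
Lemma residue_second_moment N X :
  \sum_(2 <= n < N.+1 | coprime n M && ~~ is_square n) (residue_sum X n ^+ 2)%:~R
    <= mean_const R * (N%:R * M%:R ^+ 2 * X%:R * level N ^+ 7) :> R.
Proof.
set K := mean_const R * _; set s := subprods odd_primes_of.
have sz : (size s)%:R = (2 ^ size odd_primes_of)%N%:R :> R by rewrite size_subprods.
have s0 : 0 < (size s)%:R :> R by rewrite sz ltr0n expn_gt0.
rewrite -(ler_pM2l (exprn_gt0 2 s0)) mulr_sumr.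
apply: (@le_trans _ _ (\sum_(2 <= n < N.+1 | coprime n M && ~~ is_square n)
    (size s)%:R * \sum_(m <- s) (twisted_sum X m n ^+ 2)%:~R)).
  apply: ler_sum => n _; rewrite rmorphXn -exprMn.
  have -> : (size s)%:R * (residue_sum X n)%:~R = \sum_(m <- s) (twisted_sum X m n)%:~R :> R.
    by rewrite sz -mulrz_nat natz -intrM residue_sumE rmorph_sum.
  apply: le_trans (sqr_sum_le _ _) _; rewrite le_eqVlt; apply/orP; left; apply/eqP.
  by congr (_ * _); apply: eq_bigr => m _; rewrite rmorphXn.
rewrite -mulr_sumr exchange_big /= expr2 -mulrA ler_wpM2l ?(ltW s0) //.
rewrite mulrC -sum_const_seq big_seq [X in _ <= X]big_seq; apply: ler_sum => m mi.
by apply: twisted_second_moment; case: (subprods_odd_primes_of mi).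
Qed.

(** The twist by m = 1 carries no residue condition besides coprimality to M; subtracting the
    squares leaves the non-squares. *)
Lemma nonresidue_second_moment N X :
  \sum_(2 <= n < N.+1 | coprime n M && ~~ is_square n) ((twisted_sum X 1 n - residue_sum X n) ^+ 2)%:~R
    <= 4 * (mean_const R * (N%:R * M%:R ^+ 2 * X%:R * level N ^+ 7)) :> R.
Proof.
have a := twisted_second_moment N X (dvd1n M); have b := residue_second_moment N X.
apply: (@le_trans _ _ (2 * \sum_(2 <= n < N.+1 | coprime n M && ~~ is_square n) (twisted_sum X 1 n ^+ 2)%:~R +
   2 * \sum_(2 <= n < N.+1 | coprime n M && ~~ is_square n) (residue_sum X n ^+ 2)%:~R)).
  rewrite !mulr_sumr -big_split; apply: ler_sum => n _ /=.
  rewrite -!(intrM _ 2) -intrD ler_int.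
  by have := sqrD_le (twisted_sum X 1 n) (- residue_sum X n); rewrite sqrrN.
move: a b; set x := \sum_(_ <= _ < _ | _) _; set y := \sum_(_ <= _ < _ | _) _; set K := mean_const R * _; lra.
Qed.

(** For M > 1 a number prime to M is never 0 modulo M, so the square is automatically non-zero; for
    M = 1 both conditions hold for every d. *)
Lemma disc_sum_square (X : R) n :
  disc_sum M (nonzero_square_mod M) X n = residue_sum (Num.truncn X) n.
Proof.
rewrite /disc_sum /residue_sum [RHS]big_mkcond [LHS]big_mkcond; apply: eq_bigr => d _.
case: even_fund_disc => //=; case: (boolP (coprime d M)) => //= cdM.
suff -> : nonzero_square_mod M d = square_mod M d by case: square_mod; rewrite ?mul1r ?mul0r.
have [M1|M1] := leqP M 1.
  have ME : M = 1%N by apply/eqP; rewrite eqn_leq M1.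
  rewrite ME nonzero_square_mod1; apply/esym/square_modP => //.
  by exists 0%N; rewrite !modn1.
apply/(nonzero_square_modP _ M1)/(square_modP _ M0) => [[y dy _]|[y dy]]; exists y => //.
apply/negP => My; have : (M %| d)%N by rewrite /dvdn dy.
by move=> Md; move: cdM; rewrite coprime_sym /coprime (gcdn_idPl Md) => /eqP e; rewrite e in M1.
Qed.

Lemma disc_sum_nonsquare (X : R) n :
  disc_sum M (fun d => ~~ square_mod M d) X n =
  twisted_sum (Num.truncn X) 1 n - residue_sum (Num.truncn X) n.
Proof.
rewrite /twisted_sum /residue_sum -sumrB /disc_sum [RHS]big_mkcond [LHS]big_mkcond.
apply: eq_bigr => d _; case: even_fund_disc => //=; case: (coprime d M) => //=.
by rewrite kronecker1 mul1r; case: square_mod; rewrite /= ?mul1r ?mul0r ?subrr ?subr0.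
Qed.

End GeneralModulus.

(** The power of 2 comes from lg (N M^2) <= 2 lg (N M); the other factor replaces 1 + ln (N M) by a
    multiple of ln (N M), which is possible once N M >= 2. *)
Definition log_const (R : realType) : R := 2 ^+ 7 * (1 + (ln 2)^-1) ^+ 10.

Lemma second_moment_bound (R : realType) (M : nat) (P : pred nat) (N X c : R) :
  squarefree M -> 0 < N -> 0 < X -> 0 <= c ->
  (forall N' X' : nat, X' = Num.truncn X ->
    \sum_(2 <= n < N'.+1 | coprime n M && ~~ is_square n) (disc_sum M P X n ^+ 2)%:~R <=
      c * (N'%:R * M%:R ^+ 2 * X'%:R * level R M N' ^+ 7)) ->
  (nonsquare_second_moment M P N X)%:~R <=
    c * log_const R * (N * M%:R ^+ 2 * X * ln (N * M%:R) ^+ 10).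
Proof.
move=> sfM N0 X0 c0 H; have M0 := squarefree_gt0 sfM.
have ln2 : 0 < ln (2 : R) by rewrite ln_gt0 // ltr1n.
have lc0 : 0 <= log_const R by rewrite mulr_ge0 ?exprn_ge0 // addr_ge0 // invr_ge0 ltW.
have rhs0 : 0 <= N * M%:R ^+ 2 * X.
  by apply: mulr_ge0 (ltW X0); apply: mulr_ge0 (ltW N0) (sqr_ge0 _).
rewrite /nonsquare_second_moment rmorph_sum /=; set N' := Num.truncn N.
(* For N < 2 the sum is empty. Then N M may be less than 1 and its logarithm negative, but the
   exponent 10 is even. *)
have [N1|N2] := leqP N' 1.
  rewrite big_geq ?ltnS //; apply: mulr_ge0; first exact: mulr_ge0.
  by apply: mulr_ge0 => //; rewrite exprn_even_ge0.
apply: le_trans (H N' _ erefl) _; set X' := Num.truncn X.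
have NN : N'%:R <= N by rewrite truncn_le // ltW.
have XX : X'%:R <= X by rewrite truncn_le // ltW.
rewrite -[X in _ <= X]mulrA; apply: (ler_wpM2l c0).
have MR : 1 <= M%:R :> R by rewrite ler1n.
have NM2 : 2 <= N'%:R * M%:R :> R by rewrite -natrM ler_nat (leq_trans N2) // leq_pmulr.
have Nx : N'%:R * M%:R <= N * M%:R by rewrite ler_wpM2r.
set l := ln (N * M%:R).
have l2 : ln 2 <= l by rewrite ler_ln ?posrE ?(lt_le_trans _ (le_trans NM2 Nx)) // (le_trans NM2).
have lg1 : lg R (N' * M) <= (1 + (ln 2)^-1) * l.
  have : lg R (N' * M) <= 1 + l.
    rewrite lgE lerD2l natrM ler_ln ?posrE //; last exact: lt_le_trans (le_trans NM2 Nx).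
    exact: lt_le_trans NM2.
  move=> h; apply: le_trans h _; rewrite mulrDl mul1r addrC lerD2l.
  by rewrite mulrC ler_pdivlMr // mul1r.
have lv : level R M N' ^+ 7 <= log_const R * l ^+ 10.
  have h : level R M N' <= 2 * lg R (N' * M).
    apply: le_trans (lgX2 _ _); apply: lg_le; rewrite expnMn leq_mul2r -mulnn leq_pmulr ?orbT //.
    exact: leq_trans N2.
  have g1 := lg_ge1 R (N' * M).
  apply: (@le_trans _ _ ((2 * lg R (N' * M)) ^+ 7)).
    by rewrite lerXn2r ?nnegrE ?mulr_ge0 ?lg_ge0.
  rewrite exprMn /log_const -[X in _ <= X]mulrA ler_wpM2l ?exprn_ge0 // -exprMn.
  apply: (@le_trans _ _ (lg R (N' * M) ^+ 10)).
    by rewrite (_ : 10 = 3 + 7)%N // exprD ler_peMl ?exprn_ge0 ?lg_ge0 // exprn_ege1.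
  by rewrite lerXn2r ?nnegrE ?lg_ge0 // (le_trans _ lg1) ?lg_ge0.
have [M2 X0'] : 0 <= M%:R ^+ 2 :> R /\ 0 <= X'%:R :> R by rewrite sqr_ge0.
have L0 : 0 <= level R M N' ^+ 7 by rewrite exprn_ge0 // lg_ge0.
have -> : log_const R * (N * M%:R ^+ 2 * X * l ^+ 10) = N * M%:R ^+ 2 * X * (log_const R * l ^+ 10).
  by rewrite mulrCA.
have NM : N'%:R * M%:R ^+ 2 <= N * M%:R ^+ 2 by rewrite ler_wpM2r.
have NM0 : 0 <= N'%:R * M%:R ^+ 2 :> R by apply: mulr_ge0.
exact: ler_pM (mulr_ge0 NM0 X0') L0 (ler_pM NM0 X0' NM XX) lv.
Qed.

Theorem theorem4p1 (R : realType) :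
  (exists2 C : R, 0 < C &
     forall (M : nat) (N X : R), squarefree M -> 0 < N -> 0 < X ->
       (nonsquare_second_moment M (nonzero_square_mod M) N X)%:~R
         <= C * (N * M%:R ^+ 2 * X * ln (N * M%:R) ^+ 10)) /\
  (exists2 C : R, 0 < C &
     forall (M : nat) (N X : R), squarefree M -> 0 < N -> 0 < X ->
       (nonsquare_second_moment M (fun d => ~~ square_mod M d) N X)%:~R
         <= C * (N * M%:R ^+ 2 * X * ln (N * M%:R) ^+ 10)).
Proof.
have lc : 0 < log_const R.
  have l2 : 0 < ln (2 : R) by rewrite ln_gt0 // ltr1n.
  by rewrite mulr_gt0 ?exprn_gt0 // addr_gt0 // invr_gt0.
have mc : 0 < mean_const R.
  have m0 : 0 < moment_const R by have := class_const_ge0 R; rewrite /moment_const; lra.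
  apply: mulr_gt0 => //; apply: (mulr_gt0 m0); rewrite exprn_gt0 // addr_gt0 //.
  exact: lg_gt0.
split.
  exists (mean_const R * log_const R); first exact: mulr_gt0.
  move=> M N X sfM N0 X0; apply: second_moment_bound => //; first exact: ltW.
  move=> N' X' ->; under eq_bigr do rewrite disc_sum_square //.
  exact: residue_second_moment.
exists (4 * mean_const R * log_const R); first by rewrite mulr_gt0 // mulr_gt0.
move=> M N X sfM N0 X0; apply: second_moment_bound => //; first by rewrite mulr_ge0 // ltW.
move=> N' X' ->; under eq_bigr do rewrite disc_sum_nonsquare //.
by rewrite -[X in _ <= X]mulrA; apply: nonresidue_second_moment.
Qed.
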